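(* Let $(X,d,G)$ be a $G$-system and let $\{F_n\}$ be a tempered Følner sequence of $G$. Then $$\overline{\mathrm{mdim}}_M(G,X,d)=\max_{\mu\in M(X,G)}\overline{\mathrm{mdim}}_M(\mu,\{F_n\},d),$$ i.e. the supremum of the right-hand side over $M(X,G)$ equals the left-hand side and is attained by some $\mu\in M(X,G)$.
   Context: Throughout, $G$ is a countably infinite discrete amenable group. A $G$-system $(X,d,G)$ is a compact metric space $(X,d)$ with a continuous action $G\times X\to X$, $(g,x)\mapsto gx$, with $e_Gx=x$ and $g_1(g_2x)=(g_1g_2)x$. A Følner sequence is a sequence $\{F_n\}$ of nonempty finite subsets of $G$ with $|gF_n\triangle F_n|/|F_n|\to0$ for every $g\in G$; it is tempered if there is $C>0$ with $|\bigcup_{j<n}F_j^{-1}F_n|\le C|F_n|$ for all $n$. For finite $F\subset G$, $d_F(x,y)=\max_{g\in F}d(gx,gy)$. For nonempty $Z\subset X$, $s(Z,d_F,\epsilon)$ is the maximal cardinality of a set $S\subset Z$ with $d_F(x,y)>\epsilon$ for distinct $x,y\in S$, and $h_{top}(G,Z,d,\{F_n\},\epsilon)=\limsup_{n\to\infty}\frac{1}{|F_n|}\log s(Z,d_{F_n},\epsilon)$. The upper metric mean dimension of $X$ is $\overline{\mathrm{mdim}}_M(G,X,d)=\limsup_{\epsilon\to0}h_{top}(G,X,d,\{F_n\},\epsilon)/\log\frac1\epsilon$ (it does not depend on the Følner sequence). $M(X,G)$ is the set of $G$-invariant Borel probability measures on $X$ (weak* topology), $E(X,G)$ the ergodic ones,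 and $\mathrm{co}(E(X,G))$ the set of finite convex combinations of ergodic measures; each $\mu\in\mathrm{co}(E(X,G))$ is uniquely written $\mu=\sum_{j=1}^k\lambda_j\mu_j$ with distinct $\mu_j\in E(X,G)$, $\lambda_j>0$, $\sum_j\lambda_j=1$. For $\mu\in M(X,G)$ and a finite Borel partition $\alpha$, $h_\mu(G,\alpha)=\lim_n\frac{1}{|F_n|}H_\mu(\bigvee_{g\in F_n}g^{-1}\alpha)$. For ergodic $\nu$ and $\epsilon>0$ put $h_\nu(\epsilon)=\inf\{h_\nu(G,\alpha):\alpha\text{ finite Borel partition},\ \mathrm{diam}(\alpha)\le\epsilon\}$, and for $\mu=\sum_j\lambda_j\mu_j\in\mathrm{co}(E(X,G))$ put $F(\mu,\epsilon)=\sum_j\lambda_jh_{\mu_j}(\epsilon)$. For $\mu\in M(X,G)$, $M_G(\mu)$ is the set of families $(\mu_\epsilon)_{\epsilon>0}\subset\mathrm{co}(E(X,G))$ with $\mu_\epsilon\to\mu$ weak* as $\epsilon\to0$, and the upper measure-theoretic metric mean dimension is $$\overline{\mathrm{mdim}}_M(\mu,\{F_n\},d)=\sup_{(\mu_\epsilon)\in M_G(\mu)}\limsup_{\epsilon\to0}\frac{F(\mu_\epsilon,\epsilon)}{\log\frac1\epsilon}.$$ (The paper defines $F$ using any of several measure-theoretic $\epsilon$-entropies of ergodic measures along the tempered sequence $\{F_n\}$, e.g. the upper Katok $\epsilon$-entropy; the resulting quantity is the same as with the Kolmogorov–Sinai version used here.) *)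

(* Defs.v *)
From HB Require Import structures.
From mathcomp Require Import all_boot all_order all_algebra finmap.
From mathcomp Require Import all_classical all_reals all_analysis.

Set Implicit Arguments.
Unset Strict Implicit.
Unset Printing Implicit Defensive.

Import Order.TTheory GRing.Theory Num.Theory.
Import numFieldNormedType.Exports.

Local Open Scope classical_set_scope.

Local Open Scope ring_scope.

Definition is_group (G : Type) (mul : G -> G -> G) (one : G) (inv : G -> G) :=
  [/\ forall a b c, mul a (mul b c) = mul (mul a b) c,
      forall a, mul one a = a,
      forall a, mul a one = a,
      forall a, mul (inv a) a = one &
      forall a, mul a (inv a) = one].

Definition ltrans (G : choiceType) (mul : G -> G -> G) (g : G) (F : {fset G})
  : {fset G} := [fset mul g x | x in F]%fset.

Definition invprod (G : choiceType) (mul : G -> G -> G) (inv : G -> G)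
  (A B : {fset G}) : {fset G} := [fset mul (inv a) b | a in A, b in B]%fset.

Definition fsymdiff (G : choiceType) (A B : {fset G}) : {fset G} :=
  ((A `\` B) `|` (B `\` A))%fset.

Definition Folner (R : realType) (G : choiceType) (mul : G -> G -> G)
  (F : nat -> {fset G}) :=
  (forall n, F n != fset0) /\
  forall g, (fun n => (#|` fsymdiff (ltrans mul g (F n)) (F n)|%:R
                       / #|` F n|%:R : R)) @ \oo --> (0 : R).

Definition tempered (R : realType) (G : choiceType) (mul : G -> G -> G)
  (inv : G -> G) (F : nat -> {fset G}) :=
  exists C : R, 0 < C /\
    forall n, (#|` (\bigcup_(j <- iota 0 n) invprod mul inv (F j) (F n))%fset|%:R : R)
              <= C * #|` F n|%:R.

Definition is_metric (R : realType) (X : Type) (d : X -> X -> R) :=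
  [/\ forall x y, 0 <= d x y,
      forall x y, d x y = 0 <-> x = y,
      forall x y, d x y = d y x &
      forall x y z, d x z <= d x y + d y z].

Definition dball (R : realType) (X : Type) (d : X -> X -> R) (x : X) (r : R)
  : set X := [set y | d x y < r].

Definition dopen (R : realType) (X : Type) (d : X -> X -> R) (U : set X) :=
  forall x, U x -> exists r : R, 0 < r /\ dball d x r `<=` U.

Definition dcompact (R : realType) (X : Type) (d : X -> X -> R) :=
  forall C : set (set X), (forall U, C U -> dopen d U) ->
    setT `<=` \bigcup_(U in C) U ->
    exists s : seq (set X), (forall U, U \in s -> C U) /\
                            setT `<=` \bigcup_(U in [set` s]) U.

Definition dcontinuous (R : realType) (X Y : Type) (dX : X -> X -> R)
  (dY : Y -> Y -> R) (f : X -> Y) :=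
  forall x (e : R), 0 < e -> exists del : R, 0 < del /\
    forall y, dX x y < del -> dY (f x) (f y) < e.

Definition realdist (R : realType) (a b : R) : R := `|a - b|.

Definition is_action (G X : Type) (mul : G -> G -> G) (one : G)
  (act : G -> X -> X) :=
  (forall x, act one x = x) /\
  (forall g1 g2 x, act g1 (act g2 x) = act (mul g1 g2) x).

Local Open Scope ereal_scope.

Definition elimsup (R : realType) (u : nat -> \bar R) : \bar R :=
  ereal_inf [set ereal_sup [set u n | n in [set n | (N <= n)%N]] | N in setT].

Definition elimsup0 (R : realType) (f : R -> \bar R) : \bar R :=
  ereal_inf [set ereal_sup [set f e | e in [set e | (0 < e < del)%R]]
            | del in [set del | (0 < del)%R]].

Definition eln (R : realType) (x : \bar R) : \bar R :=
  match x with
  | EFin r => (ln r)%:E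
  | +oo => +oo
  | -oo => -oo
  end.

Local Close Scope ereal_scope.

Section Top.
Context (R : realType) (G : choiceType) (X : choiceType).
Context (d : X -> X -> R) (act : G -> X -> X).

Definition dF (F : {fset G}) (x y : X) : R :=
  \big[Num.max/0]_(g <- enum_fset F) d (act g x) (act g y).

Definition separated (F : {fset G}) (eps : R) (S : {fset X}) :=
  forall x y, x \in S -> y \in S -> x != y -> eps < dF F x y.

Definition sep_num (F : {fset G}) (eps : R) : \bar R :=
  ereal_sup [set (#|` S|%:R)%:E | S in [set S | separated F eps S]].

Definition htop_eps (Fn : nat -> {fset G}) (eps : R) : \bar R :=
  elimsup (fun n => ((#|` Fn n|%:R)^-1)%:E * eln (sep_num (Fn n) eps))%E.

Definition mdimM_top (Fn : nat -> {fset G}) : \bar R :=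
  elimsup0 (fun eps => htop_eps Fn eps * ((ln (1 / eps))^-1)%:E)%E.

End Top.

Section Meas.
Context (R : realType) (G : choiceType) (dsp : measure_display)
  (X : measurableType dsp).
Context (d : X -> X -> R) (act : G -> X -> X).

Definition invariant_measure (mu : probability X R) :=
  forall g (A : set X), measurable A -> mu (act g @^-1` A) = mu A.

Definition invariant_set (A : set X) := forall g, act g @^-1` A = A.

Definition ergodic (mu : probability X R) :=
  invariant_measure mu /\
  forall A, measurable A -> invariant_set A -> mu A = 0%E \/ mu A = 1%E.

Definition is_partition (m : nat) (P : 'I_m -> set X) :=
  [/\ forall i, measurable (P i),
      forall i j, i != j -> P i `&` P j = set0 &
      \bigcup_(i in setT) P i = setT].

Definition diam_le (m : nat) (P : 'I_m -> set X) (eps : R) :=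
  forall i x y, P i x -> P i y -> d x y <= eps.

Definition etaR (t : R) : R := if t == 0 then 0 else - (t * ln t).

(* H_mu (\/_{g in F} g^{-1} alpha): atoms are indexed by w : F -> 'I_m *)
Definition Hjoin (mu : probability X R) (F : {fset G}) (m : nat)
  (P : 'I_m -> set X) : R :=
  \sum_(w : {ffun F -> 'I_m})
     etaR (fine (mu (\bigcap_(g in [set: F]) act (fsval g) @^-1` P (w g)))).

Definition hpart (Fn : nat -> {fset G}) (mu : probability X R) (m : nat)
  (P : 'I_m -> set X) : R :=
  limn (fun n => (#|` Fn n|%:R)^-1 * Hjoin mu (Fn n) P).

Definition h_eps (Fn : nat -> {fset G}) (nu : probability X R) (eps : R)
  : \bar R :=
  ereal_inf [set (hpart Fn nu (projT2 p))%:E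
            | p in [set p : {m : nat & 'I_m -> set X} |
                     is_partition (projT2 p) /\ diam_le (projT2 p) eps]].

(* A finite convex combination  sum_j lam_j nu_j  (as data) *)
Record ecomb := ECombo {
  ec_k : nat;
  ec_lam : 'I_ec_k -> R;
  ec_nu : 'I_ec_k -> probability X R }.

Arguments ec_lam : clear implicits.
Arguments ec_nu : clear implicits.

Definition is_decomp (mu : probability X R) (c : ecomb) :=
  [/\ forall j, 0 < ec_lam c j,
      \sum_j ec_lam c j = 1,
      injective (ec_nu c),
      forall j, ergodic (ec_nu c j) &
      forall A, measurable A ->
        mu A = (\sum_j (ec_lam c j)%:E * ec_nu c j A)%E].

(* F(mu, eps) computed from the (unique) ergodic decomposition *)
Definition Fval (Fn : nat -> {fset G}) (c : ecomb) (eps : R) : \bar R :=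
  (\sum_j (ec_lam c j)%:E * h_eps Fn (ec_nu c j) eps)%E.

Definition weak_cvg0 (mus : R -> probability X R) (mu : probability X R) :=
  forall f : X -> R, dcontinuous d (@realdist R) f ->
    (fun e => (\int[mus e]_x (f x)%:E)%E) @ (0 : R)^'+ -->
      (\int[mu]_x (f x)%:E)%E.

(* families in M_G(mu), represented with their ergodic decompositions *)
Definition MG (mu : probability X R) (fam : R -> ecomb) :=
  exists mus : R -> probability X R,
    (forall e, 0 < e -> is_decomp (mus e) (fam e)) /\ weak_cvg0 mus mu.

Definition mdimM_meas (Fn : nat -> {fset G}) (mu : probability X R) : \bar R :=
  ereal_sup [set elimsup0 (fun eps => Fval Fn (fam eps) eps
                                       * ((ln (1 / eps))^-1)%:E)%E
            | fam in [set fam | MG mu fam]].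

End Meas.

(* Main.v *)
Require Import Defs.
From HB Require Import structures.
From mathcomp Require Import all_boot all_order all_algebra finmap.
From mathcomp Require Import all_classical all_reals all_analysis measurable_realfun.
From mathcomp Require Import ring lra.

(* The upper bound rests on h_nu(eps) <= h_top(eps/2) + 11 for ergodic nu.  If almost
   all stabilisers are infinite, every partition has zero entropy.  Otherwise
   almost all stabilisers are finite of bounded size, an Ornstein-Weiss quasi-tiling
   of X by Folner sets exists, and labelling each point by its tile and by the Bowen
   ball containing the centre gives a partition of diameter at most eps whose
   itineraries can be counted.  The difference is negligible against ln (1/eps).

   For the lower bound, uniform measures on separated sets yield, for c < h_top(eps),
   an invariant measure all of whose partitions of diameter < eps have entropy at
   least c (Misiurewicz).  For maximal c this property is inherited by the parts of
   an invariant splitting, and a lexicographic minimisation over a countable base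
   makes the measure ergodic.  The measures obtained along a sequence of scales
   realising the limsup subconverge to a measure mu, and a family in M_G(mu) that
   takes these values at these scales attains the metric mean dimension.

   Entropies along Folner sequences are handled through Shearer's inequality, which
   identifies the limit with the infimum of H(K)/|K| over finite sets K. *)

Set Implicit Arguments.
Unset Strict Implicit.
Unset Printing Implicit Defensive.

Import Order.TTheory GRing.Theory Num.Theory.
Import numFieldNormedType.Exports.

Local Open Scope classical_set_scope.
Local Open Scope ring_scope.

(** * Shannon entropy *)

Section FiniteDistributions.
Context (R : realType).
Implicit Types (p q t : R).

(** The two inequalities meet different obstacles. [h_eps] is an infimum over partitions, so the
    upper bound must exhibit one partition of small diameter whose entropy rate is controlled by
    separated sets; in an arbitrary one, a single Bowen ball can meet exponentially many
    itineraries, so a cell has to prescribe a whole stretch of the orbit at once. Since the action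
    need not be free, t x = t' x may occur inside a tile; bounded stabilisers keep such
    multiplicities bounded. The lower bound needs one ergodic measure that works for every fine
    partition simultaneously. Instead of passing to an ergodic component, the bound is kept in the
    form c |K| <= H(K) for all finite K, a condition stable under limits, and ergodicity is reached
    by extremality. Ultralimits of measures exist on all Borel sets but are only finitely additive,
    hence [fap]; partitions whose cells have charged boundary are handled by approximating the cells
    from inside by closed sets. *)

Lemma etaRE t : etaR t = - (t * ln t).
Proof. by rewrite /etaR; case: eqP => // ->; rewrite mul0r oppr0. Qed.

Lemma etaR0 : etaR (0 : R) = 0. Proof. by rewrite /etaR eqxx. Qed.
Lemma etaR1 : etaR (1 : R) = 0. Proof. by rewrite etaRE ln1 mulr0 oppr0. Qed.

Lemma ln_le_sub1 t : 0 < t -> ln t <= t - 1.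
Proof.
move=> t0; have := @expR_ge1Dx R (ln t); rewrite lnK ?posrE//; lra.
Qed.

Lemma ln_opp_le p q : 0 < p -> 0 < q -> q^-1 <= p -> - ln p <= ln q.
Proof.
move=> p0 q0 qp; rewrite lerNl -lnV ?posrE// ler_ln ?posrE//.
by rewrite invr_gt0.
Qed.

(** This is ln x <= x - 1 at x = q / p, multiplied by p. The correction q - p is kept, so that after
    summation only the total masses of P and Q have to be compared. *)
Lemma gibbs_pointwise p q : 0 <= p -> 0 <= q -> (q = 0 -> p = 0) ->
  etaR p <= - (p * ln q) + (q - p).
Proof.
move=> p0 q0 qp; rewrite etaRE.
have [->|pn0] := eqVneq p 0; first by rewrite !mul0r oppr0 add0r addr0.
have pgt0 : 0 < p by rewrite lt_def pn0.
have qgt0 : 0 < q by rewrite lt_def q0 andbT; apply/eqP => /qp /eqP; rewrite (negbTE pn0).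
have := @ln_le_sub1 (q / p) (divr_gt0 qgt0 pgt0).
rewrite ln_div ?posrE// => h.
have : p * (ln q - ln p) <= p * (q / p - 1) by rewrite ler_pM2l.
by rewrite !mulrBr mulr1 mulrCA divff ?mulr1//; lra.
Qed.

Lemma etaR_ge0 p : p <= 1 -> 0 <= etaR p.
Proof.
move=> p1; rewrite etaRE; have [p0|p0] := ltP 0 p; last first.
  by rewrite ln0 // mulr0 oppr0.
by rewrite oppr_ge0 pmulr_rle0// ln_le0.
Qed.

Lemma etaR_le1 p : 0 <= p -> p <= 1 -> etaR p <= 1.
Proof.
move=> p0 p1.
have := @gibbs_pointwise p 1 p0 ler01; rewrite ln1 mulr0 oppr0 add0r.
by move=> h; have := h (fun e => False_ind _ (negP (oner_neq0 R) (introT eqP e))); lra.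
Qed.

Context (A : finType).
Implicit Types (P Q : A -> R).

Lemma gibbs P Q : (forall a, 0 <= P a) -> (forall a, 0 <= Q a) ->
  (forall a, Q a = 0 -> P a = 0) -> \sum_a Q a <= \sum_a P a ->
  \sum_a etaR (P a) <= \sum_a - (P a * ln (Q a)).
Proof.
move=> P0 Q0 QP S.
apply: (@le_trans _ _ (\sum_a (- (P a * ln (Q a)) + (Q a - P a)))).
  by apply: ler_sum => a _; exact: gibbs_pointwise (P0 a) (Q0 a) (@QP a).
by rewrite big_split /= sumrB; lra.
Qed.

(** Gibbs' inequality against q, half of whose mass is uniform on N and half uniform on A: a point
    of N costs ln 2 + ln |N|, any other point ln 2 + ln |A|. *)
Lemma sum_etaR_support P (N : {set A}) : (forall a, 0 <= P a) ->
  \sum_a P a = 1 ->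
  \sum_a etaR (P a)
    <= ln 2 + ln (#|N|%:R) + (\sum_(a in ~: N) P a) * ln (#|A|%:R).
Proof.
move=> P0 P1.
have A0 : (0 < #|A|)%N.
  rewrite lt0n; apply/negP => /eqP A0; move: P1; rewrite big1 => [/eqP|a _].
    by rewrite eq_sym oner_eq0.
  by have := card0_eq A0 a; rewrite inE.
have cA : 0 < (#|A|%:R : R) by rewrite ltr0n.
pose q a : R := (if a \in N then (2 * #|N|%:R)^-1 else 0) + (2 * #|A|%:R)^-1.
have i0 : 0 < (2 * #|A|%:R : R)^-1 by rewrite invr_gt0 mulr_gt0.
have q0 a : 0 < q a.
  rewrite /q; case: ifP => _; last by rewrite add0r.
  by rewrite ltr_wpDl // invr_ge0 mulr_ge0.
apply: (le_trans (@gibbs P q P0 (fun a => ltW (q0 a)) _ _)).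
- by move=> a qa; move: (q0 a); rewrite qa ltxx.
- rewrite P1 big_split /= -big_mkcond /= !sumr_const.
  rewrite -[X in X + _](mulr_natl (2 * _)^-1) -[X in _ + X](mulr_natl (2 * _)^-1) !invfM !(mulrCA _ 2^-1).
  rewrite [in X in _ + X]divff ?lt0r_neq0//.
  have [->|Nn] := posnP #|N|; first by rewrite mul0r; lra.
  by rewrite divff ?lt0r_neq0 ?ltr0n//; lra.
have key a : - (P a * ln (q a))
    <= P a * (ln 2 + ln #|N|%:R) + (if a \in ~: N then P a else 0) * ln #|A|%:R.
  rewrite -mulrN finset.in_setC; case: ifPn => aN.
  - have : - ln (q a) <= ln 2 + ln #|A|%:R.
      rewrite -lnM ?posrE// ln_opp_le ?mulr_gt0//.
      by rewrite /q (negbTE aN) add0r.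
    move=> /(ler_wpM2l (P0 a)) h; apply: (le_trans h).
    have [->|Nn] := posnP #|N|; first by rewrite (@ln0 _ 0)// !mulrDr; lra.
    have : 0 <= P a * ln #|N|%:R.
      by rewrite mulr_ge0// ln_ge0// ler1n.
    by rewrite !mulrDr; lra.
  - rewrite mul0r addr0 ler_wpM2l//; rewrite negbK in aN.
    have cN : 0 < (#|N|%:R : R) by rewrite ltr0n card_gt0; apply/finset.set0Pn; exists a.
    rewrite -lnM ?posrE// ln_opp_le ?mulr_gt0//.
      by rewrite /q aN lerDl ltW.
apply: (le_trans (ler_sum _ (fun a _ => key a))).
by rewrite big_split /= -mulr_suml P1 mul1r -mulr_suml -big_mkcond /=.
Qed.

Lemma etaR_subadd p q : 0 <= p -> 0 <= q -> etaR (p + q) <= etaR p + etaR q.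
Proof.
move=> p0 q0; rewrite !etaRE mulrDl opprD.
have aux x y : 0 <= x -> 0 <= y -> - (x * ln (x + y)) <= - (x * ln x).
  move=> x0 y0; have [->|xn] := eqVneq x 0; first by rewrite !mul0r.
  have xp : 0 < x by rewrite lt_def xn.
  by rewrite lerN2 ler_pM2l// ler_ln ?posrE// ?lerDl// ltr_wpDr.
by apply: lerD; [exact: aux|rewrite addrC; exact: aux].
Qed.

Lemma etaR_sum_le (I : finType) (D : pred I) (f : I -> R) :
  (forall i, 0 <= f i) ->
  etaR (\sum_(i | D i) f i) <= \sum_(i | D i) etaR (f i).
Proof.
move=> f0.
suff : 0 <= \sum_(i | D i) f i /\
  etaR (\sum_(i | D i) f i) <= \sum_(i | D i) etaR (f i) by case.
elim/big_rec2 : _ => [|i x y Di [y0 yx]]; first by rewrite etaR0 lexx.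
split; first exact: addr_ge0.
by apply: (le_trans (etaR_subadd (f0 i) y0)); rewrite lerD2l.
Qed.

Lemma etaR_mul p q : 0 <= p -> 0 <= q -> etaR (p * q) = p * etaR q + q * etaR p.
Proof.
move=> p0 q0; rewrite !etaRE.
have [->|pn] := eqVneq p 0; first by rewrite !(mul0r,mulr0,oppr0,addr0).
have [->|qn] := eqVneq q 0; first by rewrite !(mul0r,mulr0,oppr0,addr0).
by rewrite lnM ?posrE ?lt_def ?pn ?qn//; ring.
Qed.

(** Gibbs with the constant mean as reference; the corrections cancel because the deviations from
    the mean add up to zero. *)
Lemma etaR_concave_mean (I : finType) (f : I -> R) : (0 < #|I|)%N ->
  (forall i, 0 <= f i) ->
  \sum_i etaR (f i) <= #|I|%:R * etaR (#|I|%:R^-1 * \sum_i f i).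
Proof.
move=> I0 f0; set c : R := #|I|%:R; have c0 : 0 < c by rewrite ltr0n.
set m := c^-1 * _.
have m0 : 0 <= m by rewrite mulr_ge0 ?invr_ge0 ?sumr_ge0// ltW.
have E : \sum_i f i = c * m by rewrite /m mulrA divff ?mul1r// lt0r_neq0.
apply: (@le_trans _ _ (\sum_i (- (f i * ln m) + (m - f i)))).
  apply: ler_sum => i _; apply: gibbs_pointwise => // m00.
  have : \sum_i f i = 0 by rewrite E m00 mulr0.
  by move=> /psumr_eq0P -> //.
rewrite big_split /= sumrN -mulr_suml sumrB sumr_const cardT -cardE -mulr_natr E etaRE.
by rewrite -/c le_eqVlt; apply/orP; left; apply/eqP; ring.
Qed.

End FiniteDistributions.

(** * Entropy for finitely additive measures *)

Section FinitelyAdditive.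
Context (R : realType) (dsp : measure_display) (X : measurableType dsp).
Implicit Types (m : set X -> R) (A B C : finType).

(* Measures are only required to be finitely additive, so that the theory applies
   to ultralimits; a finite partition is a labelling by a finite type. *)
Definition fap m := [/\ forall E, measurable E -> 0 <= m E, m setT = 1 &
  forall E F, measurable E -> measurable F -> E `&` F = set0 ->
    m (E `|` F) = m E + m F].

Definition fmeas A (f : X -> A) := forall a, measurable (f @^-1` [set a]).
Definition law m A (f : X -> A) (a : A) := m (f @^-1` [set a]).
Definition ent m A (f : X -> A) := \sum_a etaR (law m f a).

Lemma fap_ge0 m E : fap m -> measurable E -> 0 <= m E.
Proof. by case => + _ _; exact. Qed.

Lemma fapT m : fap m -> m setT = 1. Proof. by case. Qed.

Lemma fapU m E F : fap m -> measurable E -> measurable F ->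
  E `&` F = set0 -> m (E `|` F) = m E + m F.
Proof. by case => _ _; exact. Qed.

Lemma fap0 m : fap m -> m set0 = 0.
Proof.
move=> hm; have := fapU hm measurable0 measurable0 (setI0 _).
by rewrite setU0 => /eqP; rewrite -subr_eq0 opprD addNKr oppr_eq0 => /eqP.
Qed.

Lemma fap_split m E F : fap m -> measurable E -> measurable F ->
  m E = m (E `&` F) + m (E `\` F).
Proof.
move=> hm mE mF; rewrite -fapU//; [|exact: measurableI|exact: measurableD|].
  by rewrite setUIDK.
by rewrite setDE setIACA setICr setI0.
Qed.

Lemma fap_le m E F : fap m -> measurable E -> measurable F -> E `<=` F ->
  m E <= m F.
Proof.
move=> hm mE mF EF; rewrite (fap_split hm mF mE) (setIidr EF) lerDl.
by apply: fap_ge0 => //; exact: measurableD.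
Qed.

Lemma fap_le1 m E : fap m -> measurable E -> m E <= 1.
Proof. by move=> hm mE; rewrite -(fapT hm); apply: fap_le. Qed.

Lemma fapC m E : fap m -> measurable E -> m (~` E) = 1 - m E.
Proof.
move=> hm mE; rewrite -(fapT hm) (fap_split hm measurableT mE) setTI setTD.
by rewrite addrC addKr.
Qed.

Lemma fapU_le m E F : fap m -> measurable E -> measurable F ->
  m (E `|` F) <= m E + m F.
Proof.
move=> hm mE mF; rewrite -(setDUK (@subsetUl _ E F)) fapU//; last 2 first.
- by apply: measurableD => //; exact: measurableU.
- by rewrite setIDA setIC -setIDA setDv setI0.
rewrite lerD2l; apply: fap_le => //; first by apply: measurableD => //; exact: measurableU.
by move=> x [[//|//]].
Qed.

Lemma bigU_measurable (I : Type) (s : seq I) (D : pred I) (B : I -> set X) :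
  (forall i, D i -> measurable (B i)) ->
  measurable (\big[setU/set0]_(i <- s | D i) B i).
Proof. by move=> mB; apply: bigsetU_measurable. Qed.

Lemma fap_sum m (I : eqType) (s : seq I) (D : pred I) (B : I -> set X) :
  fap m -> uniq s -> (forall i, D i -> measurable (B i)) ->
  (forall i j, D i -> D j -> i != j -> B i `&` B j = set0) ->
  m (\big[setU/set0]_(i <- s | D i) B i) = \sum_(i <- s | D i) m (B i).
Proof.
move=> hm + mB dB; elim: s => [_|i s IH /= /andP[is_ us]].
  by rewrite !big_nil fap0.
rewrite !big_cons; case: ifPn => Di; last exact: IH.
rewrite fapU ?IH//; [exact: mB|exact: bigU_measurable|].
rewrite big_distrr /= big_seq_cond big1// => j /andP[js Dj].
by apply: dB => //; apply: contraNneq is_ => ->.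
Qed.

Lemma fap_sum_le m (I : Type) (s : seq I) (D : pred I) (B : I -> set X) :
  fap m -> (forall i, D i -> measurable (B i)) ->
  m (\big[setU/set0]_(i <- s | D i) B i) <= \sum_(i <- s | D i) m (B i).
Proof.
move=> hm mB; elim: s => [|i s IH]; first by rewrite !big_nil fap0.
rewrite !big_cons; case: ifPn => Di //.
by apply: (le_trans (fapU_le hm (mB _ Di) (bigU_measurable s mB))); rewrite lerD2l.
Qed.

Lemma in_bigU (I : eqType) (s : seq I) (D : pred I) (B : I -> set X) x :
  (\big[setU/set0]_(i <- s | D i) B i) x <->
  exists i, [/\ i \in s, D i & B i x].
Proof.
elim: s => [|j s IH]; first by rewrite big_nil; split => // -[i []].
rewrite big_cons; case: ifPn => Dj; split.
- case=> [Bx|/IH[i [is_ Di Bi]]]; first by exists j; rewrite mem_head.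
  by exists i; rewrite inE is_ orbT.
- case=> i []; rewrite inE => /orP[/eqP-> _ Bx|is_ Di Bi]; first by left.
  by right; apply/IH; exists i.
- by move/IH => [i [is_ Di Bi]]; exists i; rewrite inE is_ orbT.
- case=> i []; rewrite inE => /orP[/eqP->|is_ Di Bi]; first by rewrite (negbTE Dj).
  by apply/IH; exists i.
Qed.

Lemma preimage_pred A (f : X -> A) (D : pred A) :
  [set x | D (f x)] = \big[setU/set0]_(a <- enum A | D a) (f @^-1` [set a]).
Proof.
apply/seteqP; split => x /=; last first.
  by move=> /in_bigU[a [_ Da /= ->]].
by move=> Dx; apply/in_bigU; exists (f x); rewrite mem_enum.
Qed.

Lemma fmeas_pred A (f : X -> A) (D : pred A) : fmeas f ->
  measurable [set x | D (f x)].
Proof. by move=> mf; rewrite preimage_pred; apply: bigU_measurable. Qed.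

Lemma fmeas_comp A B (f : X -> A) (phi : A -> B) : fmeas f -> fmeas (phi \o f).
Proof.
move=> mf b; rewrite (_ : _ @^-1` _ = [set x | phi (f x) == b]).
  exact: (fmeas_pred (fun a => phi a == b)).
by apply/seteqP; split => x /= /eqP.
Qed.

Lemma fmeas_pair A B (f : X -> A) (g : X -> B) : fmeas f -> fmeas g ->
  fmeas (fun x => (f x, g x)).
Proof.
move=> mf mg [a b]; rewrite (_ : _ @^-1` _ = f @^-1` [set a] `&` g @^-1` [set b]).
  exact: measurableI.
by apply/seteqP; split => x /= [-> ->].
Qed.

Lemma law_ge0 m A (f : X -> A) a : fap m -> fmeas f -> 0 <= law m f a.
Proof. by move=> hm mf; apply: fap_ge0. Qed.

Lemma law_pred m A (f : X -> A) (D : pred A) : fap m -> fmeas f ->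
  m [set x | D (f x)] = \sum_(a | D a) law m f a.
Proof.
move=> hm mf; rewrite preimage_pred fap_sum ?enum_uniq//.
  by rewrite big_enum_cond.
move=> a b _ _ ab; apply/seteqP; split => x //= [-> ba].
by rewrite ba eqxx in ab.
Qed.

Lemma law_comp m A B (f : X -> A) (phi : A -> B) b : fap m -> fmeas f ->
  law m (phi \o f) b = \sum_(a | phi a == b) law m f a.
Proof.
move=> hm mf; rewrite -law_pred//; congr (m _).
by apply/seteqP; split => x /= /eqP.
Qed.

Lemma law_sum1 m A (f : X -> A) : fap m -> fmeas f -> \sum_a law m f a = 1.
Proof.
move=> hm mf; rewrite -(law_pred predT hm mf) -(fapT hm); congr (m _).
by apply/seteqP; split.
Qed.

Lemma law_le1 m A (f : X -> A) a : fap m -> fmeas f -> law m f a <= 1.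
Proof. by move=> hm mf; apply: fap_le1. Qed.

Lemma ent_ge0 m A (f : X -> A) : fap m -> fmeas f -> 0 <= ent m f.
Proof. by move=> hm mf; apply: sumr_ge0 => a _; apply/etaR_ge0/law_le1. Qed.

Lemma ent_comp m A B (f : X -> A) (phi : A -> B) : fap m -> fmeas f ->
  ent m (phi \o f) <= ent m f.
Proof.
move=> hm mf; rewrite /ent (partition_big phi xpredT)//=; apply: ler_sum => b _.
rewrite law_comp//; apply: etaR_sum_le => a; exact: law_ge0.
Qed.

Lemma factor_through A B (f : X -> A) (g : X -> B) :
  (forall x y, f x = f y -> g x = g y) -> exists phi : A -> B, g = phi \o f.
Proof.
move=> fg.
exists (fun a => if pselect (exists x, f x = a) is left h then g (projT1 (cid h))
                 else g point).
apply/funext => x /=; case: pselect => [h|[]]; last by exists x.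
by case: cid => y /= /fg.
Qed.

Lemma ent_le m A B (f : X -> A) (g : X -> B) : fap m -> fmeas f ->
  (forall x y, f x = f y -> g x = g y) -> ent m g <= ent m f.
Proof. by move=> hm mf /factor_through[phi ->]; apply: ent_comp. Qed.

Lemma ent_eq m A B (f : X -> A) (g : X -> B) : fap m -> fmeas f -> fmeas g ->
  (forall x y, f x = f y <-> g x = g y) -> ent m g = ent m f.
Proof.
by move=> hm mf mg fg; apply/eqP; rewrite eq_le !ent_le// => x y /fg.
Qed.

Lemma ent_cst m A (f : X -> A) : fap m -> fmeas f -> (forall x y, f x = f y) ->
  ent m f = 0.
Proof.
move=> hm mf fc; rewrite (@ent_eq m unit A (fun=> tt))//.
  rewrite /ent big1// => -[] _; rewrite /law (_ : _ @^-1` _ = setT).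
    by rewrite fapT// etaR1.
  by apply/seteqP; split.
by move=> a; rewrite (_ : _ @^-1` _ = setT)//; apply/seteqP; split => // x _ /=; case: a.
Qed.

(** Gibbs' inequality against q = P(a,c) P(b,c) / P(c), the law under which f and g are
    conditionally independent given h. *)
Lemma ent_strong_subadd m A B C (f : X -> A) (g : X -> B) (h : X -> C) :
  fap m -> fmeas f -> fmeas g -> fmeas h ->
  ent m (fun x => (f x, g x, h x)) + ent m h
    <= ent m (fun x => (f x, h x)) + ent m (fun x => (g x, h x)).
Proof.
move=> hm mf mg mh.
set F := fun x => (f x, g x, h x).
have mF : fmeas F by apply/fmeas_pair => //; apply/fmeas_pair.
have mfh : fmeas (fun x => (f x, h x)) by apply: fmeas_pair.
have mgh : fmeas (fun x => (g x, h x)) by apply: fmeas_pair.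
pose P := law m F.
pose pac := law m (fun x => (f x, h x)).
pose pbc := law m (fun x => (g x, h x)).
pose pc := law m h.
have Eac a c : pac (a, c) = \sum_b P (a, b, c).
  rewrite /pac (_ : (fun x => (f x, h x)) = (fun t => (t.1.1, t.2)) \o F)//.
  rewrite law_comp//.
  rewrite (reindex_onto (fun b => (a, b, c)) (fun t => t.1.2))/=; last first.
    by move=> [[a' b'] c'] /= /eqP[-> ->].
  by apply: eq_bigl => b; rewrite !eqxx.
have Ebc b c : pbc (b, c) = \sum_a P (a, b, c).
  rewrite /pbc (_ : (fun x => (g x, h x)) = (fun t => (t.1.2, t.2)) \o F)//.
  rewrite law_comp//.
  rewrite (reindex_onto (fun a => (a, b, c)) (fun t => t.1.1))/=; last first.
    by move=> [[a' b'] c'] /= /eqP[-> ->].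
  by apply: eq_bigl => a; rewrite !eqxx.
have Ec c : pc c = \sum_a pac (a, c).
  rewrite /pc (_ : h = snd \o (fun x => (f x, h x)))// law_comp//.
  rewrite (reindex_onto (fun a => (a, c)) fst)/=; last by move=> [a' c'] /= /eqP->.
  by apply: eq_bigl => a; rewrite !eqxx.
have Ec' c : pc c = \sum_b pbc (b, c).
  rewrite /pc (_ : h = snd \o (fun x => (g x, h x)))// law_comp//.
  rewrite (reindex_onto (fun a => (a, c)) fst)/=; last by move=> [a' c'] /= /eqP->.
  by apply: eq_bigl => a; rewrite !eqxx.
have P0 t : 0 <= P t by apply: law_ge0.
have pac0 t : 0 <= pac t by apply: law_ge0.
have pbc0 t : 0 <= pbc t by apply: law_ge0.
have pc0 t : 0 <= pc t by apply: law_ge0.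
have sum3 (G : A * B * C -> R) : \sum_t G t = \sum_a \sum_b \sum_c G (a, b, c).
  rewrite pair_big /= pair_big /=; apply: eq_bigr => -[[a b] c] _ //.
have sum2 (D : finType) (G : D * C -> R) : \sum_t G t = \sum_a \sum_c G (a, c).
  by rewrite pair_big /=; apply: eq_bigr => -[a c] _.
pose q (t : A * B * C) := pac (t.1.1, t.2) * pbc (t.1.2, t.2) / pc t.2.
have Pac a b c : P (a, b, c) <= pac (a, c).
  by rewrite Eac (bigD1 b)//= lerDl sumr_ge0.
have Pbc a b c : P (a, b, c) <= pbc (b, c).
  by rewrite Ebc (bigD1 a)//= lerDl sumr_ge0.
have pacc a c : pac (a, c) <= pc c.
  by rewrite Ec (bigD1 a)//= lerDl sumr_ge0.
have q0 t : 0 <= q t by rewrite /q divr_ge0// mulr_ge0.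
have := @gibbs _ _ P q P0 q0.
have qz t : q t = 0 -> P t = 0.
  case: t => [[a b] c]; rewrite /q /= => /eqP.
  rewrite mulf_eq0 invr_eq0 mulf_eq0 -orbA => /or3P[] /eqP z.
  - by apply/eqP; rewrite eq_le P0 -z Pac.
  - by apply/eqP; rewrite eq_le P0 -z Pbc.
  - by apply/eqP; rewrite eq_le P0 -z (le_trans (Pac a b c)).
move=> /(_ qz).
have -> : \sum_t P t = 1 by apply: law_sum1.
have sq : \sum_t q t <= 1.
  rewrite sum3 exchange_big /=; under eq_bigr do rewrite exchange_big /=.
  rewrite exchange_big /= -(law_sum1 hm mh); apply: ler_sum => c _.
  rewrite /q /=.
  under eq_bigr => b _.
    rewrite -mulr_suml -mulr_suml -Ec.
    over.
  rewrite -mulr_suml -mulr_sumr -Ec' -/(pc c).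
  have [->|cn] := eqVneq (pc c) 0; first by rewrite !mul0r.
  by rewrite mulfK.
move=> /(_ sq) H.
rewrite -lerBrDr; apply: (le_trans H); rewrite le_eqVlt; apply/orP; left; apply/eqP.
have -> : \sum_t - (P t * ln (q t)) = \sum_t (- (P t * ln (pac (t.1.1, t.2)))
   + - (P t * ln (pbc (t.1.2, t.2))) - - (P t * ln (pc t.2))).
  apply: eq_bigr => -[[a b] c] _ /=.
  have [->|Pn] := eqVneq (P (a, b, c)) 0; first by rewrite !mul0r !oppr0 !addr0.
  have Pp : 0 < P (a, b, c) by rewrite lt_def Pn P0.
  rewrite /q /= ln_div ?posrE ?mulr_gt0//; last 3 first.
  - exact: (lt_le_trans Pp).
  - exact: (lt_le_trans Pp).
  - by apply: (lt_le_trans Pp); apply: (le_trans (Pac a b c)).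
  by rewrite lnM ?posrE//; [ring|exact: (lt_le_trans Pp)|exact: (lt_le_trans Pp)].
rewrite sumrB big_split /=; congr (_ + _ - _).
- rewrite sum3 /ent sum2; apply: eq_bigr => a _; rewrite exchange_big /=.
  by apply: eq_bigr => c _; rewrite etaRE -/(pac _) sumrN -mulr_suml -Eac.
- rewrite sum3 exchange_big /= /ent sum2; apply: eq_bigr => b _; rewrite exchange_big /=.
  by apply: eq_bigr => c _; rewrite etaRE -/(pbc _) sumrN -mulr_suml -Ebc.
- rewrite sum3; under eq_bigr do rewrite exchange_big /=.
  rewrite exchange_big /= /ent; apply: eq_bigr => c _; rewrite etaRE -/(pc c).
  under eq_bigr do rewrite sumrN -mulr_suml -Eac.
  by rewrite sumrN -mulr_suml -Ec.
Qed.

Lemma ent_pair m A B (f : X -> A) (g : X -> B) :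
  fap m -> fmeas f -> fmeas g ->
  ent m (fun x => (f x, g x)) <= ent m f + ent m g.
Proof.
move=> hm mf mg.
have mu : fmeas (fun _ : X => tt).
  move=> a; rewrite (_ : _ @^-1` _ = setT)//.
  by apply/seteqP; split => // x _ /=; case: a.
have := ent_strong_subadd hm mf mg mu.
rewrite (ent_cst hm mu)// addr0.
rewrite (@ent_eq m _ _ (fun x => (f x, g x)))//; last 3 first.
- exact: fmeas_pair.
- by apply: fmeas_pair => //; exact: fmeas_pair.
- by move=> x y; split => [[-> ->]|[-> ->]].
rewrite (@ent_eq m _ _ f (fun x => (f x, tt)))//; [|exact: fmeas_pair|by move=> x y; split => [->|[]]].
by rewrite (@ent_eq m _ _ g (fun x => (g x, tt)))//; [exact: fmeas_pair|by move=> x y; split => [->|[]]].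
Qed.

Lemma ent_support m A (f : X -> A) (N : {set A}) : fap m -> fmeas f ->
  ent m f <= ln 2 + ln #|N|%:R + m [set x | f x \notin N] * ln #|A|%:R.
Proof.
move=> hm mf; rewrite (law_pred (fun a => a \notin N) hm mf).
rewrite (eq_bigl (fun a => a \in ~: N)); last by move=> a; rewrite finset.in_setC.
by apply: sum_etaR_support => [a|]; [exact: law_ge0|exact: law_sum1].
Qed.

Lemma ent_mean_le m (I : finType) (ms : I -> set X -> R) A (f : X -> A) :
  (0 < #|I|)%N -> (forall i, fap (ms i)) -> fmeas f ->
  (forall E, measurable E -> m E = #|I|%:R^-1 * \sum_i ms i E) ->
  \sum_i ent (ms i) f <= #|I|%:R * ent m f.
Proof.
move=> I0 hms mf mE; rewrite exchange_big /= mulr_sumr; apply: ler_sum => a _.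
rewrite [law m f a]mE//; apply: etaR_concave_mean => // i; exact: law_ge0.
Qed.

(** Mixing costs at most eta(l) + eta(1 - l) <= 2 whatever the number of cells, so the loss
    disappears in entropy rates. *)
Lemma ent_convex2 m m1 m2 (l : R) A (f : X -> A) :
  fap m1 -> fap m2 -> fmeas f -> 0 <= l <= 1 ->
  (forall E, measurable E -> m E = l * m1 E + (1 - l) * m2 E) ->
  ent m f <= l * ent m1 f + (1 - l) * ent m2 f + 2.
Proof.
move=> h1 h2 mf /andP[l0 l1] mE.
have l2 : 0 <= 1 - l by lra.
apply: (@le_trans _ _ (\sum_a (l * etaR (law m1 f a) + law m1 f a * etaR l +
   ((1 - l) * etaR (law m2 f a) + law m2 f a * etaR (1 - l))))).
  apply: ler_sum => a _; rewrite [law m f a]mE// -!etaR_mul ?law_ge0//.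
  by apply: etaR_subadd; rewrite mulr_ge0// law_ge0.
rewrite big_split /= !big_split /= -!mulr_sumr -!mulr_suml !law_sum1// !mul1r.
have := etaR_le1 l0 l1; have : 1 - l <= 1 by lra.
move=> /(etaR_le1 l2); rewrite -!/(ent _ _); lra.
Qed.

End FinitelyAdditive.

(** * Shearer's inequality and entropy rates *)

Section Shearer.
Context (R : realType) (G : choiceType).
Local Open Scope fset_scope.
Local Open Scope ring_scope.

(** Build F one point at a time: adding x to L raises H(L) by no more than it raises H on the trace
    of each of the k windows containing x, while the traces of the other windows do not change. *)
Lemma shearer (H : {fset G} -> R) (J : finType) (S : J -> {fset G})
    (F : {fset G}) (k : nat) :
  H fset0 = 0 ->
  (forall K L g, K `<=` L -> g \notin L -> H (g |` L) - H L <= H (g |` K) - H K) ->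
  (forall g, g \in F -> #|[set j | g \in S j]%SET| = k) ->
  k%:R * H F <= \sum_j H (S j `&` F).
Proof.
move=> H0 Hs Fk.
have [s [E us {}Fk]] : exists s : seq G, [/\ F = [fset x in s], uniq s &
    forall g, g \in s -> #|[set j | g \in S j]%SET| = k].
  by exists (enum_fset F); split; rewrite ?fset_uniq//; apply/fsetP => x; rewrite !inE.
rewrite E; elim: s us Fk {E} => [_ _|x s IH /= /andP[xs us] Fk].
  rewrite (_ : [fset x in _] = fset0); last by apply/fsetP => x; rewrite !inE.
  by rewrite H0 mulr0 big1// => j _; rewrite fsetI0 H0.
set L := [fset x in s].
have {}IH : k%:R * H L <= \sum_j H (S j `&` L).
  by apply: IH => // g gs; apply: Fk; rewrite inE gs orbT.
have -> : [fset x0 in x :: s] = x |` L by apply/fsetP => y; rewrite !inE.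
have xL : x \notin L by rewrite inE.
have step j : (if x \in S j then H (x |` L) - H L else 0) + H (S j `&` L) <= H (S j `&` (x |` L)).
  case: ifPn => xS.
  - rewrite fsetIUr (_ : S j `&` [fset x] = [fset x]); last first.
      by apply/fsetIidPr; rewrite fsub1set.
    by have := Hs (S j `&` L) L x (fsubsetIr _ _) xL; lra.
  - rewrite add0r fsetIUr (_ : S j `&` [fset x] = fset0) ?fset0U//.
    by apply/fsetP => y; rewrite !inE; apply/negbTE/negP => /andP[yS /eqP yx]; rewrite yx (negbTE xS) in yS.
apply: le_trans (ler_sum _ (fun j _ => step j)).
rewrite big_split /= -big_mkcond /= sumr_const.
have -> : #|[pred j | x \in S j]| = k.
  by rewrite -(Fk x) ?mem_head//; apply: eq_card => j; rewrite !inE.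
by rewrite mulrnBl -[in X in _ <= X]mulr_natl -[X in _ - X]mulr_natl; lra.
Qed.
End Shearer.

(** * Product sets and translates in a group *)

Section GroupSets.
Context (G : choiceType) (mul : G -> G -> G) (one : G) (inv : G -> G).
Context (hG : is_group mul one inv).
Local Open Scope fset_scope.

Let mulA a b c : mul a (mul b c) = mul (mul a b) c. Proof. by case: hG. Qed.
Let mul1 a : mul one a = a. Proof. by case: hG. Qed.
Let mulr1 a : mul a one = a. Proof. by case: hG. Qed.
Let mulV a : mul (inv a) a = one. Proof. by case: hG. Qed.
Let mulrV a : mul a (inv a) = one. Proof. by case: hG. Qed.

Lemma mulK a b : mul (inv a) (mul a b) = b. Proof. by rewrite mulA mulV mul1. Qed.
Lemma mulVK a b : mul a (mul (inv a) b) = b. Proof. by rewrite mulA mulrV mul1. Qed.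
Lemma mulKr a b : mul (mul b a) (inv a) = b. Proof. by rewrite -mulA mulrV mulr1. Qed.
Lemma mulVKr a b : mul (mul b (inv a)) a = b. Proof. by rewrite -mulA mulV mulr1. Qed.
Lemma gmulI a : injective (mul a). Proof. exact: can_inj (mulK a). Qed.
Lemma gmulIr a : injective (mul^~ a). Proof. by move=> b c /(congr1 (mul^~ (inv a))); rewrite !mulKr. Qed.
Lemma ginvK : involutive inv.
Proof. by move=> a; rewrite -[LHS]mulr1 -(mulV a) mulK. Qed.
Lemma invM a b : inv (mul a b) = mul (inv b) (inv a).
Proof. by apply: (@gmulI (mul a b)); rewrite mulrV -mulA mulVK mulrV. Qed.

Definition mulset (A B : {fset G}) : {fset G} := [fset mul a b | a in A, b in B].
Definition invset (A : {fset G}) : {fset G} := [fset inv a | a in A].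
Definition rtrans (K : {fset G}) g : {fset G} := [fset mul k g | k in K].

Lemma mem_mulset A B a b : a \in A -> b \in B -> mul a b \in mulset A B.
Proof. by move=> aA bB; apply: in_imfset2. Qed.

Lemma mulsetP A B x : reflect (exists a b, [/\ a \in A, b \in B & x = mul a b])
  (x \in mulset A B).
Proof.
apply: (iffP (imfset2P _ _ _ _ _)) => [[a aA [b bB ->]]|[a [b [aA bB ->]]]].
  by exists a, b.
by exists a => //; exists b.
Qed.

Lemma mem_invset A a : (a \in invset A) = (inv a \in A).
Proof.
apply/imfsetP/idP => [[b bA ->]|aA]; first by rewrite ginvK.
by exists (inv a) => //; rewrite ginvK.
Qed.

Lemma mem_rtrans K g x : (x \in rtrans K g) = (mul x (inv g) \in K).
Proof.
apply/imfsetP/idP => [[k kK ->]|xK]; first by rewrite mulKr.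
by exists (mul x (inv g)) => //; rewrite mulVKr.
Qed.

Lemma card_rtrans K g : #|` rtrans K g| = #|` K|.
Proof. by rewrite card_imfset//; exact: gmulIr. Qed.

Lemma card_invset K : #|` invset K| = #|` K|.
Proof. by rewrite card_imfset//; exact: inv_inj ginvK. Qed.

Lemma mem_ltrans g K x : (x \in ltrans mul g K) = (mul (inv g) x \in K).
Proof.
apply/imfsetP/idP => [[k kK ->]|xK]; first by rewrite mulK.
by exists (mul (inv g) x) => //; rewrite mulVK.
Qed.

(** x lies in K g exactly for g in K^-1 x, which gives |K| values of g. Right translates are the
    useful windows because the itinerary of x along K g is that of g x along K. *)
Lemma card_window_cover (K F : {fset G}) x : x \in F ->
  #|[set j : mulset (invset K) F | x \in rtrans K (val j)]%SET| = #|` K|.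
Proof.
move=> xF.
have hk k : k \in K -> mul (inv k) x \in mulset (invset K) F.
  by move=> kK; apply: mem_mulset => //; rewrite mem_invset ginvK.
pose phi (k : K) : mulset (invset K) F := [` hk (val k) (valP k)].
have iphi : injective phi.
  move=> k l /(congr1 val) /= /gmulIr /(inv_inj ginvK) /val_inj //.
rewrite [RHS]cardfE -(card_imset _ iphi); apply: eq_card => j.
rewrite inE mem_rtrans; apply/idP/imsetP.
- move=> jK; exists [` jK] => //; apply: val_inj => /=.
  by rewrite invM ginvK mulVKr.
- by case=> k _ -> /=; rewrite invM ginvK mulVK; exact: valP.
Qed.
End GroupSets.

(** * Entropy of itineraries *)

Section JoinEntropy.
Context (R : realType) (G : choiceType) (mul : G -> G -> G) (one : G) (inv : G -> G).
Context (hG : is_group mul one inv).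
Context (dsp : measure_display) (X : measurableType dsp) (act : G -> X -> X).
Context (hact : is_action mul one act).
Context (hmact : forall g E, measurable E -> measurable (act g @^-1` E)).
Implicit Types (m : set X -> R) (A : finType) (K L F : {fset G}).

Definition push m g : set X -> R := fun E => m (act g @^-1` E).
Definition act_invariant m := forall g E, measurable E -> m (act g @^-1` E) = m E.

(* The itinerary along [K]: its fibres are the atoms of the join of the g^-1 f, g in K. *)
Definition name A (f : X -> A) K : X -> {ffun K -> A} :=
  fun x => [ffun g : K => f (act (val g) x)].

Definition Hset m A (f : X -> A) K : R := ent m (name f K).

Lemma fap_push m g : fap m -> fap (push m g).
Proof.
move=> hm; split => [E mE||E F mE mF EF]; first exact: (fap_ge0 hm (hmact _ mE)).
  by rewrite /push preimage_setT fapT.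
rewrite /push preimage_setU fapU//; [exact: hmact|exact: hmact|].
by rewrite -preimage_setI EF preimage_set0.
Qed.

Lemma actM g h x : act (mul g h) x = act g (act h x).
Proof. by case: hact => _ ->. Qed.

Lemma act1 x : act one x = x. Proof. by case: hact. Qed.

Lemma actK g x : act (inv g) (act g x) = x.
Proof. by case: hG => _ _ _ V _; rewrite -actM V act1. Qed.

Lemma actVK g x : act g (act (inv g) x) = x.
Proof. by case: hG => _ _ _ _ V; rewrite -actM V act1. Qed.

Lemma name_eqP A (f : X -> A) K x y : name f K x = name f K y <->
  forall g, g \in K -> f (act g x) = f (act g y).
Proof.
split => [/ffunP h g gK|h]; first by have := h (FSetSub gK); rewrite !ffunE.
by apply/ffunP => g; rewrite !ffunE; apply: h; exact: valP.
Qed.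

Lemma fmeas_act A (f : X -> A) g : fmeas f -> fmeas (f \o act g).
Proof. by move=> mf a; rewrite comp_preimage; apply: hmact. Qed.

Lemma name_meas A (f : X -> A) K : fmeas f -> fmeas (name f K).
Proof.
move=> mf w; rewrite (_ : _ @^-1` _ = \bigcap_(g in [set: K]) ((f \o act (val g)) @^-1` [set w g])).
  by apply: fin_bigcap_measurable => // g _; exact: fmeas_act.
apply/seteqP; split => x /=; first by move=> <- g _; rewrite ffunE.
by move=> h; apply/ffunP => g; rewrite ffunE; apply: h.
Qed.

Lemma Hset0 m A (f : X -> A) : fap m -> fmeas f -> Hset m f fset0 = 0.
Proof.
move=> hm mf; apply: ent_cst => //; first exact: name_meas.
by move=> x y; apply/name_eqP.
Qed.

Lemma Hset_ge0 m A (f : X -> A) K : fap m -> fmeas f -> 0 <= Hset m f K.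
Proof. by move=> hm mf; apply: ent_ge0 => //; exact: name_meas. Qed.

Lemma Hset_mono m A (f : X -> A) K L : fap m -> fmeas f -> (K `<=` L)%fset ->
  Hset m f K <= Hset m f L.
Proof.
move=> hm mf /fsubsetP KL; apply: ent_le => //; first exact: name_meas.
by move=> x y /name_eqP h; apply/name_eqP => g /KL /h.
Qed.

(** Strong subadditivity conditioned on the name along K, which the name along L determines. *)
Lemma Hset_submod m A (f : X -> A) K L g : fap m -> fmeas f -> (K `<=` L)%fset ->
  Hset m f (g |` L)%fset - Hset m f L <= Hset m f (g |` K)%fset - Hset m f K.
Proof.
move=> hm mf /fsubsetP KL.
have mK := @name_meas _ f K mf; have mL := @name_meas _ f L mf.
have mg := fmeas_act g mf.
have := ent_strong_subadd hm mg mL mK.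
rewrite (@ent_eq _ _ _ m _ _ (name f (g |` L)%fset) (fun x => ((f \o act g) x, name f L x, name f K x)))//; last 3 first.
- exact: name_meas.
- by do 2?apply: fmeas_pair.
- move=> x y; split.
    move=> /name_eqP h; congr (_, _, _); first by apply: h; rewrite !inE eqxx.
      by apply/name_eqP => k kL; apply: h; rewrite !inE kL orbT.
    by apply/name_eqP => k /KL kL; apply: h; rewrite !inE kL orbT.
  move=> [hg /name_eqP hL _]; apply/name_eqP => k; rewrite !inE => /orP[/eqP->//|].
  exact: hL.
rewrite (@ent_eq _ _ _ m _ _ (name f (g |` K)%fset) (fun x => ((f \o act g) x, name f K x)))//; last 3 first.
- exact: name_meas.
- exact: fmeas_pair.
- move=> x y; split.
    move=> /name_eqP h; congr (_, _); first by apply: h; rewrite !inE eqxx.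
    by apply/name_eqP => k kL; apply: h; rewrite !inE kL orbT.
  move=> [hg /name_eqP hL]; apply/name_eqP => k; rewrite !inE => /orP[/eqP->//|].
  exact: hL.
rewrite (@ent_eq _ _ _ m _ _ (name f L) (fun x => (name f L x, name f K x)))//; last 2 first.
- exact: fmeas_pair.
- by move=> x y; split => [/[dup] h /name_eqP h'|[]//]; congr (_, _) => //;
    apply/name_eqP => k /KL; exact: h'.
by rewrite /Hset; lra.
Qed.

Definition ecap A : R := ln 2 + ln #|A|%:R.

Lemma ecap_ge0 A : 0 <= ecap A.
Proof.
apply: addr_ge0; first by rewrite ln_ge0// ler1n.
by have [->|h] := posnP #|A|; [rewrite ln0|rewrite ln_ge0// ler1n].
Qed.

Lemma ent_le_ecap m A (f : X -> A) : fap m -> fmeas f -> ent m f <= ecap A.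
Proof.
move=> hm mf; have := ent_support [set: A]%SET hm mf.
rewrite cardsT (_ : [set x | _] = set0) ?fap0//; first by rewrite mul0r addr0.
by apply/seteqP; split => x //=; rewrite finset.in_setT.
Qed.

Lemma Hset_add m A (f : X -> A) K g : fap m -> fmeas f ->
  Hset m f (g |` K)%fset <= Hset m f K + ecap A.
Proof.
move=> hm mf; have mg := fmeas_act g mf; have mK := @name_meas _ f K mf.
apply: (le_trans (@ent_le _ _ _ m _ _ (fun x => (name f K x, (f \o act g) x)) _ hm _ _)).
- exact: fmeas_pair.
- move=> x y [/name_eqP hL hg]; apply/name_eqP => k; rewrite !inE => /orP[/eqP->//|].
  exact: hL.
by apply: (le_trans (ent_pair hm mK mg)); rewrite lerD2l; exact: ent_le_ecap.
Qed.

Lemma Hset_card m A (f : X -> A) K : fap m -> fmeas f ->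
  Hset m f K <= #|` K|%:R * ecap A.
Proof.
move=> hm mf; have [n] := ubnP #|` K|; elim: n K => // n IH K.
have [->|[g gK]] := fset_0Vmem K; first by rewrite Hset0// cardfs0 mul0r.
rewrite -(fsetD1K gK) cardfsU1 !inE eqxx /= add1n ltnS => Kn.
apply: (le_trans (Hset_add _ _ hm mf)).
by rewrite -natr1 mulrDl mul1r lerD2r; apply: IH.
Qed.

Lemma Hset_push m A (f : X -> A) K g : fap m -> fmeas f ->
  Hset m f (rtrans mul K g) = Hset (push m g) f K.
Proof.
move=> hm mf.
rewrite -[RHS]/(ent m (name f K \o act g)); apply: ent_eq => //.
- exact: fmeas_act (name_meas mf).
- exact: name_meas.
- move=> x y; split.
    move=> /name_eqP h; apply/name_eqP => k; rewrite (mem_rtrans hG) => kK.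
    by have := h _ kK; rewrite -!actM (mulVKr hG).
  move=> /name_eqP h; apply/name_eqP => k kK; rewrite -!actM; apply: h.
  by rewrite (mem_rtrans hG) (mulKr hG).
Qed.

Lemma Hset_rtrans m A (f : X -> A) K g : fap m -> act_invariant m -> fmeas f ->
  Hset m f (rtrans mul K g) = Hset m f K.
Proof.
move=> hm im mf; rewrite Hset_push//; apply: eq_bigr => w _; congr etaR.
by apply: im; apply: name_meas.
Qed.

Lemma Hset_shearer m A (f : X -> A) K F : fap m -> fmeas f ->
  #|` K|%:R * Hset m f F
   <= \sum_(g : mulset mul (invset inv K) F) Hset m f (rtrans mul K (val g) `&` F)%fset.
Proof.
move=> hm mf; apply: shearer; first exact: Hset0.
- by move=> K' L g KL _; apply: Hset_submod.
- by move=> g gF; apply: (card_window_cover hG).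
Qed.

(** By invariance each of the |K^-1 F| windows contributes at most H(K). *)
Lemma Hset_shearer_inv m A (f : X -> A) K F : fap m -> act_invariant m -> fmeas f ->
  #|` K|%:R * Hset m f F <= #|` mulset mul (invset inv K) F|%:R * Hset m f K.
Proof.
move=> hm im mf; apply: (le_trans (Hset_shearer _ _ hm mf)).
rewrite cardfE mulr_natl -sumr_const; apply: ler_sum => g _.
by rewrite -(Hset_rtrans K (val g) hm im mf); apply: Hset_mono => //; exact: fsubsetIl.
Qed.

(** Without invariance, a window at g in F contributes at most the entropy of the translated
    measure; averaging over F later merges these into one measure. The windows outside F are bounded
    trivially, and a Folner set has few of them. *)
Lemma Hset_shearer_push m A (f : X -> A) K F : fap m -> fmeas f ->
  #|` K|%:R * Hset m f F <= \sum_(g : F) Hset (push m (val g)) f K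
    + #|` (mulset mul (invset inv K) F `\` F)%fset|%:R * (#|` K|%:R * ecap A).
Proof.
move=> hm mf; apply: (le_trans (Hset_shearer _ _ hm mf)).
set E := mulset _ _ _.
have bK g : Hset m f (rtrans mul K g `&` F)%fset <= #|` K|%:R * ecap A.
  rewrite -(card_rtrans hG K g); apply: le_trans (Hset_card _ hm mf).
  by apply: Hset_mono => //; exact: fsubsetIl.
rewrite -(big_seq_fsetE _ E predT (fun g => Hset m f (rtrans mul K g `&` F)%fset))/=.
rewrite -(big_seq_fsetE _ F predT (fun g => Hset (push m g) f K))/=.
rewrite (bigID (mem F)) /=; apply: lerD.
- rewrite -big_filter [X in _ <= X](bigID (mem E))/= -[X in _ <= X + _]big_filter.
  rewrite -[X in X <= _]addr0; apply: lerD; last first.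
    by apply: sumr_ge0 => g _; apply: Hset_ge0 => //; exact: fap_push.
  rewrite (perm_big [seq i <- F | i \in E]); last first.
    apply: uniq_perm; rewrite ?filter_uniq ?fset_uniq//.
    by move=> g; rewrite !mem_filter andbC.
  apply: ler_sum => g _; rewrite -Hset_push//; apply: Hset_mono => //.
  exact: fsubsetIl.
- rewrite -big_filter.
  rewrite (perm_big (enum_fset (E `\` F)%fset)); last first.
    apply: uniq_perm; rewrite ?filter_uniq ?fset_uniq//.
    by move=> g; rewrite !mem_filter !inE.
  rewrite big_seq_fsetE /= cardfE mulr_natl -sumr_const; apply: ler_sum => g _.
  exact: bK.
Qed.
End JoinEntropy.

(** * Entropy rates along Folner sequences *)

Section FolnerLimit.
Context (R : realType) (G : choiceType) (mul : G -> G -> G) (one : G) (inv : G -> G).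
Context (hG : is_group mul one inv).
Context (F : nat -> {fset G}) (hF : Folner R mul F).

Lemma folner_card_gt0 n : 0 < (#|` F n|%:R : R).
Proof. by rewrite ltr0n cardfs_gt0; case: hF. Qed.

(** Induction on L: a single g moves F_n out of itself only within the symmetric difference of g F_n
    and F_n; the remaining elements share the other half of the error. *)
Lemma folner_mulset (L : {fset G}) (e : R) : 0 < e ->
  \forall n \near \oo, #|` (mulset mul L (F n) `\` F n)%fset|%:R <= e * #|` F n|%:R.
Proof.
have [k] := ubnP #|` L|; elim: k L e => // k IH L e Lk e0.
have [->|[g gL]] := fset_0Vmem L.
  near=> n; rewrite (_ : (_ `\` _)%fset = fset0) ?cardfs0 ?mulr_ge0 ?(ltW e0)//.
  by apply/fsetP => x; rewrite !inE; apply/negbTE; rewrite negb_and; apply/orP; right;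
    apply/mulsetP => -[a [b []]]; rewrite inE.
have e20 : 0 < e / 2 by lra.
have Lk' : (#|` (L `\ g)%fset| < k)%N.
  by move: Lk; rewrite -{1}(fsetD1K gL) cardfsU1 !inE eqxx /= add1n ltnS.
have {IH}IH := IH _ _ Lk' e20.
have /cvgrPdist_le /(_ _ e20) hg := hF.2 g.
near=> n.
have hn := folner_card_gt0 n.
have h1 : #|` (mulset mul (L `\ g) (F n) `\` F n)%fset|%:R <= e / 2 * #|` F n|%:R.
  by near: n; exact: IH.
have h2 : #|` fsymdiff (ltrans mul g (F n)) (F n)|%:R / #|` F n|%:R <= e / 2.
  have : `|0 - #|` fsymdiff (ltrans mul g (F n)) (F n)|%:R / #|` F n|%:R| <= e / 2.
    by near: n; exact: hg.
  by rewrite sub0r normrN ger0_norm// divr_ge0.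
rewrite ler_pdivrMr// in h2.
have : (#|` (mulset mul L (F n) `\` F n)%fset| <=
   #|` fsymdiff (ltrans mul g (F n)) (F n)| + #|` (mulset mul (L `\ g) (F n) `\` F n)%fset|)%N.
  apply: leq_trans (leq_card_fsetU _ _).1; apply: fsubset_leq_card.
  apply/fsubsetP => x; rewrite !inE => /andP[xF /mulsetP[a [b [aL bF xab]]]].
  have [ag|ag] := eqVneq a g.
    apply/orP; left; apply/orP; left; rewrite xF /= xab ag.
    by apply: in_imfset.
  by rewrite xF /=; apply/orP; right; rewrite xab; apply: mem_mulset => //; rewrite !inE ag.
rewrite -(ler_nat R) natrD => h3; lra.
Unshelve. all: by end_near. Qed.

Lemma folner_mulset_card (L : {fset G}) (e : R) : 0 < e ->
  \forall n \near \oo, #|` mulset mul L (F n)|%:R <= (1 + e) * #|` F n|%:R.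
Proof.
move=> e0; have := folner_mulset L e0; apply: filterS => n h.
apply: (@le_trans _ _ (#|` F n|%:R + #|` (mulset mul L (F n) `\` F n)%fset|%:R)); last by lra.
rewrite -natrD ler_nat; apply: leq_trans (leq_card_fsetU _ _).1.
by apply: fsubset_leq_card; apply/fsubsetP => x xL; rewrite !inE xL andbT orbN.
Qed.

Context (dsp : measure_display) (X : measurableType dsp) (act : G -> X -> X).
Context (hact : is_action mul one act).
Context (hmact : forall g E, measurable E -> measurable (act g @^-1` E)).

(* By Shearer's inequality this infimum is the limit of H(F_n)/|F_n| along any
   Folner sequence. *)
Definition hset (m : set X -> R) (A : finType) (f : X -> A) : R :=
  inf [set Hset act m f K / #|` K|%:R | K in [set K : {fset G} | K != fset0]].

Lemma hset_le (m : set X -> R) (A : finType) (f : X -> A) (K : {fset G}) :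
  fap m -> fmeas f -> hset m f * #|` K|%:R <= Hset act m f K.
Proof.
move=> hm mf; have [->|K0] := eqVneq K fset0.
  by rewrite cardfs0 mulr0 Hset_ge0.
have c0 : 0 < (#|` K|%:R : R) by rewrite ltr0n cardfs_gt0.
rewrite -ler_pdivlMr//; apply: ge_inf; last by exists K.
by exists 0 => _ [L _ <-]; rewrite divr_ge0// Hset_ge0.
Qed.

Lemma hset_ge (m : set X -> R) (A : finType) (f : X -> A) (c : R) :
  (forall K, K != fset0 -> c * #|` K|%:R <= Hset act m f K) -> c <= hset m f.
Proof.
move=> h; apply: lb_le_inf.
  by exists (Hset act m f (F 0) / #|` F 0|%:R), (F 0) => //=; case: hF.
move=> _ [K K0 <-]; rewrite ler_pdivlMr ?h//.
by rewrite ltr0n cardfs_gt0.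
Qed.

(** For a K with H(K)/|K| close to the infimum, Shearer bounds H(F_n)/|F_n| by (|K^-1 F_n| / |F_n|)
    H(K)/|K|, and the first factor is eventually close to 1. *)
Lemma hset_approx (m : set X -> R) (A : finType) (f : X -> A) (e : R) :
  fap m -> act_invariant act m -> fmeas f -> 0 < e ->
  \forall n \near \oo, Hset act m f (F n) <= (hset m f + e) * #|` F n|%:R.
Proof.
move=> hm im mf e0.
have [_ [K K0 <-] hK] : exists2 x, [set Hset act m f K / #|` K|%:R | K in [set K : {fset G} | K != fset0]] x
    & x < hset m f + e / 2.
  apply: inf_adherent; first lra.
  split; first by exists (Hset act m f (F 0) / #|` F 0|%:R), (F 0) => //=; case: hF.
  by exists 0 => _ [L _ <-]; rewrite divr_ge0// Hset_ge0.
have c0 : 0 < (#|` K|%:R : R) by rewrite ltr0n cardfs_gt0.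
set b := _ / _ in hK.
have b0 : 0 <= b by rewrite divr_ge0// Hset_ge0.
have d0 : 0 < e / 2 / (b + 1) by rewrite !divr_gt0//; lra.
have := folner_mulset_card (invset inv K) d0; apply: filterS => n hn.
have := Hset_shearer_inv hG hact hmact K (F n) hm im mf.
rewrite (_ : Hset act m f K = b * #|` K|%:R); last by rewrite /b divfK// lt0r_neq0.
rewrite mulrA [X in _ <= X]mulrC ler_pM2l// => h; apply: (le_trans h).
apply: (le_trans (ler_wpM2r b0 hn)); rewrite mulrAC ler_wpM2r//.
have : e / 2 / (b + 1) * (b + 1) = e / 2 by rewrite divfK// lt0r_neq0//; lra.
rewrite mulrDl mul1r mulrDr mulr1; have := ltW d0; lra.
Qed.

Lemma hset_cvg (m : set X -> R) (A : finType) (f : X -> A) :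
  fap m -> act_invariant act m -> fmeas f ->
  (fun n => #|` F n|%:R^-1 * Hset act m f (F n)) @ \oo --> hset m f.
Proof.
move=> hm im mf; apply/cvgrPdist_le => e e0.
have := hset_approx hm im mf e0; apply: filterS => n hn.
have h0 := folner_card_gt0 n.
have := hset_le (F n) hm mf; rewrite -ler_pdivlMr// => h1.
rewrite -ler_pdivrMr// in hn; rewrite mulrC distrC ger0_norm; lra.
Qed.
End FolnerLimit.

(** * From partitions to labellings *)

Section PartitionEntropy.
Context (R : realType) (G : choiceType) (mul : G -> G -> G) (one : G) (inv : G -> G).
Context (hG : is_group mul one inv).
Context (F : nat -> {fset G}) (hF : Folner R mul F).
Context (dsp : measure_display) (X : measurableType dsp) (act : G -> X -> X).
Context (hact : is_action mul one act).
Context (hmact : forall g E, measurable E -> measurable (act g @^-1` E)).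
Implicit Types (mu : probability X R).

Definition pm mu : set X -> R := fun E => fine (mu E).

Lemma pmE mu E : measurable E -> mu E = (pm mu E)%:E.
Proof.
by move=> mE; rewrite /pm fineK// fin_num_measure.
Qed.

Lemma fap_pm mu : fap (pm mu).
Proof.
split => [E mE||E K mE mK EK]; first exact: fine_ge0.
  by rewrite /pm probability_setT.
rewrite /pm measureU// fineD//; exact: fin_num_measure.
Qed.

Lemma invariant_pm mu : invariant_measure act mu -> act_invariant act (pm mu).
Proof. by move=> im g E mE; rewrite /pm im. Qed.

Lemma partition_fun m (P : 'I_m -> set X) : is_partition P ->
  exists f : X -> 'I_m, fmeas f /\ forall i, f @^-1` [set i] = P i.
Proof.
move=> [mP dP cP].
have h x : exists i, P i x by have : setT x by []; rewrite -cP => -[i _ Pi]; exists i.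
exists (fun x => projT1 (cid (h x))).
have E i : (fun x => projT1 (cid (h x))) @^-1` [set i] = P i.
  apply/seteqP; split => x /=; first by move=> <-; case: cid.
  move=> Pi; case: cid => j /= Pj; apply/eqP/negP => /negP ji.
  by have := dP _ _ ji; move/seteqP => [/(_ x) + _]; apply.
by split => // i; rewrite E.
Qed.

Lemma fun_partition m (f : X -> 'I_m) : fmeas f ->
  is_partition (fun i => f @^-1` [set i]).
Proof.
move=> mf; split => //.
  by move=> i j ij; apply/seteqP; split => x //= [-> /eqP]; rewrite (negbTE ij).
by apply/seteqP; split => // x _; exists (f x).
Qed.

Lemma Hjoin_Hset mu (K : {fset G}) m (f : X -> 'I_m) (P : 'I_m -> set X) :
  (forall i, f @^-1` [set i] = P i) -> Hjoin act mu K P = Hset act (pm mu) f K.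
Proof.
move=> fP; apply: eq_bigr => w _; congr etaR; rewrite /law /pm; congr (fine (mu _)).
apply/seteqP; split => x /=.
  move=> h; apply/ffunP => g; rewrite ffunE.
  by have := h g I; rewrite -fP.
by move=> <- g _; rewrite ffunE -fP.
Qed.

Lemma hpartE mu m (f : X -> 'I_m) (P : 'I_m -> set X) :
  invariant_measure act mu -> fmeas f -> (forall i, f @^-1` [set i] = P i) ->
  hpart act F mu P = hset act (pm mu) f.
Proof.
move=> im mf fP; apply: cvg_lim => //.
under eq_fun => n do rewrite (Hjoin_Hset _ _ fP).
by apply: (hset_cvg hG hF hact hmact) => //; [exact: fap_pm|exact: invariant_pm].
Qed.
End PartitionEntropy.

(** * Regularisation of finitely additive measures *)

Section MetricTopology.
Context (R : realType) (X : choiceType) (d : X -> X -> R).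
Context (hd : is_metric d) (hcpt : dcompact d).
Implicit Types (U V K : set X).

Definition dclosed K := dopen d (~` K).

Lemma dge0 x y : 0 <= d x y. Proof. by case: hd. Qed.
Lemma dxx x : d x x = 0. Proof. by case: hd => _ h _ _; apply/h. Qed.
Lemma dC x y : d x y = d y x. Proof. by case: hd. Qed.
Lemma dtri y x z : d x z <= d x y + d y z. Proof. by case: hd. Qed.
Lemma d_neq x y : x <> y -> 0 < d x y.
Proof.
move=> xy; by rewrite lt_def dge0 andbT; apply/eqP => e; apply: xy; case: hd => _ h _ _; apply/h.
Qed.

Lemma dopenT : dopen d setT. Proof. by move=> x _; exists 1. Qed.
Lemma dopen0 : dopen d set0. Proof. by []. Qed.
Lemma dclosedT : dclosed setT. Proof. by rewrite /dclosed setCT. Qed.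
Lemma dclosed0 : dclosed set0. Proof. by rewrite /dclosed setC0; apply: dopenT. Qed.

Lemma dopenI U V : dopen d U -> dopen d V -> dopen d (U `&` V).
Proof.
move=> oU oV x [/oU[r [r0 rU]] /oV[s [s0 sV]]]; exists (Num.min r s).
split; first by rewrite lt_min r0.
by move=> y; rewrite /dball /= lt_min => /andP[yr ys]; split; [apply: rU|apply: sV].
Qed.

Lemma dopen_bigcup (I : Type) (D : set I) (U : I -> set X) :
  (forall i, D i -> dopen d (U i)) -> dopen d (\bigcup_(i in D) U i).
Proof.
by move=> oU x [i Di /(oU _ Di)[r [r0 rU]]]; exists r; split => // y /rU Uy; exists i.
Qed.

Lemma dclosedU U V : dclosed U -> dclosed V -> dclosed (U `|` V).
Proof. by rewrite /dclosed setCU; exact: dopenI. Qed.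

Lemma dopenD U K : dopen d U -> dclosed K -> dopen d (U `\` K).
Proof. by move=> oU cK; rewrite setDE; exact: dopenI. Qed.

Lemma dclosedC U : dopen d U -> dclosed (~` U).
Proof. by rewrite /dclosed setCK. Qed.

Lemma dopen_ball x r : dopen d (dball d x r).
Proof.
move=> y; rewrite /dball /= => yr; exists (r - d x y); split; first by lra.
by move=> z /=; rewrite /dball /= => h; have := dtri y x z; lra.
Qed.

Definition cball x r : set X := [set y | d x y <= r].

Lemma dclosed_cball x r : dclosed (cball x r).
Proof.
move=> y /= /negP; rewrite /cball /= -ltNge => yr; exists (d x y - r); split; first by lra.
move=> z /=; rewrite /dball /= => h; apply/negP; rewrite -ltNge.
by have := dtri z x y; rewrite (dC z y); lra.
Qed.

Lemma dcont_open (f : X -> X) U : dcontinuous d d f -> dopen d U -> dopen d (f @^-1` U).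
Proof.
move=> cf oU x /= /oU[e [e0 eU]]; have [r [r0 h]] := cf x e e0.
by exists r; split => // y /h; exact: eU.
Qed.

Lemma dcont_closed (f : X -> X) U : dcontinuous d d f -> dclosed U -> dclosed (f @^-1` U).
Proof. by rewrite /dclosed preimage_setC; exact: dcont_open. Qed.

Lemma metric_compact_cover K (r : X -> R) : dclosed K -> (forall x, K x -> 0 < r x) ->
  exists s : seq X, (forall c, c \in s -> K c) /\
    forall x, K x -> exists2 c, c \in s & dball d c (r c) x.
Proof.
move=> cK r0.
(* Adding the complement of K to the balls reduces the compactness of a closed K to that of the
   whole space. *)
pose C := [set V : set X | V = ~` K \/ exists2 c, K c & V = dball d c (r c)].
have [||s [sC hs]] := hcpt (C := C).
- by move=> V [->|[c Kc ->]] //; exact: dopen_ball.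
- move=> x _; have [Kx|nKx] := pselect (K x); last by exists (~` K) => //; left.
  exists (dball d x (r x)); first by right; exists x.
  by rewrite /dball /= dxx; exact: r0.
have key (t : seq (set X)) : (forall U, U \in t -> C U) ->
  exists s : seq X, (forall c, c \in s -> K c) /\
   forall x V, V \in t -> K x -> V x -> exists2 c, c \in s & dball d c (r c) x.
  elim: t => [_|V t IH tC]; first by exists [::].
  have [|s' [s'K hs']] := IH; first by move=> W Wt; apply: tC; rewrite inE Wt orbT.
  have [VE|[c Kc VE]] := tC V (mem_head _ _).
  - exists s'; split => // x W; rewrite inE => /orP[/eqP->|]; last exact: hs'.
    by rewrite VE.
  - exists (c :: s'); split.
      by move=> e; rewrite inE => /orP[/eqP->|]; [|exact: s'K].
    move=> x W; rewrite inE => /orP[/eqP-> _ Vx|Wt Kx Wx].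
      by exists c; rewrite ?mem_head// -VE.
    by have [e es ex] := hs' x W Wt Kx Wx; exists e; rewrite // inE es orbT.
have [s' [s'K h]] := key s sC; exists s'; split => // x Kx.
by have [//|V Vs Vx] := hs x; exact: h Vs Kx Vx.
Qed.

Lemma finite_net (r : R) : 0 < r -> exists s : seq X, forall x, exists2 c, c \in s & d c x < r.
Proof.
move=> r0; have [//|s [_ h]] := @metric_compact_cover setT (fun=> r) dclosedT.
by exists s => x; exact: h.
Qed.

(** Each point of K has a closed ball inside some U i, and a finite subcover is sorted by the index
    i. A countable open cover is thus replaced by finitely many closed sets, over which a finitely
    additive measure can be summed. *)
Lemma closed_shrink K (U : nat -> set X) : dclosed K -> (forall i, dopen d (U i)) ->
  K `<=` \bigcup_i U i ->
  exists N (L : nat -> set X), [/\ forall i, dclosed (L i), forall i, L i `<=` U i &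
    K `<=` \big[setU/set0]_(i < N) L i].
Proof.
move=> cK oU KU.
have h x : exists ir : nat * R, K x -> 0 < ir.2 /\ cball x ir.2 `<=` U ir.1.
  have [Kx|nKx] := pselect (K x); last by exists (0%N, 0).
  have [i _ Ux] := KU _ Kx; have [r [r0 rU]] := oU i x Ux.
  exists (i, r / 2) => _ /=; split; first by lra.
  by move=> y; rewrite /cball /= => yr; apply: rU; rewrite /dball /=; lra.
pose ir x := projT1 (cid (h x)).
have irP x : K x -> 0 < (ir x).2 /\ cball x (ir x).2 `<=` U (ir x).1.
  by rewrite /ir; case: cid.
have [|s [sK hs]] := @metric_compact_cover K (fun x => (ir x).2) cK.
  by move=> x /irP[].
pose L i := \big[setU/set0]_(c <- s | (c \in s) && ((ir c).1 == i)) cball c (ir c).2.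
exists (\max_(c <- s) (ir c).1).+1, L; split.
- move=> i; rewrite /L; elim/big_rec : _ => [|c A _ cA]; first exact: dclosed0.
  by apply: dclosedU => //; exact: dclosed_cball.
- move=> i x; rewrite /L -bigcup_seq_cond => -[c /= /andP[_ /andP[cs /eqP <-]]].
  by apply: (irP c (sK _ cs)).2.
- move=> x Kx; have [c cs xc] := hs x Kx.
  rewrite -bigcup_mkord; exists (ir c).1.
    by rewrite /= ltnS; apply: leq_bigmax_seq.
  rewrite /L -bigcup_seq_cond; exists c; first by rewrite /= cs eqxx.
  by rewrite /cball /=; apply: ltW.
Qed.

End MetricTopology.

(** * The regular Borel measure attached to a finitely additive one *)

Section Regularization.
Context (R : realType) (dsp : measure_display) (X : measurableType dsp).
Context (d : X -> X -> R) (hd : is_metric d) (hcpt : dcompact d).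
Context (hborel : @measurable dsp X = <<s [set U | dopen d U] >>).

Lemma dopen_measurable U : dopen d U -> measurable U.
Proof. by move=> oU; rewrite hborel; apply: sub_sigma_algebra. Qed.

Lemma dclosed_measurable K : dclosed d K -> measurable K.
Proof. by move=> /dopen_measurable/measurableC; rewrite setCK. Qed.

Lemma dcont_measurable (f : X -> X) E : dcontinuous d d f -> measurable E ->
  measurable (f @^-1` E).
Proof.
move=> cf; rewrite {1}hborel.
apply: (@smallest_sub _ (sigma_algebra setT) _ [set E | measurable (f @^-1` E)]).
  split => [|A|A].
  - by rewrite /= preimage_set0.
  - rewrite /= setTD preimage_setC; exact: measurableC.
  - by move=> mA; rewrite /= preimage_bigcup; apply: bigcup_measurable => i _; exact: mA.
by move=> U oU /=; apply: dopen_measurable; exact: dcont_open.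
Qed.

Context (m : set X -> R) (hm : fap m).

(* Inner regularisation of the finitely additive [m] on open sets; the outer
   measure it induces is the Riesz representative of [m]. *)
Definition lam (U : set X) : R := sup [set m K | K in [set K | dclosed d K /\ K `<=` U]].

Let lam_sup U : has_sup [set m K | K in [set K | dclosed d K /\ K `<=` U]].
Proof.
split; first by exists (m set0), set0 => //; split => //; exact: dclosed0.
by exists 1 => _ [K [cK _] <-]; apply: fap_le1 => //; exact: dclosed_measurable.
Qed.

Lemma le_lam U K : dclosed d K -> K `<=` U -> m K <= lam U.
Proof. by move=> cK KU; apply: sup_upper_bound => //; exists K. Qed.

Lemma lam_le U x : (forall K, dclosed d K -> K `<=` U -> m K <= x) -> lam U <= x.
Proof. by move=> h; apply: sup_le_ub; [exact: (lam_sup U).1|move=> _ [K [cK KU] <-]; exact: h]. Qed.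

Lemma lam_mono U V : U `<=` V -> lam U <= lam V.
Proof. by move=> UV; apply: lam_le => K cK KU; apply: le_lam => //; exact: subset_trans UV. Qed.

Lemma lam_ge0 U : 0 <= lam U.
Proof. by rewrite -(fap0 hm); apply: le_lam => //; exact: dclosed0. Qed.

Lemma lam0 : lam set0 = 0.
Proof.
apply/eqP; rewrite eq_le lam_ge0 andbT; apply: lam_le => K _.
by rewrite subset0 => ->; rewrite fap0.
Qed.

Lemma lamT : lam setT = 1.
Proof.
apply/le_anti/andP; split; last by rewrite -{1}(fapT hm) le_lam//; exact: dclosedT.
by apply: lam_le => K cK _; apply: fap_le1 => //; exact: dclosed_measurable.
Qed.

Lemma lam_le_open U : dopen d U -> lam U <= m U.
Proof.
move=> oU; apply: lam_le => K cK KU; apply: fap_le => //.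
  exact: dclosed_measurable.
exact: dopen_measurable.
Qed.

Definition mstar (A : set X) : R := inf [set lam U | U in [set U | dopen d U /\ A `<=` U]].

Let mstar_inf A : has_inf [set lam U | U in [set U | dopen d U /\ A `<=` U]].
Proof.
split; first by exists (lam setT), setT => //; split => //; exact: dopenT.
by exists 0 => _ [U _ <-]; exact: lam_ge0.
Qed.

Lemma mstar_le A U : dopen d U -> A `<=` U -> mstar A <= lam U.
Proof. by move=> oU AU; apply: ge_inf; [exact: (mstar_inf A).2|exists U]. Qed.

Lemma le_mstar A x : (forall U, dopen d U -> A `<=` U -> x <= lam U) -> x <= mstar A.
Proof.
by move=> h; apply: lb_le_inf; [exact: (mstar_inf A).1|move=> _ [U [oU AU] <-]; exact: h].
Qed.

Lemma mstar_open U : dopen d U -> mstar U = lam U.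
Proof.
move=> oU; apply/eqP; rewrite eq_le mstar_le//=.
by apply: le_mstar => V _ UV; exact: lam_mono.
Qed.

Lemma mstar_adherent A e : 0 < e -> exists U, [/\ dopen d U, A `<=` U & lam U < mstar A + e].
Proof.
move=> e0; have [_ [U [oU AU] <-] h] := inf_adherent e0 (mstar_inf A).
by exists U.
Qed.

Lemma mstar_ge0 A : 0 <= mstar A.
Proof. by apply: le_mstar => U _ _; exact: lam_ge0. Qed.

Definition emstar (A : set X) : \bar R := (mstar A)%:E.

Let emstar0 : emstar set0 = 0%E.
Proof. by rewrite /emstar mstar_open ?lam0//; exact: dopen0. Qed.

Let emstar_ge0 A : (0 <= emstar A)%E.
Proof. by rewrite lee_fin mstar_ge0. Qed.

Let emstar_mono : {homo emstar : A B / A `<=` B >-> (A <= B)%E}.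
Proof.
move=> A B AB; rewrite lee_fin; apply: le_mstar => U oU BU; apply: mstar_le => //.
exact: subset_trans BU.
Qed.

(** Countable subadditivity comes from compactness: a closed K inside the union of the U n is
    covered by finitely many closed L i inside U i, so the finite subadditivity of m bounds m K by
    the sum of the lam (U i). *)
Let emstar_sub : sigma_subadditive emstar.
Proof.
move=> A.
suff add2e (e : {posnum R}) :
    (emstar (\bigcup_n A n) <= \sum_(i <oo) emstar (A i) + e%:num%:E)%E.
  by apply/lee_addgt0Pr => _/posnumP[].
apply: (le_trans _ (epsilon_trick _ _ _)) => //.
have h n : exists U, [/\ dopen d U, A n `<=` U & lam U < mstar (A n) + e%:num / (2 ^ n.+1)%:R].
  by apply: mstar_adherent; rewrite divr_gt0.
pose U n := projT1 (cid (h n)).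
have hU n : [/\ dopen d (U n), A n `<=` U n & lam (U n) < mstar (A n) + e%:num / (2 ^ n.+1)%:R].
  by rewrite /U; case: cid.
have oUU : dopen d (\bigcup_n U n) by apply: dopen_bigcup => i _; case: (hU i).
apply: (@le_trans _ _ (lam (\bigcup_n U n))%:E).
  rewrite lee_fin; apply: mstar_le => //.
  by apply: subset_bigcup => i _; case: (hU i).
have pos n : (0 <= emstar (A n) + (e%:num / (2 ^ n.+1)%:R)%:E)%E.
  by rewrite adde_ge0// lee_fin divr_ge0.
suff key K : dclosed d K -> K `<=` \bigcup_n U n ->
  ((m K)%:E <= \sum_(i <oo) (emstar (A i) + (e%:num / (2 ^ i.+1)%:R)%:E))%E.
  case E : (\sum_(i <oo) (emstar (A i) + (e%:num / (2 ^ i.+1)%:R)%:E))%E => [r| |].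
  - by rewrite lee_fin; apply: lam_le => K cK KU; rewrite -lee_fin -E; exact: key.
  - by rewrite leey.
  - by have := key _ (dclosed0 d) (@sub0set _ _); rewrite E.
move=> cK /(closed_shrink hd hcpt cK)[i|N [L [cL LU KL]]]; first by case: (hU i).
apply: (@le_trans _ _ (\sum_(0 <= i < N) (emstar (A i) + (e%:num / (2 ^ i.+1)%:R)%:E))%E); last first.
  exact: nneseries_lim_ge.
rewrite big_mkord (eq_bigr (fun i : 'I_N => (mstar (A i) + e%:num / (2 ^ i.+1)%:R)%:E))//.
rewrite sumEFin lee_fin.
apply: (@le_trans _ _ (m (\big[setU/set0]_(i < N) L i))).
  apply: fap_le => //; first exact: dclosed_measurable.
  by apply: bigsetU_measurable => i _; exact: dclosed_measurable.
apply: (le_trans (fap_sum_le _ hm _)).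
  by move=> i _; exact: dclosed_measurable.
apply: ler_sum => i _; have [_ _ /ltW hi] := hU i; apply: le_trans hi.
exact: le_lam.
Qed.

HB.instance Definition _ := isOuterMeasure.Build R X emstar emstar0 emstar_ge0
  emstar_mono emstar_sub.

(** Given an open W containing A, exhaust first the part of W in U by a closed K, and then W \ K,
    which contains A \ U, by a closed L. K and L are disjoint in W, so m K + m L <= lam W. *)
Lemma dopen_caratheodory U : dopen d U -> caratheodory_measurable emstar U.
Proof.
move=> oU; apply: le_caratheodory_measurable => A; rewrite /emstar -EFinD lee_fin.
apply: le_mstar => W oW AW.
rewrite -lerBrDr; apply: (@le_trans _ _ (lam (W `&` U))).
  by apply: mstar_le; [exact: dopenI|exact: setSI].
apply: lam_le => K cK KWU; rewrite lerBrDr addrC -lerBrDr.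
apply: (@le_trans _ _ (lam (W `\` K))).
  apply: mstar_le; first exact: dopenD.
  by move=> x [/AW Wx nUx]; split => // /KWU[].
apply: lam_le => L cL LWK; rewrite lerBrDr -fapU//; last 3 first.
- exact: dclosed_measurable.
- exact: dclosed_measurable.
- by apply/seteqP; split => x // -[/LWK[_ nK] /nK].
apply: le_lam; first exact: dclosedU.
by move=> x [/LWK[]|/KWU[]].
Qed.

Lemma measurable_caratheodory E : measurable E -> caratheodory_measurable emstar E.
Proof.
rewrite hborel.
apply: (@smallest_sub _ (sigma_algebra setT) _ (caratheodory_measurable emstar)).
  split.
  - exact: caratheodory_measurable_set0.
  - by move=> A cA; rewrite setTD; exact: caratheodory_measurable_setC.
  - exact: caratheodory_measurable_bigcup.
by move=> U oU; exact: dopen_caratheodory.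
Qed.

Let emstar_sigma : semi_sigma_additive (emstar : set X -> \bar R).
Proof.
move=> A mA tA mUA; apply: caratheodory_measure_sigma_additive => //.
  by move=> i; exact: measurable_caratheodory.
exact: measurable_caratheodory.
Qed.

HB.instance Definition _ := isMeasure.Build dsp X R emstar emstar0 emstar_ge0 emstar_sigma.

Let emstarT : emstar setT = 1%E.
Proof. by rewrite /emstar mstar_open ?lamT//; exact: dopenT. Qed.

HB.instance Definition _ := Measure_isProbability.Build dsp X R emstar emstarT.

Lemma regularization : exists mu : probability X R,
  (forall U, dopen d U -> pm mu U = lam U) /\
  (forall E e, 0 < e -> exists U, [/\ dopen d U, E `<=` U & pm mu U < pm mu E + e]).
Proof.
exists (emstar : probability X R); split => [U oU|E e e0].
  by rewrite /pm /= mstar_open.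
have [U [oU EU h]] := mstar_adherent E e0.
by exists U; split => //; rewrite /pm /= mstar_open.
Qed.
End Regularization.

Lemma cvg_sumr (R : realType) (T I : Type) (F : set_system T) (s : seq I)
  (f : T -> I -> R) (l : I -> R) : Filter F -> (forall i, (fun t => f t i) @ F --> l i) ->
  (fun t => \sum_(i <- s) f t i) @ F --> \sum_(i <- s) l i.
Proof.
move=> FF h; elim: s => [|i s IH].
  by rewrite big_nil; under eq_fun do rewrite big_nil; exact: cvg_cst.
by rewrite big_cons; under eq_fun do rewrite big_cons; apply: cvgD; [exact: h|].
Qed.

Lemma free_ultrafilter : exists U : set_system nat, UltraFilter U /\ \oo `<=` U.
Proof. by have [U [uU sU]] := ultraFilterLemma eventually_filter; exists U. Qed.

Lemma etaR_continuous (R : realType) : continuous (@etaR R).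
Proof.
move=> t; have E : @etaR R = fun x => - (x * ln x) by apply/funext => x; rewrite etaRE.
have [t0|t0|->] := ltgtP t 0.
- apply: cvg_near_cst; near=> x.
  rewrite !etaRE !ln0 ?mulr0 ?oppr0 ?(ltW t0)//; apply/ltW; near: x; exact: lt_nbhsl.
- rewrite E; apply: cvgN; apply: cvgM; first exact: cvg_id.
  exact: continuous_ln.
(* At 0, with s = sqrt x, eta(x) = eta(s s) = 2 s eta(s) <= 2 s. *)
- rewrite /continuous_at etaR0; apply: (@squeeze_cvgr _ _ _ _ (fun=> 0) (fun x => 2 * Num.sqrt x)).
  + near=> x; have x1 : x < 1 by near: x; exact: lt_nbhsl.
    apply/andP; split; first by apply: etaR_ge0; exact: ltW.
    have [x0|x0] := ltP 0 x; last first.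
      by rewrite etaRE ln0 ?mulr0 ?oppr0 ?mulr_ge0 ?sqrtr_ge0.
    have s0 : 0 < Num.sqrt x by rewrite sqrtr_gt0.
    have xE : x = Num.sqrt x * Num.sqrt x by rewrite -expr2 sqr_sqrtr// ltW.
    rewrite {1}xE etaR_mul ?sqrtr_ge0//.
    have : etaR (Num.sqrt x) <= 1 by rewrite etaR_le1 ?sqrtr_ge0// -sqrtr1 ler_wsqrtr// ltW.
    by move=> /(ler_wpM2l (ltW s0)); lra.
  + exact: cvg_cst.
  + have h : (fun x : R => 2 * Num.sqrt x) @ (0 : R) --> 2 * Num.sqrt (0 : R).
      by apply: cvgM; [exact: cvg_cst|exact: sqrt_continuous].
    by rewrite sqrtr0 mulr0 in h.
Unshelve. all: by end_near. Qed.

(** * Ultralimits and semicontinuity of entropy *)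

Section UltraLimit.
Context (R : realType) (U : set_system nat) (uU : UltraFilter U) (sU : \oo `<=` U).
Implicit Types (u v : nat -> R).

Definition ulim u : R := lim (u @ U).

Lemma ulim_cvg u a b : (forall n, a <= u n <= b) -> u @ U --> ulim u.
Proof.
move=> hu; suff : cvg (u @ U) by [].
have := @segment_compact R a b; rewrite compact_ultra => /(_ (u @ U)) H.
have /H : UltraFilter (u @ U).
  split; first exact: fmap_proper_filter.
  move=> H' PH' sub; apply/seteqP; split => [A HA|]; last exact: sub.
  have [//|nA] := in_ultra_setVsetC (u @^-1` A) uU.
  have /sub HnA : (u @ U) (~` A) by exact: nA.
  have [x [Ax nAx]] := filter_ex (filterI HA HnA); by exfalso; exact: nAx.
move=> [|l [_ ul]]; last by apply/cvg_ex; exists l.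
by rewrite /=; apply: filterE => n /=; rewrite in_itv /= hu.
Qed.

Lemma ulim_unique u l : u @ U --> l -> ulim u = l.
Proof. by move=> h; exact: (@cvg_lim _ _ _ _ _ _ _ h). Qed.

Lemma ulim_le u v a b a' b' : (forall n, a <= u n <= b) -> (forall n, a' <= v n <= b') ->
  (\forall n \near \oo, u n <= v n) -> ulim u <= ulim v.
Proof.
move=> /ulim_cvg hu /ulim_cvg hv uv.
apply: (@ler_lim _ U _ R u v); [exact: (cvgP _ hu)|exact: (cvgP _ hv)|exact: sU].
Qed.

Lemma ulim_ge u a b c : (forall n, a <= u n <= b) ->
  (\forall n \near \oo, c <= u n) -> c <= ulim u.
Proof.
by move=> /ulim_cvg hu cu; apply: (@limr_ge _ U _ R c u); [exact: (cvgP _ hu)|exact: sU].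
Qed.

Context (dsp : measure_display) (X : measurableType dsp).
Context (ms : nat -> set X -> R) (hms : forall n, fap (ms n)).

Definition mlim : set X -> R := fun E => ulim (fun n => ms n E).

Lemma ms_bound E : measurable E -> forall n, 0 <= ms n E <= 1.
Proof. by move=> mE n; rewrite fap_ge0// fap_le1. Qed.

Lemma mlim_cvg E : measurable E -> (fun n => ms n E) @ U --> mlim E.
Proof. by move=> mE; apply: ulim_cvg; exact: ms_bound. Qed.

Lemma fap_mlim : fap mlim.
Proof.
split => [E mE||E F mE mF EF].
- by apply: (ulim_ge (ms_bound mE)); apply: nearW => n; apply: fap_ge0.
- by apply: ulim_unique; under eq_fun do rewrite fapT//; exact: cvg_cst.
- apply: ulim_unique; under eq_fun do rewrite fapU//.
  by apply: cvgD; apply: mlim_cvg.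
Qed.

Lemma mlim_ent (A : finType) (f : X -> A) : fmeas f ->
  (fun n => ent (ms n) f) @ U --> ent mlim f.
Proof.
move=> mf; apply: cvg_sumr => a.
by apply: continuous_cvg; [exact: etaR_continuous|exact: mlim_cvg].
Qed.

Lemma mlim_ent_ge (A : finType) (f : X -> A) c : fmeas f ->
  (forall e, 0 < e -> \forall n \near \oo, c - e <= ent (ms n) f) -> c <= ent mlim f.
Proof.
move=> mf h; apply/ler_addgt0Pr => e e0.
have := mlim_ent mf; move=> /cvgrPdist_lt /(_ _ (divr_gt0 e0 (ltr0n _ 2))) h1.
have e2 : 0 < e / 2 by lra.
have [n [/= h2 h3]] := filter_ex (filterI h1 (sU (h _ e2))).
by move: h2; rewrite ltr_norml => /andP[? ?]; lra.
Qed.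
End UltraLimit.

Lemma fin_pos_min (R : realType) (I : finType) (r : I -> R) :
  (forall i, 0 < r i) -> exists r0, 0 < r0 /\ forall i, r0 <= r i.
Proof.
move=> r0; exists (\big[Num.min/1]_i r i); split.
  by elim/big_rec : _ => // i x _ x0; rewrite lt_min r0.
by move=> i; apply: bigmin_le_cond.
Qed.

Lemma bigmin_seq_le (R : realType) (I : eqType) (s : seq I) (r : I -> R) c :
  c \in s -> \big[Num.min/1]_(i <- s) r i <= r c.
Proof.
elim: s => // i s IH; rewrite inE big_cons ge_min => /orP[/eqP->|/IH ->].
  by rewrite lexx.
by rewrite orbT.
Qed.

Section FirstCover.
Context (dsp : measure_display) (X : measurableType dsp) (I : finType).

(** phi picks the first set that contains x, which makes the cover disjoint while keeping it
    measurable. *)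
Lemma first_cover (D : I -> set X) : (forall i, measurable (D i)) ->
  (forall x, exists i, D i x) ->
  exists phi : X -> I, fmeas phi /\ forall x, D (phi x) x.
Proof.
move=> mD cD.
have h x : exists i, D i x /\ forall j, (enum_rank j < enum_rank i)%N -> ~ D j x.
  have [i Di] := cD x.
  have [n] := ubnP (enum_rank i); elim: n i Di => // n IH i Di; rewrite ltnS => lin.
  have [[j [ji Dj]]|H] := pselect (exists j, (enum_rank j < enum_rank i)%N /\ D j x).
    by apply: IH Dj _; exact: leq_trans ji lin.
  by exists i; split => // j ji Dj; apply: H; exists j.
exists (fun x => projT1 (cid (h x))); split; last by move=> x; case: cid => i [].
move=> i.
rewrite (_ : _ @^-1` _ = D i `\` \big[setU/set0]_(j | (enum_rank j < enum_rank i)%N) D j).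
  by apply: measurableD => //; apply: bigU_measurable.
apply/seteqP; split => x /=.
  move=> <-; case: cid => j /= [Dj hj]; split => // /in_bigU[k [_ kj Dk]].
  exact: hj kj Dk.
move=> [Di hi]; case: cid => j /= [Dj hj].
have [ij|ij|/val_inj/enum_rank_inj//] := ltngtP (enum_rank j) (enum_rank i).
  by exfalso; apply: hi; apply/in_bigU; exists j; rewrite mem_index_enum.
by exfalso; exact: hj ij Di.
Qed.
End FirstCover.

(** * Upper semicontinuity of the entropy of small partitions *)

Section UpperSemicontinuity.
Context (R : realType) (G : choiceType) (mul : G -> G -> G) (one : G) (inv : G -> G).
Context (hG : is_group mul one inv).
Context (dsp : measure_display) (X : measurableType dsp).
Context (d : X -> X -> R) (hd : is_metric d) (hcpt : dcompact d).
Context (hborel : @measurable dsp X = <<s [set U | dopen d U] >>).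
Context (act : G -> X -> X) (hact : is_action mul one act).
Context (hcont : forall g, dcontinuous d d (act g)).
Implicit Types (m : set X -> R) (A : finType) (mu : probability X R).

Lemma hmact g E : measurable E -> measurable (act g @^-1` E).
Proof. exact: (dcont_measurable hborel). Qed.

(** One e' < e serves all cells: the slack e - e' leaves room to thicken them to open sets in
    [entropy_usc]. *)
Definition diam_lt A (f : X -> A) (e : R) :=
  exists e', e' < e /\ forall x y, f x = f y -> d x y <= e'.

Definition outer_regular mu :=
  forall E e, 0 < e -> exists U, [/\ dopen d U, E `<=` U & pm mu U < pm mu E + e].

Definition regularizes mu m :=
  (forall U, dopen d U -> pm mu U = lam d m U) /\ outer_regular mu.

(** On open sets the inequality mu (g^-1 U) <= mu U is inherited from m through [lam], because g is
    a homeomorphism; outer regularity carries it to Borel sets, and the inverse of g gives the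
    converse. *)
Lemma regularizes_invariant mu m : fap m -> act_invariant act m -> regularizes mu m ->
  invariant_measure act mu.
Proof.
move=> hm im [mulam reg].
have o g U : dopen d U -> pm mu (act g @^-1` U) <= pm mu U.
  move=> oU; rewrite !mulam//; last exact: dcont_open.
  apply: (lam_le hborel hm) => K cK KU.
  rewrite -(im (inv g)); last exact: (dclosed_measurable hborel).
  apply: (le_lam hborel hm); first exact: dcont_closed.
  by move=> x /= /KU /=; rewrite (actVK hG hact).
have le g E : measurable E -> pm mu (act g @^-1` E) <= pm mu E.
  move=> mE; apply/ler_addgt0Pr => e e0.
  have [U [oU EU]] := reg E e e0; move/ltW; apply: le_trans.
  apply: le_trans (o g U oU).
  apply: fap_le; [exact: fap_pm|exact: hmact| |].
    exact/hmact/(dopen_measurable hborel).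
  by move=> x /= /EU.
move=> g E mE; rewrite !pmE//; last exact: hmact.
congr (_%:E); apply/le_anti/andP; split; first exact: le.
have := le (inv g) _ (hmact g mE); rewrite -comp_preimage.
rewrite (_ : act g \o act (inv g) = id) ?preimage_id//.
by apply/funext => x /=; rewrite (actVK hG hact).
Qed.

Lemma regular_closed mu E e : outer_regular mu -> measurable E -> 0 < e ->
  exists K, [/\ dclosed d K, K `<=` E & pm mu (E `\` K) < e].
Proof.
move=> reg mE e0; have [U [oU EU h]] := reg (~` E) e e0.
exists (~` U); split; first exact: dclosedC.
  by move=> x nU; apply: contrapT => nE; apply: nU; exact: EU.
rewrite setDE setCK; move: h; have hm := fap_pm mu.
have mU := dopen_measurable hborel oU.
rewrite (fap_split hm mU mE) setIC addrC.
rewrite (_ : U `\` E = ~` E); first by lra.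
by apply/seteqP; split => x /=; [case|move=> nE; split => //; exact: EU].
Qed.

Lemma closed_gap C D : dclosed d C -> dclosed d D -> C `&` D = set0 ->
  exists r, 0 < r /\ forall x y, C x -> D y -> r <= d x y.
Proof.
move=> cC cD CD.
have h x : exists r, C x -> 0 < r /\ dball d x (2 * r) `<=` ~` D.
  have [Cx|nC] := pselect (C x); last by exists 0.
  have [|r [r0 rD]] := cD x; first by move=> Dx; move/seteqP : CD => [/(_ x) + _]; apply.
  by exists (r / 2) => _; split; [lra|rewrite mulrC divfK].
pose r x := projT1 (cid (h x)).
have rP x : C x -> 0 < r x /\ dball d x (2 * r x) `<=` ~` D by rewrite /r; case: cid.
have [|s [sC hs]] := metric_compact_cover hd hcpt (r := r) cC; first by move=> x /rP[].
exists (\big[Num.min/1]_(c <- s) r c); split.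
  rewrite big_seq; elim/big_rec : _ => // c x cs x0; rewrite lt_min x0 andbT.
  exact: (rP c (sC _ cs)).1.
move=> x y Cx Dy; have [c cs xc] := hs x Cx.
have [rc0 hc] := rP c (sC _ cs).
have : 2 * r c <= d c y by rewrite leNgt; apply/negP => /hc.
have := dtri hd x c y; move: xc; rewrite /dball /=.
suff : \big[Num.min/1]_(c <- s) r c <= r c by lra.
exact: bigmin_seq_le.
Qed.

Lemma dopen_bigcap_fin (I : finType) (O : I -> set X) :
  (forall i, dopen d (O i)) -> dopen d (\bigcap_i O i).
Proof.
move=> oO x Ox; have h i : exists r, 0 < r /\ dball d x r `<=` O i by exact/oO/Ox.
pose r i := projT1 (cid (h i)).
have rP i : 0 < r i /\ dball d x (r i) `<=` O i by rewrite /r; case: cid.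
have [i|r0 [r00 hr]] := @fin_pos_min R _ r; first exact: (rP i).1.
exists r0; split => // y; rewrite /dball /= => xy i _.
by apply: (rP i).2; rewrite /dball /=; exact: lt_le_trans xy (hr i).
Qed.

Lemma closed_gaps A (C : A -> set X) : (forall a, dclosed d (C a)) ->
  (forall a b, a != b -> C a `&` C b = set0) ->
  exists r, 0 < r /\ forall a b x y, a != b -> C a x -> C b y -> r <= d x y.
Proof.
move=> cC dC.
have h (t : A * A) : exists r, 0 < r /\
    (t.1 != t.2 -> forall x y, C t.1 x -> C t.2 y -> r <= d x y).
  have [->|tn] := eqVneq t.1 t.2; first by exists 1; split.
  by have [r [r0 hr]] := closed_gap (cC t.1) (cC t.2) (dC _ _ tn); exists r; split.
pose r t := projT1 (cid (h t)).
have [t|r0 [r00 hr]] := @fin_pos_min R _ r; first by rewrite /r; case: cid => ? [].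
exists r0; split => // a b x y ab Ca Cb; apply: (le_trans (hr (a, b))).
by rewrite /r; case: cid => s /= [_]; apply.
Qed.

Lemma etaR_sum_cont (W : finType) (p : W -> R) (e : R) : 0 < e ->
  exists r, 0 < r /\ forall q : W -> R, (forall w, `|q w - p w| < r) ->
    \sum_w etaR (q w) <= \sum_w etaR (p w) + e.
Proof.
move=> e0; pose k : R := #|W|%:R + 1.
have k0 : 0 < k by rewrite /k ltr_wpDl.
have h w : exists r : R, 0 < r /\ forall q, `|q - p w| < r -> etaR q <= etaR (p w) + e / k.
  have /cvgrPdist_lt /(_ _ (divr_gt0 e0 k0)) := @etaR_continuous R (p w).
  move=> /nbhs_ballP[r /= r0 hr]; exists r; split => // q qp.
  have := hr q; rewrite /ball /= distrC => /(_ qp).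
  by rewrite ltr_norml => /andP[+ _]; lra.
pose r w := projT1 (cid (h w)).
have [w|r0 [r00 hr]] := @fin_pos_min R _ r; first by rewrite /r; case: cid => ? [].
exists r0; split => // q hq.
have key w : etaR (q w) <= etaR (p w) + e / k.
  have := lt_le_trans (hq w) (hr w); rewrite /r; case: cid => s /= [_]; exact.
apply: (le_trans (ler_sum _ (fun w _ => key w))).
rewrite big_split /= lerD2l sumr_const -mulr_natl cardT -cardE mulrCA.
by rewrite ler_piMr ?(ltW e0)// ler_pdivrMr// /k mul1r lerDl.
Qed.

(** The measures m and mu are compared on open sets only, where mu U <= m U. Closed cores C a
    carrying almost all of the mu-mass of the cells are therefore thickened to disjoint open sets V
    a. The names of f' then have m-mass at least nearly the mu-mass of the names of f; both families
    sum to 1, so the reverse estimate follows and the entropies are close. *)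
Lemma entropy_usc mu m A (f : X -> A) (e : R) (K : {fset G}) (eta : R) :
  fap m -> regularizes mu m -> invariant_measure act mu -> fmeas f ->
  diam_lt f e -> 0 < eta ->
  exists (B : finType) (f' : X -> B), [/\ fmeas f', diam_lt f' e &
    Hset act m f' K <= Hset act (pm mu) f K + eta].
Proof.
move=> hm [mulam reg] imu mf [e' [e'e he']] eta0.
have hmu := fap_pm mu.
have e'0 : 0 <= e' by rewrite -(dxx hd point); exact: he'.
have e40 : 0 < e / 4 by lra.
have [s hs] := finite_net hd hcpt e40.
pose n := size s.
pose B : finType := (A + 'I_n)%type.
pose p := law (pm mu) (name act ((inl : A -> B) \o f) K).
have mfi : fmeas ((inl : A -> B) \o f) by exact: fmeas_comp.
have [rho [rho0 hrho]] := etaR_sum_cont p eta0.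
pose W : finType := {ffun K -> B}.
(* A name loses at most |K| kap, one kap for each coordinate; what it gains is at most the sum of
   the |W| possible losses. *)
pose k : R := (#|W|%:R + 1) * (#|` K|%:R + 1).
have k0 : 0 < k by rewrite mulr_gt0// ltr_wpDl.
pose kap := rho / k.
have kap0 : 0 < kap by rewrite divr_gt0.
have hC a := regular_closed reg (mf a) kap0.
pose C a := projT1 (cid (hC a)).
have CP a : [/\ dclosed d (C a), C a `<=` f @^-1` [set a] & pm mu (f @^-1` [set a] `\` C a) < kap].
  by rewrite /C; case: cid.
have [|a b ab|r [r0 hr]] := closed_gaps (C := C).
- by move=> a; case: (CP a).
- apply/seteqP; split => x //= [Ca Cb].
  have [_ Ha _] := CP a; have [_ Hb _] := CP b.
  have Ea : f x = a := Ha _ Ca; have Eb : f x = b := Hb _ Cb.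
  by rewrite -Ea -Eb eqxx in ab.
(* r / 2 keeps the V a disjoint; (e - e') / 4 keeps their diameters at most e' + 2 t < e. *)
pose t := Num.min (r / 2) ((e - e') / 4).
have t0 : 0 < t by rewrite lt_min; apply/andP; split; lra.
have tr : t <= r / 2 by rewrite ge_min lexx.
have te : t <= (e - e') / 4 by rewrite ge_min lexx orbT.
pose V a := \bigcup_(c in C a) dball d c t.
have oV a : dopen d (V a) by apply: dopen_bigcup => c _; exact: dopen_ball.
have CV a : C a `<=` V a by move=> c Cc; exists c; rewrite //= /dball /= dxx.
have dV a b x : V a x -> V b x -> a = b.
  move=> [c Cc cx] [c' Cc' cx']; apply/eqP/negP => /negP ab.
  have := hr _ _ _ _ ab Cc Cc'; have := dtri hd x c c'.
  rewrite (dC hd x c'); move: cx cx'; rewrite /dball /=; lra.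
(* What the V a leave over is cut by balls of radius e / 4 and labelled by [inr], so that f' is
   defined everywhere with small cells. *)
pose D (i : B) := match i with inl a => V a
   | inr i => dball d (nth point s i) (e / 4) `\` \bigcup_a V a end.
have mVU : measurable (\bigcup_a V a).
  by apply: (dopen_measurable hborel); apply: dopen_bigcup.
have mD i : measurable (D i).
  case: i => [a|i] /=; first exact: (dopen_measurable hborel).
  apply: measurableD => //; apply: (dopen_measurable hborel); exact: dopen_ball.
have cD x : exists i, D i x.
  have [[a Va]|nV] := pselect (exists a, V a x); first by exists (inl a).
  have [c cs xc] := hs x.
  have ls : (index c s < n)%N by rewrite index_mem.
  exists (inr (Ordinal ls)) => /=; split; last by move=> [a _ Va]; apply: nV; exists a.
  by rewrite /= nth_index.
have [f' [mf' hf']] := first_cover mD cD.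
exists B, f'; split => //.
  exists (Num.max (e / 2) (e' + 2 * t)); split.
    by rewrite gt_max; apply/andP; split; lra.
  move=> x y xy; rewrite le_max; move: (hf' x) (hf' y); rewrite xy.
  case: (f' y) => [a|i] /=.
    move=> [c Cc cx] [c' Cc' cy]; apply/orP; right.
    have [_ Ha _] := CP a; have Ec : f c = a := Ha _ Cc; have Ec' : f c' = a := Ha _ Cc'.
    have := he' c c' (etrans Ec (esym Ec')).
    have := dtri hd c x y; have := dtri hd c' c y; move: cx cy; rewrite /dball /=.
    by rewrite (dC hd x c); lra.
  move=> [cx _] [cy _]; apply/orP; left.
  have := dtri hd (nth point s i) x y; rewrite (dC hd x (nth point s i)); move: cx cy; rewrite /dball /=.
  lra.
have f'V a x : V a x -> f' x = inl a.
  move=> Va; move: (hf' x); case: (f' x) => [b Vb|i [_ nV]]; first by rewrite (dV _ _ _ Vb Va).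
  by exfalso; apply: nV; exists a.
apply: (@le_trans _ _ (ent (pm mu) (name act ((inl : A -> B) \o f) K) + eta)); last first.
  rewrite lerD2r; apply: ent_le => //; first exact: (name_meas hmact).
  by move=> x y /(name_eqP) h; apply/name_eqP => g gK /=; rewrite h.
pose q := law m (name act f' K).
have mn : fmeas (name act f' K) by exact: (name_meas hmact).
have mp : fmeas (name act ((inl : A -> B) \o f) K) by exact: (name_meas hmact).
have q1 : \sum_w q w = 1 by exact: law_sum1.
have p1 : \sum_w p w = 1 by exact: law_sum1.
(* If all coordinates of a point of the name w lie in the cores, the point lies in the open set O,
   where m dominates mu; otherwise some coordinate misses its core, and the point lies in a set
   [Z g] of mass at most kap. *)
have low w : p w - #|` K|%:R * kap <= q w.
  have [[v wv]|nw] := pselect (exists v : K -> A, forall g, w g = inl (v g)); last first.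
    have -> : p w = 0.
      rewrite /p /law (_ : _ @^-1` _ = set0) ?fap0//.
      apply/seteqP; split => x //= xw; apply: nw.
      by exists (fun g => f (act (val g) x)) => g; rewrite -xw ffunE.
    have : 0 <= q w by exact: law_ge0.
    have : 0 <= #|` K|%:R * kap by rewrite mulr_ge0 ?(ltW kap0).
    lra.
  pose O := \bigcap_g (act (val (g : K)) @^-1` V (v g)).
  have oO : dopen d O by apply: dopen_bigcap_fin => g; exact: dcont_open.
  pose Z g := act (val (g : K)) @^-1` (f @^-1` [set v g] `\` C (v g)).
  have mOK : measurable O by exact: (dopen_measurable hborel).
  have mZ g : measurable (Z g).
    apply: hmact; apply: measurableD => //; apply: (dclosed_measurable hborel).
    by case: (CP (v g)).
  have mZU : measurable (\big[setU/set0]_g Z g) by exact: bigU_measurable.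
  have : p w <= pm mu (O `|` \big[setU/set0]_g Z g).
    apply: fap_le => //; first exact: measurableU.
    move=> x /= xw.
    have fx g : f (act (val g) x) = v g.
      by have := wv g; rewrite -xw ffunE /= => -[].
    have [hC'|nC] := pselect (forall g, C (v g) (act (val g) x)).
      by left => g _ /=; exact: CV.
    right; have [g ng] : exists g, ~ C (v g) (act (val g) x).
      by apply/existsNP.
    by apply/in_bigU; exists g; split; rewrite ?mem_index_enum//=; split.
  have := fapU_le hmu mOK mZU.
  have : pm mu (\big[setU/set0]_g Z g) <= #|` K|%:R * kap.
    apply: (le_trans (fap_sum_le _ hmu _)) => //.
    rewrite cardfE mulr_natl -sumr_const; apply: ler_sum => g _.
    rewrite (invariant_pm imu)//; first by case: (CP (v g)) => _ _ /ltW.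
    by apply: measurableD => //; apply: (dclosed_measurable hborel); case: (CP (v g)).
  have : m O <= q w.
    apply: fap_le => //.
    move=> x Ox; apply/ffunP => g; rewrite ffunE wv; apply: f'V; exact: Ox g I.
  have := lam_le_open hborel hm oO; rewrite -mulam//; lra.
apply: hrho => w.
pose del := #|` K|%:R * kap.
have del0 : 0 <= del by rewrite mulr_ge0 ?(ltW kap0).
have lowd : p w - del <= q w by exact: low.
(* The upper bound comes from the total mass: every other name has lost at most del. *)
have up : q w <= p w + #|W|%:R * del.
  have : \sum_(w' | w' != w) (p w' - del) <= \sum_(w' | w' != w) q w'.
    by apply: ler_sum => w' _; exact: low.
  rewrite sumrB sumr_const.
  have := q1; rewrite (bigD1 w)//=; have := p1; rewrite (bigD1 w)//= => p1' q1'.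
  have : del *+ #|[pred w' | w' != w]| <= #|W|%:R * del.
    rewrite -mulr_natl ler_wpM2r// ler_nat; exact: max_card.
  by move: p1' q1'; lra.
have dl : (#|W|%:R + 1) * del < rho.
  rewrite /del mulrA.
  have -> : rho = k * kap by rewrite /kap mulrC divfK// lt0r_neq0.
  by rewrite ltr_pM2r// /k ltr_pM2l ?ltrDl// ltr_wpDl.
have W0 : 0 <= #|W|%:R * del by exact: mulr_ge0 (ler0n _ _) del0.
move: dl; rewrite -/(q w) mulrDl mul1r => dl.
by rewrite ltr_norml; apply/andP; split; lra.
Qed.

(* Unlike a lower bound on the entropy rates, this property passes to ultralimits,
   because it only involves finitely many coordinates at a time. *)
Definition good (e c : R) m := forall A (f : X -> A), fmeas f -> diam_lt f e ->
  forall K, c * #|` K|%:R <= Hset act m f K.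

Lemma good_regularization mu m e c : fap m -> regularizes mu m ->
  invariant_measure act mu -> good e c m -> good e c (pm mu).
Proof.
move=> hm rm im gm A f mf df K; apply/ler_addgt0Pr => eta eta0.
have [B [f' [mf' df' h]]] := entropy_usc K hm rm im mf df eta0.
exact: le_trans (gm _ _ mf' df' K) h.
Qed.
End UpperSemicontinuity.

(** * Measures of large entropy *)

Section FolnerInfinite.
Context (R : realType) (G : choiceType) (mul : G -> G -> G) (one : G) (inv : G -> G).
Context (hG : is_group mul one inv) (hinf : ~ finite_set [set: G]).
Context (F : nat -> {fset G}) (hF : Folner R mul F).

Lemma large_fset n : exists A : {fset G}, (#|` A| >= n)%N.
Proof.
elim: n => [|n [A An]]; first by exists fset0.
have [x xA] : exists x, x \notin A.
  apply: contrapT => h; apply: hinf; apply: (sub_finite_set _ (finite_fset A)) => x _ /=.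
  by apply/negPn/negP => xA; apply: h; exists x.
by exists (x |` A)%fset; rewrite cardfsU1 xA ltnS.
Qed.

(** If |F_n| < N, a boundary of size at most |F_n| / (N + 1) is empty. Then A F_n lies in F_n, which
    forces |A| <= |F_n| although |A| >= N. *)
Lemma folner_card_large (N : nat) : \forall n \near \oo, (N <= #|` F n|)%N.
Proof.
have [A AN] := large_fset N.
have e0 : 0 < (N.+1%:R)^-1 :> R by rewrite invr_gt0.
have h := folner_mulset hF A e0; near=> n.
rewrite leqNgt; apply/negP => lt.
have : #|` (mulset mul A (F n) `\` F n)%fset|%:R <= N.+1%:R^-1 * #|` F n|%:R :> R.
  by near: n; exact: h.
move=> hn.
have : (mulset mul A (F n) `\` F n)%fset = fset0.
  apply/eqP; rewrite -cardfs_eq0 -leqn0 -ltnS -(ltr_nat R).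
  apply: le_lt_trans hn _; rewrite mulrC ltr_pdivrMr// mul1r ltr_nat.
  exact: leq_trans lt _.
move=> /eqP; rewrite fsetD_eq0 => /fsubsetP AF.
have [x xF] : exists x, x \in F n by apply/fset0Pn; case: hF.
have : (#|` A| <= #|` F n|)%N.
  rewrite -(card_rtrans hG A x); apply: fsubset_leq_card; apply/fsubsetP => y.
  by move=> /imfsetP[a aA ->]; apply: AF; exact: mem_mulset.
by move=> h'; have := leq_ltn_trans (leq_trans AN h') lt; rewrite ltnn.
Unshelve. all: by end_near. Qed.
End FolnerInfinite.

Lemma fset_sum_diff (R : realType) (G : choiceType) (A B : {fset G}) (u : G -> R) :
  (forall g, 0 <= u g <= 1) ->
  \sum_(g <- A) u g <= \sum_(g <- B) u g + #|` (A `\` B)%fset|%:R.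
Proof.
move=> hu; rewrite (bigID (mem B)) /=; apply: lerD.
- rewrite -big_filter [X in _ <= X](bigID (mem A)) /= -[X in _ <= X + _]big_filter.
  rewrite (perm_big [seq i <- B | i \in A]); last first.
    apply: uniq_perm; rewrite ?filter_uniq ?fset_uniq//.
    by move=> g; rewrite !mem_filter andbC.
  by rewrite lerDl; apply: sumr_ge0 => g _; case/andP: (hu g).
- rewrite -big_filter (perm_big (enum_fset (A `\` B)%fset)); last first.
    apply: uniq_perm; rewrite ?filter_uniq ?fset_uniq//.
    by move=> g; rewrite !mem_filter !inE.
  rewrite big_seq_fsetE /= cardfE -sum1_card natr_sum; apply: ler_sum => g _.
  by case/andP: (hu (val g)).
Qed.

Lemma ent_ge_law (R : realType) (dsp : measure_display) (X : measurableType dsp)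
    (m : set X -> R) (A : finType) (f : X -> A) (q : R) :
  fap m -> fmeas f -> 0 < q -> (forall a, law m f a <= q) -> - ln q <= ent m f.
Proof.
move=> hm mf q0 hq; rewrite -[leLHS]mul1r -(law_sum1 hm mf) mulr_suml.
apply: ler_sum => a _; rewrite etaRE -/(law m f a) mulrN lerN2.
have [->|n0] := eqVneq (law m f a) 0; first by rewrite !mul0r.
have l0 : 0 < law m f a by rewrite lt_def n0 law_ge0.
by rewrite ler_pM2l// ler_ln ?posrE.
Qed.

(** * Misiurewicz's construction *)

Section Misiurewicz.
Context (R : realType) (G : choiceType) (mul : G -> G -> G) (one : G) (inv : G -> G).
Context (hG : is_group mul one inv).
Context (dsp : measure_display) (X : measurableType dsp).
Context (d : X -> X -> R) (hd : is_metric d) (hcpt : dcompact d).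
Context (hborel : @measurable dsp X = <<s [set U | dopen d U] >>).
Context (act : G -> X -> X) (hact : is_action mul one act).
Context (hcont : forall g, dcontinuous d d (act g)).
Context (F : nat -> {fset G}) (hF : Folner R mul F).

Lemma separated_exists (eps c : R) : (c%:E < htop_eps d act F eps)%E ->
  forall N, exists n (S : {fset X}), [/\ (N <= n)%N, Defs.separated d act (F n) eps S,
    S != fset0 & c * #|` F n|%:R < ln #|` S|%:R].
Proof.
move=> hc N.
have : (c%:E < ereal_sup [set ((#|` F n|%:R)^-1)%:E * eln (sep_num d act (F n) eps) | n in [set n | (N <= n)%N]])%E.
  by apply: lt_le_trans hc _; apply: ereal_inf_lbound; exists N.
move=> /ereal_sup_gt[_ [n /= Nn <-]] h.
have k0 := folner_card_gt0 hF n.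
set k : R := #|` F n|%:R in k0 h *.
have s1 : (1%:E <= sep_num d act (F n) eps)%E.
  apply: ereal_sup_ubound; exists [fset point]%fset; last by rewrite cardfs1.
  by move=> x y; rewrite !inE => /eqP-> /eqP->; rewrite eqxx.
have : ((expR (c * k))%:E < sep_num d act (F n) eps)%E.
  case: (sep_num _ _ _ _) s1 h => [r| |] //=.
    rewrite lee_fin -EFinM !lte_fin => r1.
    rewrite mulrC -ltr_pdivrMr ?invr_gt0// invrK => h.
    rewrite -[ltRHS]lnK ?posrE ?ltr_expR//; exact: lt_le_trans r1.
  by move=> _ _; rewrite ltry.
move=> /ereal_sup_gt[_ [S /= sS <-]]; rewrite lte_fin => hS.
have S0 : 0 < (#|` S|%:R : R) by apply: lt_trans hS; exact: expR_gt0.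
exists n, S; split => //; first by rewrite -cardfs_gt0 -(ltr_nat R).
by rewrite -[ltLHS]expRK ltr_ln ?posrE ?expR_gt0.
Qed.

Definition unif (S : {fset X}) : set X -> R :=
  fun E => #|` S|%:R^-1 * \sum_(x <- S) (x \in E)%:R.

Lemma fap_unif S : S != fset0 -> fap (unif S).
Proof.
move=> S0; have c0 : 0 < (#|` S|%:R : R) by rewrite ltr0n cardfs_gt0.
split => [E _||E K _ _ EK].
- by rewrite mulr_ge0 ?invr_ge0// sumr_ge0.
- rewrite /unif (eq_bigr (fun=> 1)); last by move=> x _; rewrite in_setT.
  by rewrite big_const_seq count_predT iter_addr_0 mulVf// lt0r_neq0.
- rewrite /unif -mulrDr -big_split /=; congr (_ * _); apply: eq_bigr => x _.
  rewrite in_setU -natrD; congr (_%:R).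
  have : ~~ ((x \in E) && (x \in K)).
    by rewrite -in_setI EK in_set0.
  by case: (x \in E); case: (x \in K).
Qed.

(** Two points with the same name stay within e' < eps of each other along K, so a name class
    contains at most one point of S and has mass at most 1 / |S|. *)
Lemma separated_entropy S K (eps : R) (A : finType) (f : X -> A) : 0 <= eps ->
  S != fset0 -> Defs.separated d act K eps S -> fmeas f -> diam_lt d f eps ->
  ln #|` S|%:R <= Hset act (unif S) f K.
Proof.
move=> eps0 S0 sS mf [e' [e'e hf]].
have c0 : 0 < (#|` S|%:R : R) by rewrite ltr0n cardfs_gt0.
rewrite -[leLHS]opprK -lnV ?posrE//; apply: ent_ge_law.
- exact: fap_unif.
- exact/name_meas/mf/(hmact hborel hcont).
- by rewrite invr_gt0.
- move=> w; rewrite /law /unif ler_piMr ?invr_ge0//.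
  have [[x [xS xw]]|H] := pselect (exists x, x \in S /\ name act f K x = w); last first.
    rewrite big_seq big1 ?ler01// => x xS; case: (boolP (_ \in _)) => //.
    by rewrite inE /= => xw; exfalso; apply: H; exists x.
  rewrite (big_fsetD1 x)//= big_seq big1 ?addr0; first by rewrite lern1 leq_b1.
  move=> y; rewrite !inE => /andP[yx yS]; case: (boolP (_ \in _)) => //.
  rewrite inE /= -xw => /name_eqP yw; exfalso.
  have := sS _ _ yS xS yx; rewrite ltNge => /negP; apply.
  rewrite /dF big_seq; elim/big_rec : _ => // g r gK re.
  by rewrite ge_max re andbT (le_trans (hf _ _ (yw _ gK)))// ltW.
Qed.

Definition average (m : set X -> R) (K : {fset G}) : set X -> R :=
  fun E => #|` K|%:R^-1 * \sum_(g <- K) push act m g E.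

Lemma fap_average m K : K != fset0 -> fap m -> fap (average m K).
Proof.
move=> K0 hm; have c0 : 0 < (#|` K|%:R : R) by rewrite ltr0n cardfs_gt0.
have hp g : fap (push act m g) by apply: fap_push hm => //; exact: (hmact hborel hcont).
split => [E mE||E L mE mL EL].
- by rewrite mulr_ge0 ?invr_ge0// sumr_ge0// => g _; apply: fap_ge0.
- rewrite /average (eq_bigr (fun=> 1)); last by move=> g _; exact: fapT.
  by rewrite big_const_seq count_predT iter_addr_0 mulVf// lt0r_neq0.
- rewrite /average -mulrDr -big_split /=; congr (_ * _); apply: eq_bigr => g _.
  exact: fapU.
Qed.

Lemma average_shift m K g E : K != fset0 -> fap m -> measurable E ->
  `| average m K (act g @^-1` E) - average m K E |
    <= #|` fsymdiff (ltrans mul g K) K|%:R / #|` K|%:R.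
Proof.
move=> K0 hm mE; have c0 : 0 < (#|` K|%:R : R) by rewrite ltr0n cardfs_gt0.
pose u h := push act m h E.
have hu h : 0 <= u h <= 1.
  have hp : fap (push act m h) by apply: fap_push hm => //; exact: (hmact hborel hcont).
  by rewrite fap_ge0// fap_le1.
have -> : average m K (act g @^-1` E) = #|` K|%:R^-1 * \sum_(h <- ltrans mul g K) u h.
  rewrite /average; congr (_ * _).
  rewrite /ltrans big_imfset /=; last by move=> x y _ _; exact: (gmulI hG).
  apply: eq_bigr => h _; rewrite /u /push; congr (m _).
  by apply/seteqP; split => x /=; rewrite (actM hact).
rewrite /average -mulrBr normrM gtr0_norm ?invr_gt0// mulrC ler_pM2r ?invr_gt0//.
have h1 := fset_sum_diff (ltrans mul g K) K hu.
have h2 := fset_sum_diff K (ltrans mul g K) hu.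
rewrite -/(u _).
have a1 : #|` (ltrans mul g K `\` K)%fset|%:R <= #|` fsymdiff (ltrans mul g K) K|%:R :> R.
  by rewrite ler_nat fsubset_leq_card// fsubsetUl.
have a2 : #|` (K `\` ltrans mul g K)%fset|%:R <= #|` fsymdiff (ltrans mul g K) K|%:R :> R.
  by rewrite ler_nat fsubset_leq_card// fsubsetUr.
by rewrite ler_norml; apply/andP; split; rewrite /u in h1 h2 *; lra.
Qed.

(** Concavity of entropy replaces the sum over the translates in Shearer's bound by the entropy of
    their average. *)
Lemma average_entropy m (K L : {fset G}) (A : finType) (f : X -> A) :
  L != fset0 -> fap m -> fmeas f ->
  #|` K|%:R * Hset act m f L <= #|` L|%:R * Hset act (average m L) f K
    + #|` (mulset mul (invset inv K) L `\` L)%fset|%:R * (#|` K|%:R * ecap R A).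
Proof.
move=> L0 hm mf; have hma := hmact hborel hcont.
apply: (le_trans (Hset_shearer_push hG hact hma _ _ hm mf)).
rewrite lerD2r cardfE; apply: ent_mean_le.
- by rewrite -cardfE cardfs_gt0.
- by move=> g; exact: fap_push.
- exact: name_meas.
- by move=> E mE; rewrite /average cardfE big_seq_fsetE.
Qed.

(** Under the uniform measure on S the name along F_n has entropy at least ln |S| > c |F_n|.
    Shearer's inequality spreads this over the windows K g, so for each fixed K the averaged measure
    satisfies H(K) >= c |K| up to an error tending to 0. The ultralimit removes the error, and the
    Folner property makes it invariant. *)
Lemma good_measure_exists (eps c : R) : 0 <= eps -> (c%:E < htop_eps d act F eps)%E ->
  exists mu : probability X R, [/\ invariant_measure act mu, outer_regular d mu &
    good d act eps c (pm mu)].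
Proof.
move=> eps0 hc; have H := separated_exists hc.
have hma := hmact hborel hcont.
pose n k := projT1 (cid (H k)).
have Hn k : exists S : {fset X}, [/\ (k <= n k)%N, Defs.separated d act (F (n k)) eps S,
    S != fset0 & c * #|` F (n k)|%:R < ln #|` S|%:R] by rewrite /n; case: cid.
pose S k := projT1 (cid (Hn k)).
have HS k : [/\ (k <= n k)%N, Defs.separated d act (F (n k)) eps (S k),
    S k != fset0 & c * #|` F (n k)|%:R < ln #|` S k|%:R] by rewrite /S; case: cid.
have nk : n @ \oo --> \oo.
  move=> P [N _ hN]; exists N => // k /= Nk; apply: hN => /=.
  by apply: leq_trans Nk _; case: (HS k).
have F0 k : F k != fset0 by case: hF.
pose ms k := average (unif (S k)) (F (n k)).
have hms k : fap (ms k).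
  by apply: fap_average => //; apply: fap_unif; case: (HS k).
have [U [uU sU]] := free_ultrafilter.
pose m := mlim U ms.
have hm : fap m by exact: fap_mlim.
have im : act_invariant act m.
  move=> g E mE.
  have h1 := mlim_cvg uU hms mE; have h2 := mlim_cvg uU hms (hma g _ mE).
  have h3 : (fun k => ms k (act g @^-1` E) - ms k E) @ U --> m (act g @^-1` E) - m E.
    exact: cvgB.
  apply/eqP; rewrite -subr_eq0; apply/eqP; rewrite -(ulim_unique uU h3).
  apply: (ulim_unique uU).
  suff h4 : (fun k => ms k (act g @^-1` E) - ms k E) @ \oo --> (0 : R).
    by move=> P /h4 hP; exact: sU.
  apply/cvgr0Pnorm_le => e e0.
  have /cvgrPdist_le /(_ _ e0) hP := hF.2 g.
  have hP' : \forall k \near \oo,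
    `|0 - #|` fsymdiff (ltrans mul g (F (n k))) (F (n k))|%:R / #|` F (n k)|%:R| <= e :> R.
    exact: (nk _ hP).
  apply: filterS hP' => k /=; rewrite sub0r normrN => hk.
  apply: le_trans (average_shift g (F0 (n k)) (fap_unif _) mE) _; first by case: (HS k).
  by apply: le_trans hk; exact: ler_norm.
have gm : good d act eps c m.
  move=> A f mf df K; apply: mlim_ent_ge => //; first exact: name_meas.
  move=> e e0.
  have e1 : 0 < e / (#|` K|%:R * ecap R A + 1).
    by rewrite divr_gt0// ltr_wpDl// mulr_ge0// ecap_ge0.
  have hP := folner_mulset hF (invset inv K) e1.
  have hP' : \forall k \near \oo, #|` (mulset mul (invset inv K) (F (n k)) `\` F (n k))%fset|%:R
     <= e / (#|` K|%:R * ecap R A + 1) * #|` F (n k)|%:R by exact: (nk _ hP).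
  apply: filterS hP' => k /= hk.
  have k0 := folner_card_gt0 hF (n k).
  have [_ sS S0 hS] := HS k.
  have h1 := separated_entropy eps0 S0 sS mf df.
  have := average_entropy K (F0 (n k)) (fap_unif S0) mf.
  rewrite -/(ms k) -/(Hset act (ms k) f K) => h2.
  have h3 : c * #|` K|%:R * #|` F (n k)|%:R <= #|` K|%:R * Hset act (unif (S k)) f (F (n k)).
    rewrite -mulrA mulrCA ler_wpM2l//; apply: le_trans h1; exact: ltW.
  have kA : 0 <= #|` K|%:R * ecap R A by rewrite mulr_ge0// ecap_ge0.
  have h4 := ler_wpM2r kA hk.
  have h5 : e / (#|` K|%:R * ecap R A + 1) * #|` F (n k)|%:R * (#|` K|%:R * ecap R A)
      <= e * #|` F (n k)|%:R.
    rewrite mulrAC ler_pM2r// -mulrAC ler_pdivrMr; last by rewrite ltr_wpDl.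
    by rewrite ler_pM2l// lerDl.
  rewrite -(ler_pM2r k0) mulrBl; lra.
have [mu [mulam reg]] := regularization hd hcpt hborel hm.
exists mu; have rm : regularizes d mu m by split.
have imu := regularizes_invariant hG hborel hact hcont hm im rm.
by split => //; apply: good_regularization gm.
Qed.
End Misiurewicz.

(** * Ergodic measures of large entropy *)

Section CountableBase.
Context (R : realType) (dsp : measure_display) (X : measurableType dsp).
Context (d : X -> X -> R) (hd : is_metric d) (hcpt : dcompact d).
Context (hborel : @measurable dsp X = <<s [set U | dopen d U] >>).

(* [O] enumerates the finite unions of balls of a countable base, so that every
   open set is an increasing union of members. *)
Lemma countable_base : exists O : nat -> set X, (forall i, dopen d (O i)) /\
  forall U, dopen d U -> exists j : nat -> nat,
    (forall n k, (n <= k)%N -> O (j n) `<=` O (j k)) /\ U = \bigcup_n O (j n).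
Proof.
have h n : exists s : seq X, forall x, exists2 c, c \in s & d c x < (n.+1%:R)^-1.
  by apply: (finite_net hd hcpt); rewrite invr_gt0.
pose net n := projT1 (cid (h n)).
have netP n x : exists2 c, c \in net n & d c x < (n.+1%:R)^-1.
  by rewrite /net; case: cid.
pose b (k : nat) : set X := match choice.unpickle k : option (nat * nat) with
  | Some p => dball d (nth point (net p.1) p.2) (p.1.+1%:R)^-1 | None => set0 end.
pose O (k : nat) : set X := match choice.unpickle k : option (seq nat) with
  | Some s => \bigcup_(j in [set` s]) b j | None => set0 end.
have ob k : dopen d (b k).
  by rewrite /b; case: choice.unpickle => [p|]; [exact: dopen_ball|exact: dopen0].
exists O; split.
  move=> i; rewrite /O; case: choice.unpickle => [s|]; last exact: dopen0.
  by apply: dopen_bigcup => j _.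
move=> U oU.
pose J n := [seq k <- iota 0 n | `[<b k `<=` U>]].
exists (fun n => choice.pickle (J n)); split.
  move=> n k nk x; rewrite /O !choice.pickleK => -[j /=].
  rewrite !mem_filter !mem_iota !add0n /= => /andP[bU jn] bx.
  by exists j => //=; rewrite mem_filter bU mem_iota add0n (leq_trans jn).
apply/seteqP; split => x.
- move=> Ux; have [r [r0 rU]] := oU x Ux.
  have r20 : 0 < r / 2 by lra.
  have [n _ /(_ n (leqnn _)) hn] := near_infty_natSinv_lt (PosNum r20).
  have [c cn xc] := netP n x.
  pose k := choice.pickle (n, index c (net n)).
  have bk : b k = dball d c (n.+1%:R)^-1 by rewrite /b /k choice.pickleK /= nth_index.
  exists k.+1 => //; rewrite /O choice.pickleK; exists k; last by rewrite bk.
  rewrite /= mem_filter mem_iota add0n ltnSn !andbT; apply/asboolP.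
  rewrite bk => y cy; apply: rU; rewrite /dball /= in cy *.
  have hn' : (n.+1%:R)^-1 < r / 2 := hn.
  have := dtri hd c x y; rewrite (dC hd x c); move: hn' cy xc.
  by move: (n.+1%:R^-1 : R) => q; clear; move=> *; lra.
- move=> [n _]; rewrite /O choice.pickleK => -[k /=].
  by rewrite mem_filter => /andP[/asboolP bU _] /bU.
Qed.

Implicit Types mu : probability X R.

Lemma pm_bigcup_cvg mu (B : nat -> set X) : (forall n, measurable (B n)) ->
  (forall n k, (n <= k)%N -> B n `<=` B k) ->
  (fun n => pm mu (B n)) @ \oo --> pm mu (\bigcup_n B n).
Proof.
move=> mB nB.
have mU : measurable (\bigcup_n B n) by exact: bigcupT_measurable.
have nB' : {homo B : n m / (n <= m)%N >-> (n <= m)%O}.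
  by move=> n k nk; apply/subsetPset; exact: nB.
have h : (fun n => mu (B n)) @ \oo --> (pm mu (\bigcup_n B n))%:E.
  by rewrite -pmE//; exact: (nondecreasing_cvg_mu mB mU nB').
by have /fine_cvgP[_] := h.
Qed.

Lemma pm_open_eq mu nu : (forall U, dopen d U -> pm mu U = pm nu U) ->
  forall E, measurable E -> pm mu E = pm nu E.
Proof.
move=> h E mE; rewrite /pm; congr fine.
apply: (@measure_unique _ _ _ [set U | dopen d U] (fun=> setT)) => //=.
- by move=> U V; exact: dopenI.
- by move=> _; exact: dopenT.
- by apply/seteqP; split => // x _; exists 0%N.
- by move=> U oU; rewrite !pmE ?h//; exact: (dopen_measurable hborel).
- by move=> _; rewrite probability_setT ltry.
Qed.

Lemma conditional_probability mu A : measurable A -> 0 < pm mu A ->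
  exists nu : probability X R, forall E, measurable E ->
    pm nu E = pm mu (E `&` A) / pm mu A.
Proof.
move=> mA A0; exists (mnormalize (mrestr mu mA) mu : probability X R) => E mE.
rewrite {1}/pm /= /mnormalize /= /mrestr setTI (pmE mu mA) ifF; last by rewrite orbF eqe gt_eqF.
by rewrite pmE//; exact: measurableI.
Qed.
End CountableBase.

(** * Maximal levels and extremality *)

Section MaximalErgodic.
Context (R : realType) (G : choiceType) (mul : G -> G -> G) (one : G) (inv : G -> G).
Context (hG : is_group mul one inv) (hinf : ~ finite_set [set: G]).
Context (dsp : measure_display) (X : measurableType dsp).
Context (d : X -> X -> R) (hd : is_metric d) (hcpt : dcompact d).
Context (hborel : @measurable dsp X = <<s [set U | dopen d U] >>).
Context (act : G -> X -> X) (hact : is_action mul one act).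
Context (hcont : forall g, dcontinuous d d (act g)).
Context (F : nat -> {fset G}) (hF : Folner R mul F).
Implicit Types (mu nu : probability X R) (P : probability X R -> Prop).

Let hma := hmact hborel hcont.

Lemma fine_partition (eps : R) : 0 < eps ->
  exists n (f : X -> 'I_n), fmeas f /\ diam_lt d f eps.
Proof.
move=> e0; have e3 : 0 < eps / 3 by lra.
have [s hs] := finite_net hd hcpt e3.
have [|x|f [mf hf]] := @first_cover _ X 'I_(size s) (fun i => dball d (nth point s i) (eps / 3)).
- by move=> i; apply: (dopen_measurable hborel); exact: dopen_ball.
- have [c cs xc] := hs x; have ls : (index c s < size s)%N by rewrite index_mem.
  by exists (Ordinal ls); rewrite /dball /= nth_index.
exists (size s), f; split => //; exists (2 * (eps / 3)); split; first lra.
move=> x y xy; have := hf x; have := hf y; rewrite -xy /dball /=.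
have := dtri hd (nth point s (f x)) x y; rewrite (dC hd x (nth point s (f x))); lra.
Qed.

Lemma good_bounded (eps : R) : 0 < eps -> exists b, forall c mu, good d act eps c (pm mu) -> c <= b.
Proof.
move=> /fine_partition[n [f [mf df]]]; exists (ecap R 'I_n) => c mu gm.
have := gm _ f mf df [fset one]%fset; rewrite cardfs1 mulr1 => /le_trans; apply.
by have := Hset_card hma [fset one]%fset (fap_pm mu) mf; rewrite cardfs1 mul1r.
Qed.

Lemma ent_restrict (m : set X -> R) (A B : finType) (f : X -> A) (g : X -> B)
    (phi : A -> B) E : fap m -> measurable E -> m E = 1 -> fmeas f -> fmeas g ->
  (forall x, E x -> g x = phi (f x)) -> ent m g <= ent m f.
Proof.
move=> hm mE E1 mf mg gE; apply: le_trans (ent_comp phi hm mf).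
have nE : m (~` E) = 0 by rewrite fapC// E1 subrr.
have key (K : set X) : measurable K -> m K = m (K `&` E).
  move=> mK; rewrite [LHS](fap_split hm mK mE).
  suff -> : m (K `\` E) = 0 by rewrite addr0.
  apply/le_anti/andP; split; last by apply: fap_ge0 => //; exact: measurableD.
  rewrite -nE; apply: (fap_le hm) => [||x []//]; [exact: measurableD|exact: measurableC].
rewrite le_eqVlt; apply/orP; left; apply/eqP; apply: eq_bigr => b _; congr etaR.
rewrite /law key; last exact: mg.
rewrite [RHS]key; last exact: (fmeas_comp phi mf).
by congr (m _); apply/seteqP; split => x /= [h Ex]; split; rewrite // ?gE// -?gE.
Qed.

(* [c] bounds a weighted mean of the entropies of two *different* partitions on the two
   parts, which is why a maximal [c] is inherited by both parts. *)
Lemma glue_entropy (eps c : R) mu nu1 nu2 E (n1 n2 : finType) (f1 : X -> n1) (f2 : X -> n2) :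
  measurable E -> invariant_set act E ->
  invariant_measure act nu1 -> invariant_measure act nu2 ->
  0 <= pm mu E <= 1 -> pm nu1 E = 1 -> pm nu2 (~` E) = 1 ->
  (forall D, measurable D -> pm mu D = pm mu E * pm nu1 D + (1 - pm mu E) * pm nu2 D) ->
  good d act eps c (pm mu) ->
  fmeas f1 -> fmeas f2 -> diam_lt d f1 eps -> diam_lt d f2 eps ->
  c <= pm mu E * hset act (pm nu1) f1 + (1 - pm mu E) * hset act (pm nu2) f2.
Proof.
move=> mE iE i1 i2 /andP[a0 a1] E1 E2 muE gm mf1 mf2 [e1 [e1e d1]] [e2 [e2e d2]].
set a := pm mu E in a0 a1 muE *.
have a2 : 0 <= 1 - a by lra.
pose f x : (n1 + n2)%type := if x \in E then inl (f1 x) else inr (f2 x).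
have mf : fmeas f.
  move=> [i|i].
    rewrite (_ : _ @^-1` _ = f1 @^-1` [set i] `&` E); first exact: measurableI.
    apply/seteqP; split => x /=; rewrite /f; case: ifPn => xE //.
    - by move=> [<-]; split => //; exact: set_mem.
    - by move=> [<-].
    - by move=> [_ Ex]; rewrite mem_set in xE.
  rewrite (_ : _ @^-1` _ = f2 @^-1` [set i] `\` E); first exact: measurableD.
  apply/seteqP; split => x /=; rewrite /f; case: ifPn => xE //.
  - by move=> [<-]; split => // Ex; rewrite mem_set in xE.
  - by move=> [_]; case; exact: set_mem.
  - by move=> [<-].
have df : diam_lt d f eps.
  exists (Num.max e1 e2); split; first by rewrite gt_max e1e.
  move=> x y; rewrite /f le_max; case: ifPn => _; case: ifPn => _ // [].
    by move=> /d1 ->.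
  by move=> /d2 ->; rewrite orbT.
have actE g x : (act g x \in E) = (x \in E).
  by apply/idP/idP => /set_mem h; apply/mem_set; [rewrite -(iE g)|rewrite -(iE g) in h].
have h1 K : Hset act (pm nu1) f K <= Hset act (pm nu1) f1 K.
  apply: (@ent_restrict _ _ _ _ _ (fun w : {ffun K -> n1} => [ffun g => (inl (w g) : (n1 + n2)%type)]) E) => //.
  - exact: fap_pm.
  - exact: name_meas.
  - exact: name_meas.
  - by move=> x Ex; apply/ffunP => g; rewrite !ffunE /f actE mem_set.
have h2 K : Hset act (pm nu2) f K <= Hset act (pm nu2) f2 K.
  apply: (@ent_restrict _ _ _ _ _ (fun w : {ffun K -> n2} => [ffun g => (inr (w g) : (n1 + n2)%type)]) (~` E)) => //.
  - exact: fap_pm.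
  - exact: measurableC.
  - exact: name_meas.
  - exact: name_meas.
  - by move=> x Ex; apply/ffunP => g; rewrite !ffunE /f actE memNset.
have h3 K : Hset act (pm mu) f K <= a * Hset act (pm nu1) f1 K + (1 - a) * Hset act (pm nu2) f2 K + 2.
  apply: (le_trans (ent_convex2 (fap_pm nu1) (fap_pm nu2) (name_meas hma mf) _ muE)).
    by rewrite a0.
  by rewrite lerD2r; apply: lerD; apply: ler_wpM2l => //; [exact: h1|exact: h2].
apply/ler_addgt0Pr => e e0.
have e20 : 0 < e / 2 by lra.
have k1 := hset_approx hG hF hact hma (fap_pm nu1) (invariant_pm i1) mf1 e20.
have k2 := hset_approx hG hF hact hma (fap_pm nu2) (invariant_pm i2) mf2 e20.
(* The additive constant 2 of [ent_convex2] must be absorbed by |F_n|, which tends to infinity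
   because G is infinite. *)
have [N eN] : exists N : nat, 2 <= e / 2 * N%:R.
  exists (Num.trunc (4 / e)).+1; rewrite -ler_pdivrMl//.
  by apply: ltW; rewrite (_ : (e / 2)^-1 * 2 = 4 / e) ?truncnS_gt//; field; lra.
have k3 := folner_card_large hG hinf hF N.
have [n [[/= H1 H2] H3]] := filter_ex (filterI (filterI k1 k2) k3).
have k0 := folner_card_gt0 hF n.
have := gm _ _ mf df (F n) => /le_trans /(_ (h3 _)) H.
have : 2 <= e / 2 * #|` F n|%:R.
  by apply: (le_trans eN); rewrite ler_pM2l// ler_nat.
have := ler_wpM2l a0 H1; have := ler_wpM2l a2 H2.
rewrite -(ler_pM2r k0) => *; nra.
Qed.

Definition top_level (eps c : R) mu := [/\ invariant_measure act mu, good d act eps c (pm mu) &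
  forall nu c', invariant_measure act nu -> good d act eps c' (pm nu) -> c' <= c].

Context (U : set_system nat) (uU : UltraFilter U) (sU : \oo `<=` U).

Definition limit_closed P := forall (nus : nat -> probability X R) mu,
  regularizes d mu (mlim U (fun n => pm (nus n))) ->
  (\forall n \near \oo, P (nus n)) -> P mu.

Lemma mlim_pm_fap (nus : nat -> probability X R) : fap (mlim U (fun n => pm (nus n))).
Proof. by apply: fap_mlim => // n; exact: fap_pm. Qed.

Lemma limit_exists (nus : nat -> probability X R) :
  exists mu, regularizes d mu (mlim U (fun n => pm (nus n))).
Proof.
have [mu [h1 h2]] := regularization hd hcpt hborel (mlim_pm_fap nus).
by exists mu.
Qed.

Lemma limit_invariant (nus : nat -> probability X R) mu :
  regularizes d mu (mlim U (fun n => pm (nus n))) ->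
  (\forall n \near \oo, invariant_measure act (nus n)) -> invariant_measure act mu.
Proof.
move=> rm im; apply: (regularizes_invariant hG hborel hact hcont (mlim_pm_fap nus) _ rm).
move=> g E mE; apply: (ulim_unique uU).
apply: cvg_trans (mlim_cvg uU (fun n => fap_pm (nus n)) mE).
apply: near_eq_cvg; apply: sU; apply: filterS im => n im.
by rewrite (invariant_pm im).
Qed.

Lemma limit_good eps (cs : nat -> R) c (nus : nat -> probability X R) mu :
  regularizes d mu (mlim U (fun n => pm (nus n))) ->
  (\forall n \near \oo, invariant_measure act (nus n)) ->
  (forall e, 0 < e -> \forall n \near \oo, c - e <= cs n) ->
  (\forall n \near \oo, good d act eps (cs n) (pm (nus n))) -> good d act eps c (pm mu).
Proof.
move=> rm im hc gn; have hm := mlim_pm_fap nus.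
apply: (good_regularization hd hcpt hborel hcont hm rm (limit_invariant rm im)).
move=> A f mf df K.
apply: (mlim_ent_ge uU sU (fun n => fap_pm (nus n)) (name_meas hma mf)) => e e0.
have k1 : 0 < #|` K|%:R + 1 :> R by rewrite ltr_wpDl.
have := hc _ (divr_gt0 e0 k1); move: gn; apply: filterS2 => n gn cn.
apply: le_trans (gn _ _ mf df K); apply: le_trans (ler_wpM2r (ler0n _ _) cn).
rewrite mulrBl lerD2l lerN2 mulrAC ler_pdivrMr// ler_pM2l//; lra.
Qed.

(** Regularisation can only lower the mass of an open set, so upper bounds on such masses survive
    limits. This is why the lexicographic scheme minimises over open sets. *)
Lemma limit_open_le (nus : nat -> probability X R) mu V b :
  regularizes d mu (mlim U (fun n => pm (nus n))) -> dopen d V ->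
  (forall e, 0 < e -> \forall n \near \oo, pm (nus n) V <= b + e) -> pm mu V <= b.
Proof.
move=> [mulam _] oV h; rewrite mulam//.
apply: (le_trans (lam_le_open hborel (mlim_pm_fap nus) oV)).
apply/ler_addgt0Pr => e e0.
have mV := dopen_measurable hborel oV.
have hb n : 0 <= pm (nus n) V <= 1.
  by have hp := fap_pm (nus n); rewrite fap_ge0// fap_le1.
apply: (@le_trans _ _ (ulim U (fun=> b + e))).
  apply: (@ulim_le _ _ uU sU (fun n => pm (nus n) V) (fun=> b + e) 0 1 (b + e) (b + e) hb).
    by rewrite lexx.
  exact: h.
by rewrite (ulim_unique uU (cvg_cst _)).
Qed.

(** The levels are bounded by [good_bounded], and their supremum is attained by an ultralimit of
    measures whose levels tend to it. *)
Lemma top_level_exists eps c0 mu0 : 0 < eps -> invariant_measure act mu0 ->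
  good d act eps c0 (pm mu0) -> exists c mu, c0 <= c /\ top_level eps c mu.
Proof.
move=> eps0 i0 g0.
pose C := [set c | exists mu, invariant_measure act mu /\ good d act eps c (pm mu)].
have [b hb] := good_bounded eps0.
have hC : has_sup C.
  by split; [exists c0, mu0|exists b => c [mu [_ gm]]; exact: hb gm].
have h n : exists cm : R * probability X R, [/\ sup C - n.+1%:R^-1 < cm.1,
    invariant_measure act cm.2 & good d act eps cm.1 (pm cm.2)].
  have n0 : 0 < (n.+1%:R^-1 : R) by rewrite invr_gt0.
  have [c [mu [im gm]] hc] := sup_adherent n0 hC.
  by exists (c, mu).
pose cm n := projT1 (cid (h n)).
have cmP n : [/\ sup C - n.+1%:R^-1 < (cm n).1,
    invariant_measure act (cm n).2 & good d act eps (cm n).1 (pm (cm n).2)].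
  by rewrite /cm; case: cid.
have [mu rm] := limit_exists (fun n => (cm n).2).
exists (sup C), mu; split; first by apply: sup_upper_bound => //; exists mu0.
have im : \forall n \near \oo, invariant_measure act (cm n).2.
  by apply: nearW => n; case: (cmP n).
split.
- exact: limit_invariant rm im.
- apply: (limit_good rm im (cs := fun n => (cm n).1)).
    move=> e e0; have := near_infty_natSinv_lt (PosNum e0); apply: filterS => n hn.
    have [h1 _ _] := cmP n; apply: ltW; apply: le_lt_trans h1.
    by rewrite lerD2l lerN2; exact: ltW hn.
  by apply: nearW => n; case: (cmP n).
- by move=> nu c' inu gnu; apply: sup_upper_bound => //; exists nu.
Qed.

Section Lexicographic.
Context (O : nat -> set X) (oO : forall i, dopen d (O i)).
Context (eps c : R).

(* Minimising the open sets of a base one after the other; a measure surviving all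
   levels is ergodic, since the two parts of an invariant splitting also survive
   and agree with it on the base. *)
Fixpoint level (i : nat) : probability X R -> Prop :=
  if i is j.+1 then fun mu => level j mu /\
    forall nu, level j nu -> pm mu (O j) <= pm nu (O j)
  else top_level eps c.

Lemma level_sub i j mu : (i <= j)%N -> level j mu -> level i mu.
Proof.
elim: j => [|j IH]; first by rewrite leqn0 => /eqP->.
by rewrite leq_eqVlt => /orP[/eqP->//|]; rewrite ltnS => ij [/(IH ij)].
Qed.

Lemma level_closed i : limit_closed (level i).
Proof.
elim: i => [|i IH] nus mu rm hn.
  have im : \forall n \near \oo, invariant_measure act (nus n).
    by apply: filterS hn => n [].
  have [n0 [_ _ ht]] := filter_ex hn.
  split; [exact: limit_invariant rm im| |by []].
  apply: (limit_good rm im (cs := fun=> c)).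
    by move=> e e0; apply: nearW => _; lra.
  by apply: filterS hn => n [].
split; first by apply: (IH nus) => //; apply: filterS hn => n [].
move=> nu lnu; apply: (limit_open_le rm) => // e e0.
by apply: filterS hn => n [_ /(_ _ lnu)]; lra.
Qed.

Lemma level_nonempty mu0 : top_level eps c mu0 -> forall i, exists mu, level i mu.
Proof.
move=> h0; elim => [|i [mu1 l1]]; first by exists mu0.
pose I := [set pm mu (O i) | mu in [set mu | level i mu]].
have mO := dopen_measurable hborel (@oO i).
have hI : has_inf I.
  split; first by exists (pm mu1 (O i)), mu1.
  by exists 0 => _ [mu _ <-]; apply: fap_ge0 => //; exact: fap_pm.
have h n : exists mu, level i mu /\ pm mu (O i) < inf I + n.+1%:R^-1.
  have n0 : 0 < (n.+1%:R^-1 : R) by rewrite invr_gt0.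
  by have [_ [mu lm <-] hm] := inf_adherent n0 hI; exists mu.
pose nus n := projT1 (cid (h n)).
have nuP n : level i (nus n) /\ pm (nus n) (O i) < inf I + n.+1%:R^-1.
  by rewrite /nus; case: cid.
have [mu rm] := limit_exists nus.
exists mu; split; first by apply: (level_closed rm); apply: nearW => n; case: (nuP n).
move=> nu lnu; apply: (limit_open_le rm) => // e e0.
have := near_infty_natSinv_lt (PosNum e0); apply: filterS => n hn.
have h1 : inf I <= pm nu (O i) by apply: ge_inf; [exact: hI.2|exists nu].
have [_ h2] := nuP n; apply: (le_trans (ltW h2)); apply: lerD => //.
exact: ltW hn.
Qed.

(** A diagonal sequence: from index i on, all its members lie in level i, which is closed. *)
Lemma level_all mu0 : top_level eps c mu0 -> exists mu, forall i, level i mu.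
Proof.
move=> /level_nonempty h; pose nus i := projT1 (cid (h i)).
have nuP i : level i (nus i) by rewrite /nus; case: cid.
have [mu rm] := limit_exists nus; exists mu => i.
apply: (level_closed rm); exists i => // j /= ij; exact: level_sub (nuP j).
Qed.

Lemma conditional_invariant mu nu E : measurable E -> invariant_set act E ->
  (forall D, measurable D -> pm nu D = pm mu (D `&` E) / pm mu E) ->
  invariant_measure act mu -> invariant_measure act nu.
Proof.
move=> mE iE hnu im g D mD; rewrite !pmE//; last exact: hma.
congr (_%:E); rewrite !hnu//; last exact: hma.
congr (_ / _); rewrite -{1}(iE g) -preimage_setI.
by rewrite (invariant_pm im)//; exact: measurableI.
Qed.

(** Maximality of c provides on nu2 a partition of rate below c + eta. Gluing it to an arbitrary
    partition f on nu1 gives c <= a h(f) + (1 - a)(c + eta) with a the mass of E; letting eta tend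
    to 0 yields h(f) >= c. *)
Lemma top_level_split mu nu1 nu2 E : measurable E -> invariant_set act E ->
  0 < pm mu E < 1 -> pm nu1 E = 1 -> pm nu2 (~` E) = 1 ->
  invariant_measure act nu1 -> invariant_measure act nu2 ->
  (forall D, measurable D -> pm mu D = pm mu E * pm nu1 D + (1 - pm mu E) * pm nu2 D) ->
  top_level eps c mu -> top_level eps c nu1.
Proof.
move=> mE iE /andP[a0 a1] E1 E2 i1 i2 muE [im gm top]; split => // n f mf df K.
have [->|K0] := eqVneq (K : {fset G}) fset0.
  by rewrite cardfs0 mulr0 (Hset_ge0 hma)//; exact: fap_pm.
apply: le_trans (hset_le hma K (fap_pm nu1) mf); rewrite ler_wpM2r//.
suff key eta : 0 < eta -> pm mu E * c <= pm mu E * hset act (pm nu1) f + eta.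
  rewrite -(ler_pM2l a0); apply/ler_addgt0Pr; exact: key.
move=> eta0.
have [f2 [mf2 [df2 h2]]] : exists f2 : {n : finType & X -> n}, fmeas (projT2 f2) /\
    diam_lt d (projT2 f2) eps /\ hset act (pm nu2) (projT2 f2) < c + eta.
  apply: contrapT => H.
  suff : c + eta <= c by lra.
  apply: (top nu2) => // n2 f2 mf2 df2 L.
  have [->|L0] := eqVneq (L : {fset G}) fset0.
    by rewrite cardfs0 mulr0 (Hset_ge0 hma)//; exact: fap_pm.
  apply: le_trans (hset_le hma L (fap_pm nu2) mf2); rewrite ler_wpM2r//.
  rewrite leNgt; apply/negP => lt; apply: H.
  by exists (existT _ n2 f2).
have a01 : 0 <= pm mu E <= 1 by rewrite !ltW.
have := glue_entropy mE iE i1 i2 a01 E1 E2 muE gm mf mf2 df df2.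
have : (1 - pm mu E) * hset act (pm nu2) (projT2 f2) <= (1 - pm mu E) * (c + eta).
  by rewrite ler_wpM2l ?subr_ge0 ?ltW.
have : 0 < pm mu E * eta by rewrite mulr_gt0.
by nra.
Qed.

Context (baseO : forall V, dopen d V -> exists j : nat -> nat,
  (forall n k, (n <= k)%N -> O (j n) `<=` O (j k)) /\ V = \bigcup_n O (j n)).

Lemma pm_base_eq mu nu : (forall i, pm mu (O i) = pm nu (O i)) ->
  forall E, measurable E -> pm mu E = pm nu E.
Proof.
move=> h; apply: (pm_open_eq hborel) => V /baseO[j [jm ->]].
have mO n : measurable (O (j n)) by exact: (dopen_measurable hborel).
have h1 := @pm_bigcup_cvg _ _ _ mu _ mO jm; have h2 := @pm_bigcup_cvg _ _ _ nu _ mO jm.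
have E : (fun n => pm nu (O (j n))) = (fun n => pm mu (O (j n))) by apply/funext => n; rewrite h.
by rewrite E in h2; rewrite -(cvg_lim _ h1)// -(cvg_lim _ h2).
Qed.

Lemma level_all_ergodic mu : (forall i, level i mu) -> ergodic act mu.
Proof.
move=> lmu; have [im gm top] := lmu 0%N; split => // E mE iE.
have hp := fap_pm mu.
have E01 : 0 <= pm mu E by exact: fap_ge0.
have E11 : pm mu E <= 1 by exact: fap_le1.
rewrite pmE//.
have [->|n0] := eqVneq (pm mu E) 0; first by left.
have [->|n1] := eqVneq (pm mu E) 1; first by right.
exfalso.
have a0 : 0 < pm mu E by rewrite lt_def n0.
have a1 : pm mu E < 1 by rewrite lt_def eq_sym n1.
have mnE : measurable (~` E) by exact: measurableC.
have inE : invariant_set act (~` E) by move=> g; rewrite -preimage_setC iE.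
have nEa : pm mu (~` E) = 1 - pm mu E by rewrite fapC.
have b0 : 0 < pm mu (~` E) by rewrite nEa; lra.
have b1 : pm mu (~` E) < 1 by rewrite nEa; lra.
have [nu1 h1] := conditional_probability mE a0.
have [nu2 h2] := conditional_probability mnE b0.
have i1 := conditional_invariant mE iE h1 im.
have i2 := conditional_invariant mnE inE h2 im.
have E1 : pm nu1 E = 1 by rewrite h1// setIid divff// gt_eqF.
have E2 : pm nu2 (~` E) = 1 by rewrite h2// setIid divff// gt_eqF.
have dec D : measurable D -> pm mu D = pm mu E * pm nu1 D + (1 - pm mu E) * pm nu2 D.
  move=> mD; rewrite h1// h2// -nEa mulrC divfK ?gt_eqF// mulrC divfK ?gt_eqF//.
  exact: fap_split.
have dec' D : measurable D -> pm mu D = pm mu (~` E) * pm nu2 D + (1 - pm mu (~` E)) * pm nu1 D.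
  by move=> mD; rewrite dec// nEa; ring.
have lev i : level i nu1 /\ level i nu2.
  elim: i => [|i [l1 l2]].
    split; [apply: (top_level_split mE iE _ E1 E2 i1 i2 dec (lmu 0%N))|].
      by rewrite a0.
    apply: (top_level_split mnE inE _ E2 _ i2 i1 dec' (lmu 0%N)); first by rewrite b0.
    by rewrite setCK.
  have [_ hmin] := lmu i.+1.
  have m1 := hmin _ l1; have m2 := hmin _ l2.
  have := dec _ (dopen_measurable hborel (@oO i)) => hd'.
  (* Both parts give O i at least the mass that mu gives it, and mu is their mean with positive
     weights, so equality holds. *)
  have e1 : pm nu1 (O i) = pm mu (O i) by nra.
  have e2 : pm nu2 (O i) = pm mu (O i) by nra.
  by split; split => // nu lnu; [rewrite e1|rewrite e2]; exact: hmin.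
have : pm nu1 E = pm mu E.
  apply: pm_base_eq => // i.
  have [_ hmin] := lmu i.+1.
  have [l1 l2] := lev i.
  have m1 := hmin _ l1; have m2 := hmin _ l2.
  have := dec _ (dopen_measurable hborel (@oO i)) => hd'.
  by nra.
by rewrite E1 => e1; rewrite -e1 ltxx in a1.
Qed.
End Lexicographic.
End MaximalErgodic.

Section ErgodicExistence.
Context (R : realType) (G : choiceType) (mul : G -> G -> G) (one : G) (inv : G -> G).
Context (hG : is_group mul one inv) (hinf : ~ finite_set [set: G]).
Context (dsp : measure_display) (X : measurableType dsp).
Context (d : X -> X -> R) (hd : is_metric d) (hcpt : dcompact d).
Context (hborel : @measurable dsp X = <<s [set U | dopen d U] >>).
Context (act : G -> X -> X) (hact : is_action mul one act).
Context (hcont : forall g, dcontinuous d d (act g)).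
Context (F : nat -> {fset G}) (hF : Folner R mul F).

Lemma good_ergodic_exists (eps c : R) : 0 < eps -> (c%:E < htop_eps d act F eps)%E ->
  exists nu : probability X R, ergodic act nu /\ good d act eps c (pm nu).
Proof.
move=> eps0 hc.
have [mu0 [i0 _ g0]] := good_measure_exists hG hd hcpt hborel hact hcont hF (ltW eps0) hc.
have [U [uU sU]] := free_ultrafilter.
have [c' [mu1 [cc' top1]]] := top_level_exists hG hd hcpt hborel hact hcont uU sU eps0 i0 g0.
have [B [oB baseB]] := countable_base hd hcpt.
have [mu lmu] := level_all hG hd hcpt hborel hact hcont uU sU oB top1.
have [_ gm _] := lmu 0%N.
exists mu; split.
  exact: (level_all_ergodic hG hinf hborel hact hcont hF oB baseB lmu).
move=> A f mf df K; apply: le_trans (gm _ f mf df K).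
by rewrite ler_wpM2r.
Qed.
End ErgodicExistence.

Lemma card_sets (T : finType) : #|{set T}| = (2 ^ #|T|)%N.
Proof.
have <- : #|powerset [set: T]%SET| = #|{set T}|.
  by rewrite -[RHS]cardsT; apply: eq_card => A; rewrite powersetE finset.subsetT finset.in_setT.
by rewrite card_powerset cardsT.
Qed.

(** * Infinite stabilisers *)

Section Codes.
Context (R : realType) (dsp : measure_display) (X : measurableType dsp).

Lemma ln_nat_le (a b : nat) : (a <= b)%N -> ln (a%:R : R) <= ln (b%:R : R).
Proof.
move=> ab; have [->|a0] := posnP a.
  rewrite ln0//; have [->|b0] := posnP b; first by rewrite ln0.
  by rewrite ln_ge0// ler1n.
by rewrite ler_ln ?posrE ?ltr0n ?ler_nat// (leq_trans a0).
Qed.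

(** Codes are only counted, so [code] may be an arbitrary function; outside Gd the trivial bound ln
    |A| is paid. *)
Lemma ent_code (m : set X -> R) (A C : finType) (f : X -> A) (code : X -> C)
    (Gd : set X) (B : {set C}) :
  fap m -> fmeas f -> measurable Gd -> (forall x, Gd x -> code x \in B) ->
  (forall x y, Gd x -> Gd y -> code x = code y -> f x = f y) ->
  ent m f <= ln 2 + ln #|B|%:R + m (~` Gd) * ln #|A|%:R.
Proof.
move=> hm mf mG cB cf.
pose N := [set a : A | `[< exists x, Gd x /\ f x = a >]]%SET.
apply: (le_trans (ent_support N hm mf)); apply: lerD.
  rewrite lerD2l; apply: ln_nat_le.
  pose g a : C := if pselect (exists x, Gd x /\ f x = a) is left h
                  then code (projT1 (cid h)) else code point.
  have gP a : a \in N -> exists x, [/\ Gd x, f x = a & g a = code x].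
    rewrite inE => /asboolP h; rewrite /g; case: pselect => // h'.
    by case: cid => x /= [Gx fx]; exists x.
  rewrite -(card_in_imset (f := g) (D := N)); last first.
    move=> a b /gP[x [Gx <- ->]] /gP[y [Gy <- ->]]; exact: cf.
  apply: subset_leq_card; apply/fintype.subsetP => c /imsetP[a /gP[x [Gx _ ->]] ->].
  exact: cB.
have A1 : 0 <= ln (#|A|%:R : R).
  by rewrite ln_ge0// ler1n; apply/card_gt0P; exists (f point).
apply: ler_wpM2r => //; apply: fap_le => //.
- exact: (fmeas_pred (fun a => a \notin N)).
- exact: measurableC.
- move=> x /= fx Gx; move/negP: fx; apply; rewrite inE; apply/asboolP.
  by exists x.
Qed.
End Codes.

Section Representatives.
Context (G : choiceType) (mul : G -> G -> G) (one : G) (inv : G -> G).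
Context (hG : is_group mul one inv).

(* [reps] is a maximal set of [t] with pairwise disjoint translates [t A]. *)
Lemma coset_representatives (T A : {fset G}) : A != fset0 -> exists reps : {fset G},
  [/\ (reps `<=` T)%fset, (#|` reps| * #|` A| <= #|` mulset mul T A|)%N &
  forall t, t \in T -> exists r a b, [/\ r \in reps, a \in A, b \in A & mul t a = mul r b]].
Proof.
move=> A0.
pose P (S : {set T}) := [forall r in S, forall s in S,
  (r == s) || [disjoint (ltrans mul (val r) A) & (ltrans mul (val s) A)]%fset].
have P0 : P finset.set0 by apply/forall_inP => r; rewrite inE.
have [S /maxsetP[PS maxS] _] := maxset_exists P0.
have sep (r s : T) a b : r \in S -> s \in S -> a \in A -> b \in A ->
    mul (val r) a = mul (val s) b -> r = s.
  move=> rS sS aA bA e; move/forall_inP: PS => /(_ r rS)/forall_inP/(_ s sS).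
  move=> /orP[/eqP//|/fdisjointP/(_ (mul (val r) a))].
  by rewrite (mem_ltrans hG) (mulK hG) e (mem_ltrans hG) (mulK hG) bA => /(_ aA).
exists [fset val t | t in S]%fset; split.
- by apply/fsubsetP => x /imfsetP[t _ ->]; exact: valP.
- have hm (p : T * A) : mul (val p.1) (val p.2) \in mulset mul T A.
    by apply: mem_mulset; exact: valP.
  pose g (p : T * A) : mulset mul T A := FSetSub (hm p).
  have -> : #|` [fset val t | t in S]%fset| = #|S|.
    by rewrite card_imfset ?cardE//; exact: val_inj.
  rewrite !cardfE -(cardsT A) -cardsX -(card_in_imset (f := g)); last first.
    move=> [r a] [s b]; rewrite !inE !andbT /= => rS sS /(congr1 val) /= e.
    have E := sep _ _ _ _ rS sS (valP a) (valP b) e.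
    by rewrite E in e *; congr (_, _); apply: val_inj; exact: (gmulI hG e).
  exact: max_card.
- move=> t tT; have [tS|tS] := boolP (FSetSub tT \in S).
    have /fset0Pn[a aA] := A0.
    by exists t, a, a; split => //; apply/imfsetP; exists (FSetSub tT).
  have nP : ~~ P (FSetSub tT |: S)%SET.
    apply/negP => PtS; have := maxS _ PtS (finset.subsetUr _ _) => E.
    by rewrite -E setU11 in tS.
  apply: contrapT => H; move/negP: nP; apply.
  have dis (s : T) : s \in S -> [disjoint (ltrans mul t A) & (ltrans mul (val s) A)]%fset.
    move=> sS; apply/fdisjointP => x; rewrite !(mem_ltrans hG) => xt; apply/negP => xs.
    apply: H; exists (val s), (mul (inv t) x), (mul (inv (val s)) x); split => //.
      by apply/imfsetP; exists s.
    by rewrite !(mulVK hG).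
  apply/forall_inP => r; rewrite !inE => /orP[/eqP->|rS]; apply/forall_inP => s;
    rewrite !inE => /orP[/eqP->|sS].
  + by rewrite eqxx.
  + by rewrite dis ?orbT.
  + by rewrite fdisjoint_sym dis ?orbT.
  + by move/forall_inP: PS => /(_ r rS)/forall_inP/(_ s sS).
Qed.
End Representatives.

Section Stabilizers.
Context (R : realType) (G : countType) (mul : G -> G -> G) (one : G) (inv : G -> G).
Context (hG : is_group mul one inv) (hinf : ~ finite_set [set: G]).
Context (dsp : measure_display) (X : measurableType dsp).
Context (d : X -> X -> R) (hd : is_metric d) (hcpt : dcompact d).
Context (hborel : @measurable dsp X = <<s [set U | dopen d U] >>).
Context (act : G -> X -> X) (hact : is_action mul one act).
Context (hcont : forall g, dcontinuous d d (act g)).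
Context (F : nat -> {fset G}) (hF : Folner R mul F).
Implicit Types (nu : probability X R).

Let hma := hmact hborel hcont.

Lemma displacement_open g (r : R) : dopen d [set x | d (act g x) x < r].
Proof.
move=> x /= xr; pose s := (r - d (act g x) x) / 2.
have s0 : 0 < s by rewrite /s; lra.
have [t [t0 ht]] := hcont g x s0.
exists (Num.min s t); split; first by rewrite lt_min s0.
move=> y; rewrite /dball /= lt_min => /andP[ys /ht yt].
have := dtri hd (act g x) (act g y) y; have := dtri hd x (act g x) y.
by rewrite (dC hd (act g y) (act g x)); move: ys yt; rewrite /s; lra.
Qed.

Lemma fixed_measurable g : measurable [set x | act g x = x].
Proof.
rewrite (_ : [set x | _] = \bigcap_n [set x | d (act g x) x < n.+1%:R^-1]).
  by apply: bigcap_measurable => // n _; apply: (dopen_measurable hborel); exact: displacement_open.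
apply/seteqP; split => x /=.
  by move=> xx n _ /=; rewrite xx (dxx hd) invr_gt0.
move=> h; apply: contrapT => /(d_neq hd) d0.
have [n _ /(_ n (leqnn _)) hn] := near_infty_natSinv_lt (PosNum d0).
have h' : n.+1%:R^-1 < d (act g x) x := hn.
by have := lt_trans h' (h n I); rewrite ltxx.
Qed.

Definition stab (E : {fset G}) (x : X) : {set E} := [set g : E | act (val g) x == x]%SET.

Lemma stab_meas E : fmeas (stab E).
Proof.
move=> S; rewrite (_ : _ @^-1` _ = \bigcap_(g in [set: E])
    (if g \in S then [set x | act (val g) x = x] else ~` [set x | act (val g) x = x])).
  apply: fin_bigcap_measurable => // g _; case: ifP => _; last apply: measurableC;
    exact: fixed_measurable.
apply/seteqP; split => x /=.
  by move=> <- g _; rewrite inE; case: eqP.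
move=> h; apply/finset.setP => g; have := h g I; rewrite inE.
by case: (g \in S) => /= [/eqP|/eqP/negbTE].
Qed.

(* Along the translates [t A], A = [stab E x], the itinerary of [x] is constant, so a
   set of representatives 1/|A| times as large determines it. *)
Lemma hset_infinite_stab nu (A : finType) (f : X -> A) :
  invariant_measure act nu -> fmeas f ->
  (forall (N : nat) (e : R), 0 < e ->
     exists E : {fset G}, 1 - e <= pm nu [set x | (N <= #|stab E x|)%N]) ->
  hset act (pm nu) f <= 0.
Proof.
move=> im mf hN; have hp := fap_pm nu.
rewrite -[leRHS]addr0; apply/ler_addgt0Pr => eta eta0; rewrite add0r.
pose c : R := ln (#|A|.+1%:R).
have c0 : 0 <= c by rewrite ln_ge0// ler1n.
have cA : ln (#|A|%:R) <= c by exact: ln_nat_le.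
have cA0 : 0 <= ln (#|A|%:R : R).
  by rewrite ln_ge0// ler1n; apply/card_gt0P; exists (f point).
(* One third of eta is spent on the letters at the representatives, one on the points outside Gd,
   and one on the constant D. *)
pose N := (Num.trunc (6 * c / eta)).+1.
have N0 : 0 < (N%:R : R) by rewrite ltr0n.
have NP : 2 * c / N%:R <= eta / 3.
  have : 6 * c / eta < N%:R by rewrite truncnS_gt.
  rewrite ltr_pdivrMr// ler_pdivrMr//; lra.
have e0 : 0 < eta / (3 * (c + 1)) by rewrite divr_gt0//; lra.
have eP : eta / (3 * (c + 1)) * c <= eta / 3.
  rewrite mulrAC ler_pdivrMr; last by lra.
  by have := mulr_ge0 (ltW eta0) c0; lra.
have [E hE] := hN N _ e0.
set e := eta / (3 * (c + 1)) in e0 eP hE.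
set Gd := [set x | _] in hE.
have mG : measurable Gd by exact: (fmeas_pred (fun S : {set E} => (N <= #|S|)%N) (@stab_meas E)).
pose D : R := ln 2 + #|` E|%:R * ln 2.
have [M hM] : exists M : nat, D <= eta / 3 * M%:R.
  exists (Num.trunc (3 * D / eta)).+1; rewrite -ler_pdivrMl; last lra.
  apply: ltW; rewrite (_ : (eta / 3)^-1 * D = 3 * D / eta) ?truncnS_gt//; field; lra.
have [n [/= h1 h2]] := filter_ex (filterI
  (folner_mulset_card hF (invset inv E) (ltr01 : 0 < (1:R))) (folner_card_large hG hinf hF M)).
(* Inverses turn left into right almost invariance: |T E| = |E^-1 F_n| <= 2 |F_n|, which bounds the
   number of disjoint translates t A. *)
pose T := invset inv (F n).
have cT : #|` T| = #|` F n| by exact: (card_invset hG).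
have T0 : 0 < (#|` T|%:R : R) by rewrite cT; exact: folner_card_gt0 hF n.
have TE : (#|` mulset mul T E| <= 2 * #|` T|)%N.
  have : #|` mulset mul T E| = #|` mulset mul (invset inv E) (F n)|.
    rewrite -(card_invset hG (mulset mul T E)); congr (#|` _|).
    apply/fsetP => x; rewrite (mem_invset hG); apply/mulsetP/mulsetP.
      move=> [a [b [aT bE xE]]]; exists (inv b), (inv a).
      by rewrite (mem_invset hG) (ginvK hG) bE -(mem_invset hG) aT -(invM hG) -xE (ginvK hG).
    move=> [a [b [aE bF ->]]]; exists (inv b), (inv a).
    by rewrite (mem_invset hG) (ginvK hG) bF -(mem_invset hG) aE (invM hG).
  by move=> ->; rewrite -(ler_nat R) cT natrM; lra.
pose AS (S : {set E}) : {fset G} := [fset val g | g in S]%fset.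
have cAS (S : {set E}) : #|` AS S| = #|S| by rewrite card_imfset ?cardE//; exact: val_inj.
have hR (S : {set E}) : exists reps : {fset G}, (N <= #|S|)%N -> [/\ (reps `<=` T)%fset,
    (#|` reps| * #|` AS S| <= #|` mulset mul T (AS S)|)%N &
    forall t, t \in T -> exists r a b, [/\ r \in reps, a \in AS S, b \in AS S & mul t a = mul r b]].
  have [NS|NS] := leqP N #|S|; last by exists fset0.
  have S0 : AS S != fset0 by rewrite -cardfs_gt0 cAS (leq_trans _ NS).
  by have [reps h] := coset_representatives hG T S0; exists reps.
pose reps (S : {set E}) := projT1 (cid (hR S)).
have repsP (S : {set E}) : (N <= #|S|)%N -> [/\ (reps S `<=` T)%fset,
    (#|` reps S| * #|` AS S| <= #|` mulset mul T (AS S)|)%N &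
    forall t, t \in T -> exists r a b, [/\ r \in reps S, a \in AS S, b \in AS S & mul t a = mul r b]].
  by rewrite /reps; case: cid.
pose q := (2 * #|` T| %/ N)%N.
have repsq (S : {set E}) : (N <= #|S|)%N -> (#|` reps S| <= q)%N.
  move=> NS; have [_ h _] := repsP S NS.
  rewrite /q leq_divRL//; apply: leq_trans TE.
  apply: leq_trans (leq_trans h _); first by rewrite cAS leq_mul2l NS orbT.
  apply: fsubset_leq_card; apply/fsubsetP => x /mulsetP[a [b [aT /imfsetP[g _ ->] ->]]].
  by apply: mem_mulset => //; exact: valP.
pose code x := (stab E x, [ffun t : T => if val t \in reps (stab E x)
   then Some (f (act (val t) x)) else None]).
pose BS (S : {set E}) : {set {set E} * {ffun T -> option A}} :=
  [set p | (p.1 == S) && (p.2 \in pffun_on None [pred t : T | val t \in reps S] predT)]%SET.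
pose B := \bigcup_(S : {set E} | (N <= #|S|)%N) BS S.
have cB : (#|B| <= 2 ^ #|` E| * #|A|.+1 ^ q)%N.
  apply: (@leq_trans (\sum_(S : {set E} | (N <= #|S|)%N) #|BS S|)).
    rewrite /B; elim/big_rec2 : _ => [|S a b _ h]; first by rewrite cards0.
    by apply: leq_trans (leq_card_setU _ _).1 _; rewrite leq_add2l.
  apply: (@leq_trans (\sum_(S : {set E}) #|A|.+1 ^ q)); last first.
    by rewrite sum_nat_const card_sets cardfE.
  rewrite big_mkcond /=; apply: leq_sum => S _; case: ifP => // NS.
  apply: (@leq_trans #|pffun_on (None : option A) [pred t : T | val t \in reps S] predT|).
    rewrite -(card_in_imset (f := snd) (D := BS S)); last first.
      by move=> [a b] [a' b']; rewrite !inE /= => /andP[/eqP-> _] /andP[/eqP-> _] ->.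
    by apply: subset_leq_card; apply/fintype.subsetP => w /imsetP[p]; rewrite inE => /andP[_ h] ->.
  rewrite card_pffun_on cardT -cardE card_option leq_pexp2l//.
  have [sub _ _] := repsP S NS.
  apply: leq_trans (repsq S NS).
  rewrite cardE -(size_map val); apply: uniq_leq_size.
    by rewrite map_inj_uniq ?enum_uniq//; exact: val_inj.
  by move=> x /mapP[t]; rewrite mem_enum inE => h ->.
have mn : fmeas (name act f T) by exact: name_meas.
have key : Hset act (pm nu) f T <= ln 2 + ln #|B|%:R + pm nu (~` Gd) * ln #|{ffun T -> A}|%:R.
  apply: (ent_code (code := code)) => //.
    move=> x Gx; apply/bigcupP; exists (stab E x) => //; rewrite inE eqxx /=.
    apply/pffun_onP; split => //; apply/fintype.subsetP => t; rewrite !inE /= ffunE.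
    by case: ifP.
  move=> x y Gx Gy [/= sxy]; rewrite -sxy => /ffunP cxy.
  apply/name_eqP => t tT; have [sub _ h] := repsP _ Gx.
  have [r [a [b [rR aA bA tr]]]] := h t tT.
  have fixA z g : stab E z = stab E x -> g \in AS (stab E x) -> act g z = z.
    by move=> <- /imfsetP[k /=]; rewrite inE => /eqP h' ->.
  (* t z = t a z = r b z = r z, because a and b fix z. *)
  have tz z : stab E z = stab E x -> act t z = act r z.
    move=> sz; rewrite -{1}(fixA z a sz aA) -(actM hact) tr (actM hact).
    by rewrite (fixA z b sz bA).
  rewrite !tz//.
  have rT : r \in T by exact: (fsubsetP sub).
  by have := cxy (FSetSub rT); rewrite !ffunE /= rR => -[].
have lB : ln (#|B|%:R : R) <= #|` E|%:R * ln 2 + q%:R * c.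
  apply: (le_trans (@ln_nat_le R _ _ cB)).
  by rewrite natrM !natrX lnM ?posrE ?exprn_gt0// !lnXn// !mulr_natl.
have lT : ln (#|{ffun T -> A}|%:R : R) = #|` T|%:R * ln #|A|%:R.
  by rewrite card_ffun -cardfE natrX lnXn ?mulr_natl// ltr0n; apply/card_gt0P; exists (f point).
have nG : pm nu (~` Gd) <= e by rewrite fapC//; lra.
have qT : q%:R * c <= eta / 3 * #|` T|%:R.
  apply: (@le_trans _ _ (2 * c / N%:R * #|` T|%:R)); last by rewrite ler_wpM2r.
  have : q%:R <= 2 * #|` T|%:R / N%:R :> R.
    by rewrite ler_pdivlMr// -natrM -natrM ler_nat leq_divM.
  by move=> /(ler_wpM2r c0); rewrite (_ : 2 * #|` T|%:R / N%:R * c = 2 * c / N%:R * #|` T|%:R)//; ring.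
have DT : D <= eta / 3 * #|` T|%:R.
  by apply: (le_trans hM); rewrite ler_pM2l ?divr_gt0// ler_nat cT.
have eT : pm nu (~` Gd) * ln (#|{ffun T -> A}|%:R) <= eta / 3 * #|` T|%:R.
  rewrite lT; apply: (@le_trans _ _ (e * (#|` T|%:R * c))).
    apply: ler_pM => //; [by apply: fap_ge0 => //; exact: measurableC|exact: mulr_ge0|].
    by rewrite ler_wpM2l.
  by rewrite mulrCA mulrC ler_wpM2r.
have h := hset_le hma T hp mf.
rewrite -(ler_pM2r T0); move: key lB DT qT eT h; rewrite /D; lra.
Qed.
End Stabilizers.

(** * Quasi-tilings *)

Section DoubleCounting.
Context (R : realType) (dsp : measure_display) (X : measurableType dsp).
Context (m : set X -> R) (hm : fap m) (I : finType) (B : I -> set X).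
Context (mB : forall i, measurable (B i)).

Definition incidence (x : X) : {set I} := [set i | x \in B i]%SET.

Lemma incidence_meas : fmeas incidence.
Proof.
move=> S; rewrite (_ : _ @^-1` _ = \bigcap_(i in [set: I])
    (if i \in S then B i else ~` B i)).
  by apply: fin_bigcap_measurable => // i _; case: ifP => _ //; exact: measurableC.
apply/seteqP; split => x /=.
  move=> <- i _; rewrite inE; case: ifPn => [/set_mem//|h Bx].
  by move: h; rewrite mem_set.
move=> h; apply/finset.setP => i; have := h i Logic.I; rewrite inE.
by case: (i \in S) => [/mem_set //|Bi]; rewrite memNset.
Qed.

(** The right-hand side is the integral of the counting function x |-> |incidence x|, written as a
    finite sum over the values of [incidence]. *)
Let sum_incidence : \sum_i m (B i) = \sum_(S : {set I}) #|S|%:R * law m incidence S.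
Proof.
have E i : m (B i) = \sum_(S : {set I}) (if i \in S then law m incidence S else 0).
  rewrite -big_mkcond -(law_pred (fun S : {set I} => i \in S) hm incidence_meas).
  congr (m _); apply/seteqP; split => x /=; rewrite inE; first by move/mem_set.
  by move/set_mem.
under eq_bigr do rewrite E.
rewrite exchange_big /=; apply: eq_bigr => S _.
by rewrite -big_mkcond sumr_const mulr_natl.
Qed.

Lemma double_counting_ge E (k : R) : measurable E -> 0 <= k ->
  (forall x, E x -> k <= #|incidence x|%:R) -> k * m E <= \sum_i m (B i).
Proof.
move=> mE k0 h; rewrite sum_incidence.
apply: (@le_trans _ _ (k * m [set x | k <= #|incidence x|%:R])).
  rewrite ler_wpM2l//; apply: fap_le => //.
  exact: (fmeas_pred (fun S : {set I} => k <= #|S|%:R) incidence_meas).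
rewrite (law_pred (fun S : {set I} => k <= #|S|%:R) hm incidence_meas).
rewrite mulr_sumr big_mkcond; apply: ler_sum => S _.
have l0 := law_ge0 S hm incidence_meas.
by case: ifP => [kS|_]; [rewrite ler_wpM2r|rewrite mulr_ge0].
Qed.

Lemma double_counting_le E (k : R) : measurable E -> 0 <= k ->
  (forall i, B i `<=` E) ->
  (forall x, E x -> #|incidence x|%:R <= k) -> \sum_i m (B i) <= k * m E.
Proof.
move=> mE k0 BE h; rewrite sum_incidence.
apply: (@le_trans _ _ (k * m [set x | incidence x != finset.set0])).
  rewrite (law_pred (fun S : {set I} => S != finset.set0) hm incidence_meas).
  rewrite mulr_sumr [leRHS]big_mkcond; apply: ler_sum => S _.
  case: ifPn => [S0|]; last by rewrite negbK => /eqP->; rewrite cards0 mul0r.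
  have [[x xS]|nx] := pselect (exists x, incidence x = S).
    rewrite ler_wpM2r ?(law_ge0 _ hm incidence_meas)// -xS; apply: h.
    have /finset.set0Pn[i] := S0; rewrite -xS inE => /set_mem; exact: BE.
  rewrite /law (_ : _ @^-1` _ = set0) ?fap0 ?mulr0//.
  by apply/seteqP; split => x //= xS; apply: nx; exists x.
rewrite ler_wpM2l//; apply: fap_le => //.
  exact: (fmeas_pred (fun S : {set I} => S != finset.set0) incidence_meas).
by move=> x /= /finset.set0Pn[i]; rewrite inE => /set_mem; exact: BE.
Qed.
End DoubleCounting.

Section QuasiTiling.
Context (R : realType) (G : countType) (mul : G -> G -> G) (one : G) (inv : G -> G).
Context (hG : is_group mul one inv).
Context (dsp : measure_display) (X : measurableType dsp).
Context (d : X -> X -> R) (hd : is_metric d) (hcpt : dcompact d).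
Context (hborel : @measurable dsp X = <<s [set U | dopen d U] >>).
Context (act : G -> X -> X) (hact : is_action mul one act).
Context (hcont : forall g, dcontinuous d d (act g)).
Context (F : nat -> {fset G}) (hF : Folner R mul F).
Context (nu : probability X R) (inu : invariant_measure act nu).
Context (delta : R) (delta0 : 0 < delta) (delta1 : delta < 1).

Let hma := hmact hborel hcont.
Let mu := pm nu.
Let hp : fap mu := fap_pm nu.

Let muI g E : measurable E -> mu (act g @^-1` E) = mu E.
Proof. exact: invariant_pm. Qed.

(* Ornstein-Weiss quasi-tilings, built greedily from large shapes to small ones.
   The most recent step is at the head of the list; the step (T, M) adds the
   tiles T x for x in M. *)
Implicit Types (T : {fset G}) (M C : set X) (L : seq ({fset G} * set X)).

Definition sat T M : set X := \bigcup_(t in [set: T]) act (inv (val t)) @^-1` M.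

Lemma satP T M z : sat T M z <-> exists t x, [/\ t \in T, M x & z = act t x].
Proof.
split => [[t _ Mz]|[t [x [tT Mx ->]]]].
  by exists (val t), (act (inv (val t)) z); rewrite (actVK hG hact); split => //; exact: valP.
by exists (FSetSub tT) => //=; rewrite (actK hG hact).
Qed.

Lemma sat_measurable T M : measurable M -> measurable (sat T M).
Proof. by move=> mM; apply: fin_bigcup_measurable => // t _; exact: hma. Qed.

Fixpoint cov L : set X :=
  if L is (T, M) :: L' then cov L' `|` sat T M else set0.

Definition visits T C (x : X) : {set T} := [set t : T | act (val t) x \in C]%SET.

Lemma visits_meas T C : measurable C -> fmeas (visits T C).
Proof.
move=> mC; have -> : visits T C = incidence (fun t : T => act (val t) @^-1` C).
  by apply/funext => x; apply/finset.setP => t; rewrite !inE; apply/idP/idP => /set_mem /mem_set.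
by apply: incidence_meas => t; exact: hma.
Qed.

Lemma visits_compl T C x : (#|visits T C x| + #|visits T (~` C) x|)%N = #|` T|.
Proof.
rewrite cardfE -(cardsC (visits T C x)); congr (_ + _)%N; apply: eq_card => t.
by rewrite !inE in_setC.
Qed.

Lemma visits_mono T C C' x : C `<=` C' -> (#|visits T C x| <= #|visits T C' x|)%N.
Proof.
move=> CC'; apply: subset_leq_card; apply/fintype.subsetP => t; rewrite !inE.
exact: CC'.
Qed.

(* The tiles of one step are disjoint, although [t x = t' x] is allowed within a
   tile; each tile meets the earlier ones in a proportion at most [delta], with
   multiplicity. *)
Fixpoint wf L : Prop := if L is (T, M) :: L' then
  [/\ wf L', measurable M,
   forall x x' t t', M x -> M x' -> t \in T -> t' \in T -> act t x = act t' x' -> x = x' &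
   forall x, M x -> (1 - delta) * #|` T|%:R <= #|visits T (~` cov L') x|%:R]
  else True.

Lemma cov_measurable L : wf L -> measurable (cov L).
Proof.
elim: L => [_|[T M] L IH /= [wL mM _ _]]; first exact: measurable0.
by apply: measurableU; [exact: IH|exact: sat_measurable].
Qed.

(** If t x = t' x', the centres x and x' differ by an element t'^-1 t of D. Once nonzero
    displacements are bounded below by 2 / (n + 1), centres taken in one ball of radius 1 / (n + 1)
    have disjoint tiles. The bound is uniform off a small set by continuity from below. *)
Lemma uniform_displacement (D : {fset G}) (e : R) : 0 < e ->
  exists n (Y : set X), [/\ measurable Y, mu (~` Y) <= e &
   forall y g, Y y -> g \in D -> act g y = y \/ 2 / n.+1%:R <= d (act g y) y].
Proof.
move=> e0.
pose Z n := \bigcap_(g in [set: D]) ([set x | act (val g) x = x] `|` ~` [set x | d (act (val g) x) x < 2 / n.+1%:R]).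
have mZ n : measurable (Z n).
  apply: fin_bigcap_measurable => // g _; apply: measurableU.
    exact: (fixed_measurable hd hborel hcont).
  apply: measurableC; apply: (dopen_measurable hborel); exact: displacement_open.
have nZ n k : (n <= k)%N -> Z n `<=` Z k.
  move=> nk x Zx g _; case: (Zx g I) => [h|h]; [by left|right => /= lt; apply: h].
  apply: lt_le_trans lt _; rewrite ler_pM2l// lef_pV2 ?posrE// ler_nat ltnS //.
have UZ : \bigcup_n Z n = setT.
  apply/seteqP; split => // x _.
  have h (g : D) : exists r : R, 0 < r /\ (act (val g) x <> x -> r <= d (act (val g) x) x).
    have [->|ne] := pselect (act (val g) x = x); first by exists 1; split.
    by exists (d (act (val g) x) x); split => //; exact: d_neq.
  pose r g := projT1 (cid (h g)).
  have [g|r0 [r00 hr]] := @fin_pos_min R _ r; first by rewrite /r; case: cid => ? [].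
  have r20 : 0 < r0 / 2 by lra.
  have [n _ /(_ n (leqnn _)) hn] := near_infty_natSinv_lt (PosNum r20).
  have hn' : n.+1%:R^-1 < r0 / 2 := hn.
  exists n => // g _; have [xx|xx] := pselect (act (val g) x = x); [by left|right].
  apply/negP; rewrite -leNgt; apply: (@le_trans _ _ r0); first by move: hn'; move: (n.+1%:R^-1 : R) => q; lra.
  apply: (le_trans (hr g)); rewrite /r; case: cid => ? [_ /=]; exact.
have := @pm_bigcup_cvg _ _ _ nu Z mZ nZ; rewrite UZ (fapT (fap_pm nu)) => /cvgrPdist_le /(_ _ e0) h.
have [n hn] := filter_ex h.
exists n, (Z n); split => //.
  rewrite fapC//; move: hn; rewrite /= ger0_norm ?subr_ge0//; exact: fap_le1.
move=> y g Zy gD; case: (Zy (FSetSub gD) I) => /= [yy|]; [by left|right].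
by rewrite leNgt; apply/negP.
Qed.

(** A greedy pass over the balls of a finite net: a point of [P c] becomes a centre if at least (1 -
    delta)|T| of its tile is free. Its whole tile is covered then; otherwise more than delta |T| of
    the tile was covered before. The exceptional points are those outside Y. *)
Lemma tiling_stage T L (e : R) : 0 < e -> wf L -> exists L', [/\ wf L', cov L `<=` cov L',
  forall T', T' \in unzip1 L' -> T' = T \/ T' \in unzip1 L &
  mu [set x | #|visits T (cov L') x|%:R < delta * #|` T|%:R] <= e].
Proof.
move=> e0 wL.
have [n [Y [mY muY hY]]] := uniform_displacement (mulset mul (invset inv T) T) e0.
have n0 : 0 < (n.+1%:R^-1 : R) by rewrite invr_gt0.
have [cs hcs] := finite_net hd hcpt n0.
pose P c := Y `&` dball d c n.+1%:R^-1.
have mP c : measurable (P c).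
  by apply: measurableI => //; apply: (dopen_measurable hborel); exact: dopen_ball.
have sepP c x x' t t' : P c x -> P c x' -> t \in T -> t' \in T -> act t x = act t' x' -> x = x'.
  move=> [Yx cx] [Yx' cx'] tT t'T tx.
  have xE : x' = act (mul (inv t') t) x by rewrite (actM hact) tx (actK hG hact).
  have gD : mul (inv t') t \in mulset mul (invset inv T) T.
    by apply: mem_mulset => //; rewrite (mem_invset hG) (ginvK hG).
  case: (hY _ _ Yx gD) => [<-//|]; rewrite -xE => h; exfalso.
  have := dtri hd c x' x; rewrite (dC hd x' c); move: cx cx' h; rewrite /dball /=.
  move: (n.+1%:R^-1 : R) => q; lra.
suff : exists L', [/\ wf L', cov L `<=` cov L',
  forall T', T' \in unzip1 L' -> T' = T \/ T' \in unzip1 L &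
  forall c x, c \in cs -> P c x -> delta * #|` T|%:R <= #|visits T (cov L') x|%:R].
  move=> [L' [wL' LL' sL' hL']]; exists L'; split => //.
  apply: le_trans muY; apply: fap_le => //.
  - exact: (fmeas_pred (fun S : {set T} => #|S|%:R < delta * #|` T|%:R)
      (visits_meas (cov_measurable wL'))).
  - exact: measurableC.
  - move=> x /= lt Yx; have [c cc cx] := hcs x.
    by have := hL' c x cc (conj Yx cx); rewrite leNgt lt.
elim: cs {hcs} => [|c cs [L1 [w1 LL1 s1 h1]]]; first by exists L; split => // T' ?; right.
pose M := P c `&` [set x | (1 - delta) * #|` T|%:R <= #|visits T (~` cov L1) x|%:R].
exists ((T, M) :: L1); split.
- split => //.
  + apply: measurableI => //.
    exact: (fmeas_pred (fun S : {set T} => (1 - delta) * #|` T|%:R <= #|S|%:R)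
      (visits_meas (measurableC (cov_measurable w1)))).
  + by move=> x x' t t' [Px _] [Px' _]; exact: sepP Px Px'.
  + by move=> x [].
- by move=> x Lx; left; exact: LL1.
- by move=> T'; rewrite inE => /orP[/eqP->|/s1//]; left.
- move=> c' x; rewrite inE => /orP[/eqP->|c'cs] Px; last first.
    apply: (le_trans (h1 _ _ c'cs Px)); rewrite ler_nat; apply: visits_mono.
    by move=> y; left.
  have [Mx|nM] := pselect (M x).
    suff -> : #|visits T (cov ((T, M) :: L1)) x| = #|` T|.
      by rewrite ler_piMl ?(ltW delta1).
    rewrite cardfE; apply: eq_card => t; rewrite !inE mem_set//; right.
    by apply/satP; exists (val t), x; split => //; exact: valP.
  have lt : #|visits T (~` cov L1) x|%:R < (1 - delta) * #|` T|%:R.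
    by rewrite ltNge; apply/negP => h; apply: nM.
  apply: (@le_trans _ _ #|visits T (cov L1) x|%:R).
    move: lt; rewrite -(visits_compl T (cov L1) x) natrD; lra.
  by rewrite ler_nat; apply: visits_mono => y; left.
Qed.

Context (s : nat) (hs : forall E : {fset G}, mu [set x | (s < #|stab act E x|)%N] = 0).

(** Double counting of the pairs (centre, t) with t x free: each centre has at least (1 - delta)|T|
    of them, while a point z with small stabiliser is reached by at most s elements t. Indeed all
    these t have the same centre t^-1 z, so t t0^-1 fixes z. *)
Lemma tile_mass T M C : measurable M -> measurable C ->
  (forall x x' t t', M x -> M x' -> t \in T -> t' \in T -> act t x = act t' x' -> x = x') ->
  (forall x, M x -> (1 - delta) * #|` T|%:R <= #|visits T (~` C) x|%:R) ->
  (1 - delta) * #|` T|%:R * mu M <= s%:R * mu (sat T M `\` C).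
Proof.
move=> mM mC sep hM.
pose B (t : T) := M `&` act (val t) @^-1` (~` C).
have mB t : measurable (B t) by apply: measurableI => //; apply: hma; exact: measurableC.
pose D := mulset mul T (invset inv T).
pose Z := [set x | (s < #|stab act D x|)%N].
have mZ : measurable Z.
  exact: (fmeas_pred (fun S : {set D} => (s < #|S|)%N) (stab_meas hd hborel hcont (E := D))).
pose W (t : T) := (act (inv (val t)) @^-1` (B t)) `\` Z.
have mW t : measurable (W t) by apply: measurableD => //; exact: hma.
apply: (@le_trans _ _ (\sum_t mu (B t))).
  apply: (double_counting_ge hp mB) => //.
    by rewrite mulr_ge0// subr_ge0 ltW.
  move=> x Mx; apply: (le_trans (hM x Mx)); rewrite ler_nat; apply: subset_leq_card.
  apply/fintype.subsetP => t; rewrite inE => /set_mem h; rewrite inE; apply/mem_set; split => //.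
apply: (@le_trans _ _ (\sum_t mu (W t))).
  apply: ler_sum => t _; rewrite -(muI (inv (val t)) (mB t)).
  rewrite (fap_split hp (hma (inv (val t)) (mB t)) mZ) -[leRHS]add0r lerD2r -(hs D).
  by apply: fap_le => //; apply: measurableI => //; exact: hma.
have mE : measurable (sat T M `\` C) by apply: measurableD => //; exact: sat_measurable.
apply: (@le_trans _ _ (s%:R * mu ((sat T M `\` C) `\` Z))); last first.
  by rewrite ler_wpM2l//; apply: fap_le => //; exact: measurableD.
apply: (double_counting_le hp mW) => //; first exact: measurableD.
  move=> t z [[/= Mz Cz] nZ]; split => //; split; first by exists t.
  by move: Cz; rewrite /= (actVK hG hact).
move=> z [_ nZ]; rewrite ler_nat.
have [->|[t0 ht0]] := finset.set_0Vmem (incidence W z); first by rewrite cards0.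
have zM t : t \in incidence W z -> M (act (inv (val t)) z).
  by rewrite inE => /set_mem[[]].
have hD (t : T) : mul (val t) (inv (val t0)) \in D.
  by apply: mem_mulset; [exact: valP|rewrite (mem_invset hG) (ginvK hG); exact: valP].
pose phi (t : T) : D := FSetSub (hD t).
have phiI : injective phi.
  by move=> t t' /(congr1 val) /= /(gmulIr hG) /val_inj.
have : (#|stab act D z| <= s)%N by rewrite leqNgt; apply/negP.
apply: leq_trans; rewrite -(card_imset _ phiI); apply: subset_leq_card.
apply/fintype.subsetP => y /imsetP[t ht ->]; rewrite inE /=; apply/eqP.
have E : act (inv (val t)) z = act (inv (val t0)) z.
  apply: (sep _ _ (val t) (val t0) (zM _ ht) (zM _ ht0)); [exact: valP|exact: valP|].
  by rewrite !(actVK hG hact).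
by rewrite (actM hact) -E (actVK hG hact).
Qed.

(** g can push t x out of its tile only if g t is not in T, which concerns a kap-fraction of T.
    [tile_mass] compares the resulting mass kap |T| mu(M) with the mass newly covered by the same
    step, so the contributions of all steps add up. *)
Lemma cov_near_invariant L g (kap : R) : 0 <= kap -> wf L ->
  (forall T, T \in unzip1 L -> #|[set t : T | mul g (val t) \notin T]%SET|%:R <= kap * #|` T|%:R) ->
  mu (cov L `\` act g @^-1` cov L) <= kap * s%:R / (1 - delta) * mu (cov L).
Proof.
move=> kap0; have d1 : 0 < 1 - delta by rewrite subr_gt0.
elim: L => [_ _|[T M] L IH /= [wL mM sep hM] hT].
  by rewrite set0D (fap0 hp) mulr0.
have {}IH : mu (cov L `\` act g @^-1` cov L) <= kap * s%:R / (1 - delta) * mu (cov L).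
  by apply: IH => // T' h; apply: hT; rewrite inE h orbT.
have mL := cov_measurable wL.
have mS := sat_measurable T mM.
pose N := \big[setU/set0]_(t : T | mul g (val t) \notin T) (act (inv (val t)) @^-1` M).
have mN : measurable N by apply: bigU_measurable => t _; exact: hma.
have mLg : measurable (cov L `\` act g @^-1` cov L) by apply: measurableD => //; exact: hma.
have E1 : mu (cov L `|` sat T M) = mu (cov L) + mu (sat T M `\` cov L).
  rewrite -(fapU hp)//; [|exact: measurableD|].
    by congr (mu _); apply/seteqP; split => x [Lx|h]; [by left| |by left|by case: h; right];
      case: (pselect (cov L x)) => Lx; [left|right].
  by apply/seteqP; split => x // -[Lx []].
rewrite E1 mulrDr.
apply: (@le_trans _ _ (mu (cov L `\` act g @^-1` cov L) + mu N)).
  apply: (@le_trans _ _ (mu ((cov L `\` act g @^-1` cov L) `|` N))); last exact: fapU_le.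
  apply: (fap_le hp); [|exact: measurableU|].
    by apply: measurableD; [exact: measurableU|apply: hma; exact: measurableU].
  move=> z [[Lz|Sz] ngz]; first by left; split => // gz; apply: ngz; left.
  right; have [t [x [tT Mx zE]]] := (satP _ _ _).1 Sz.
  apply/in_bigU; exists (FSetSub tT); split; first by rewrite mem_index_enum.
    apply/negP => gt; apply: ngz; right; apply/satP.
    by exists (mul g t), x; rewrite zE (actM hact).
  by rewrite /= zE (actK hG hact).
apply: lerD.
  exact: IH.
apply: (@le_trans _ _ (kap * #|` T|%:R * mu M)).
  apply: (le_trans (fap_sum_le _ hp _)); first by move=> t _; exact: hma.
  under eq_bigr do rewrite muI//.
  rewrite sumr_const -[X in X <= _]mulr_natl ler_wpM2r ?(fap_ge0 hp)//.
  have := hT T (mem_head _ _); congr (_%:R <= _).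
  by apply: eq_card => t; rewrite !inE.
have h := tile_mass mM mL sep hM.
rewrite -!(mulrA kap) ler_wpM2l// mulrAC ler_pdivlMr//.
by rewrite mulrC mulrA.
Qed.

(** Up to mixed points, rare because cov L is almost invariant under T T^-1, an orbit piece T x lies
    inside cov L or misses it altogether. In the second case the new cover takes at least a
    proportion delta of it, so the uncovered mass shrinks by the factor 1 - delta. *)
Lemma cov_improve T L L' (e kap : R) : T != fset0 -> wf L -> wf L' -> cov L `<=` cov L' ->
  0 <= kap ->
  mu [set x | #|visits T (cov L') x|%:R < delta * #|` T|%:R] <= e ->
  (forall g, g \in mulset mul T (invset inv T) -> mu (cov L `\` act g @^-1` cov L) <= kap) ->
  mu (~` cov L') <= (1 - delta) * mu (~` cov L) + #|` T|%:R ^+ 2 * kap + e.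
Proof.
move=> T0 wL wL' LL' kap0 he hk.
have mL := cov_measurable wL; have mL' := cov_measurable wL'.
have t0 : 0 < (#|` T|%:R : R) by rewrite ltr0n cardfs_gt0.
have mnL := measurableC mL; have mnL' := measurableC mL'.
pose C := cov L.
pose mix (p : T * T) := act (val p.1) @^-1` C `&` act (val p.2) @^-1` (~` C).
have mmix p : measurable (mix p) by apply: measurableI; exact: hma.
pose Mx := \big[setU/set0]_p mix p.
have mMx : measurable Mx by exact: bigU_measurable.
have muMx : mu Mx <= #|` T|%:R ^+ 2 * kap.
  apply: (le_trans (fap_sum_le _ hp _)) => //.
  apply: (@le_trans _ _ (\sum_(p : T * T) kap)); last first.
    by rewrite sumr_const -[X in X <= _]mulr_natl card_prod -cardfE natrM expr2.
  apply: ler_sum => -[t t'] _.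
  apply: le_trans (hk (mul (val t') (inv (val t))) _); last first.
    by apply: mem_mulset; [exact: valP|rewrite (mem_invset hG) (ginvK hG); exact: valP].
  rewrite -[leRHS](muI (val t)); last by apply: measurableD => //; exact: hma.
  rewrite le_eqVlt; apply/orP; left; apply/eqP; congr (mu _).
  have E x : act (mul (val t') (inv (val t))) (act (val t) x) = act (val t') x.
    by rewrite (actM hact) (actK hG hact).
  by apply/seteqP; split => x [Ct h]; split => // h'; apply: h; move: h'; rewrite /= ?E.
pose Bad := [set x | #|visits T (cov L') x|%:R < delta * #|` T|%:R].
have mBad : measurable Bad.
  exact: (fmeas_pred (fun S : {set T} => #|S|%:R < delta * #|` T|%:R) (visits_meas mL')).
pose W := Mx `|` Bad.
have mW : measurable W by exact: measurableU.
have muW : mu W <= #|` T|%:R ^+ 2 * kap + e.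
  by apply: (le_trans (fapU_le hp mMx mBad)); exact: lerD.
have /fset0Pn[g0 g0T] := T0.
pose E := act g0 @^-1` (~` C) `\` W.
have mE : measurable E by apply: measurableD => //; exact: hma.
have muE : mu E <= mu (~` C).
  by rewrite -(muI g0 mnL); apply: fap_le => //; [exact: hma|move=> x []].
pose B (t : T) := act (val t) @^-1` (~` cov L') `\` W.
have mB t : measurable (B t) by apply: measurableD => //; exact: hma.
have BE t : B t `<=` E.
  move=> x [/= ntx nW]; split => // Cg0; apply: nW; left.
  apply/in_bigU; exists (FSetSub g0T, t) => //.
  split; [exact: mem_index_enum|by []|].
  by split => //= Ct; apply: ntx; exact: LL'.
have cB x : E x -> #|incidence B x|%:R <= (1 - delta) * #|` T|%:R.
  move=> [_ nW].
  have : delta * #|` T|%:R <= #|visits T (cov L') x|%:R.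
    by rewrite leNgt; apply/negP => h; apply: nW; right.
  have : (#|incidence B x| <= #|visits T (~` cov L') x|)%N.
    apply: subset_leq_card; apply/fintype.subsetP => t; rewrite inE => /set_mem[h _].
    by rewrite inE; apply/mem_set.
  rewrite -(ler_nat R) => h1 h2.
  have := visits_compl T (cov L') x => /(congr1 (fun n : nat => n%:R : R)).
  by rewrite natrD; lra.
have k0 : 0 <= (1 - delta) * #|` T|%:R.
  by rewrite mulr_ge0// subr_ge0 ltW.
have := double_counting_le hp mB mE k0 BE cB.
have hB (t : T) : mu (~` cov L') - (#|` T|%:R ^+ 2 * kap + e) <= mu (B t).
  rewrite -(muI (val t) mnL') (fap_split hp (hma (val t) mnL') mW).
  have : mu (act (val t) @^-1` (~` cov L') `&` W) <= mu W.
    by apply: fap_le => //; apply: measurableI => //; exact: hma.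
  by rewrite /B; lra.
have : \sum_(t : T) (mu (~` cov L') - (#|` T|%:R ^+ 2 * kap + e)) <= \sum_t mu (B t).
  by apply: ler_sum => t _.
rewrite sumr_const -[X in X <= _]mulr_natl -cardfE => h1 h2.
have d0 : 0 <= 1 - delta by rewrite subr_ge0 ltW.
have h3 := ler_wpM2l k0 muE.
have : #|` T|%:R * (mu (~` cov L') - (#|` T|%:R ^+ 2 * kap + e)) <= #|` T|%:R * ((1 - delta) * mu (~` C)).
  by apply: (le_trans h1); apply: (le_trans h2); rewrite mulrCA mulrA.
by rewrite ler_pM2l// /C; lra.
Qed.

Definition almost_inv (A : {fset G}) (kap : R) T :=
  forall g, g \in A -> #|[set t : T | mul g (val t) \notin T]%SET|%:R <= kap * #|` T|%:R.

Lemma folner_almost_inv (A : {fset G}) (kap : R) : 0 < kap ->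
  \forall n \near \oo, almost_inv A kap (F n).
Proof.
move=> k0; have := folner_mulset hF A k0; apply: filterS => n hn g gA.
apply: le_trans hn; rewrite ler_nat.
pose phi (t : F n) : G := mul g (val t).
rewrite cardE -(size_map phi); apply: uniq_leq_size.
  by rewrite map_inj_uniq ?enum_uniq// => t t' /(gmulI hG) /val_inj.
move=> x /mapP[t]; rewrite mem_enum inE => nt ->.
by rewrite !inE nt; apply: mem_mulset => //; exact: valP.
Qed.

(** The shape T used last is chosen first. The induction hypothesis then supplies the earlier
    shapes, almost invariant under T T^-1 as well as under A, so that the cover they produce is
    almost invariant when T is added. *)
Lemma quasi_tiling k : forall (A : {fset G}) (kap : R) (n0 : nat), 0 < kap ->
  exists L (S : seq {fset G}), [/\ wf L, (size S <= k)%N,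
   forall T, T \in unzip1 L -> T \in S,
   forall T, T \in S -> (exists2 n, (n0 <= n)%N & T = F n) /\ almost_inv A kap T &
   mu (~` cov L) <= (1 - delta) ^+ k + kap].
Proof.
have d1 : 0 < 1 - delta by rewrite subr_gt0.
elim: k => [|k IH] A kap n0 kap0.
  exists [::], [::]; split => //=.
  by rewrite setC0 (fapT hp) expr0; lra.
have [n [/= ainv n0n]] := filter_ex (filterI (folner_almost_inv A kap0) (nbhs_infty_ge n0)).
set T := F n in ainv.
have T0 : T != fset0 by case: hF => + _; exact.
pose D := mulset mul T (invset inv T).
(* Makes kap' + |T|^2 kap' s / (1 - delta) equal to kap / 2; the other half of kap is the
   exceptional set of [tiling_stage]. *)
pose c : R := 1 + #|` T|%:R ^+ 2 * (s%:R / (1 - delta)).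
have c1 : 1 <= c.
  by rewrite lerDl mulr_ge0// ?exprn_ge0// divr_ge0// ltW.
have c0 : 0 < c by exact: lt_le_trans c1.
pose kap' := kap / (2 * c).
have kap'0 : 0 < kap' by rewrite divr_gt0// mulr_gt0.
have kk : kap' <= kap.
  rewrite ler_pdivrMr ?mulr_gt0// ler_peMr ?(ltW kap0)//; lra.
have [L [S [wL sS LS hS muL]]] := IH (A `|` D)%fset kap' n0 kap'0.
have e0 : 0 < kap / 2 by lra.
have [L' [wL' LL' sL' hL']] := tiling_stage T e0 wL.
exists L', (T :: S); split => //=.
- by move=> T' /sL'[->|/LS h]; rewrite inE ?eqxx// h orbT.
- move=> T'; rewrite inE => /orP[/eqP->|/hS[h1 h2]].
    by split => //; exists n.
  split => // g gA; apply: le_trans (h2 g _) _; first by rewrite !inE gA.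
  by rewrite ler_wpM2r.
- have k2 : 0 <= kap' * s%:R / (1 - delta).
    by rewrite divr_ge0 ?(ltW d1)// mulr_ge0 ?(ltW kap'0).
  apply: (le_trans (cov_improve T0 wL wL' LL' k2 hL' _)).
    move=> g gD; apply: (le_trans (@cov_near_invariant L g kap' (ltW kap'0) wL _)).
      by move=> T' /LS/hS[_]; apply; rewrite !inE gD orbT.
    by rewrite ler_piMr// (fap_le1 hp)//; exact: cov_measurable.
  have h1 : (1 - delta) * mu (~` cov L) <= (1 - delta) * ((1 - delta) ^+ k + kap').
    by rewrite ler_pM2l.
  have h2 : kap' * c = kap / 2 by rewrite /kap'; field; lra.
  have h3 : (1 - delta) * kap' <= kap' by rewrite ler_piMl ?(ltW kap'0)// gerBl ltW.
  move: h2; rewrite /c mulrDr mulr1 (exprS (1 - delta)) => h2.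
  have h4 : #|` T|%:R ^+ 2 * (kap' * s%:R / (1 - delta)) = kap' * (#|` T|%:R ^+ 2 * (s%:R / (1 - delta))).
    by ring.
  rewrite h4; move: h1 h2 h3; rewrite mulrDr; move: (_ * (_ / _)) => a; move: (_ * mu _) (_ * (1 - delta) ^+ k).
  by move: (kap') ((1 - delta) * kap') => b b' u v; lra.
Qed.

(* The shape T of the tile that covered [z] first, and a t in T with
   t^-1 z a centre of that step. *)
Fixpoint owner L (z : X) : option ({fset G} * G) :=
  if L is (T, M) :: L' then
    if z \in cov L' then owner L' z
    else omap (fun t : T => (T, val t)) [pick t : T | act (inv (val t)) z \in M]
  else None.

Lemma owner_mem L z T t : owner L z = Some (T, t) -> T \in unzip1 L /\ t \in T.
Proof.
elim: L => //= -[T' M] L IH /=; case: ifP => _.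
  by move=> /IH[h ?]; rewrite inE h orbT.
by case: pickP => //= t' _ [<- <-]; rewrite inE eqxx; split => //; exact: valP.
Qed.

Lemma owner_cov L z : cov L z <-> owner L z.
Proof.
elim: L => //= -[T M] L IH /=; case: ifPn => [/set_mem Lz|/negP Lz].
  by split => _; [exact/IH|left].
case: pickP => /= [t /set_mem Mt|h]; split => //; first by right; exists t.
  by move=> [/mem_set//|[t _ Mt]]; move: (h t); rewrite mem_set.
Qed.

Lemma owner_measurable L p : wf L -> measurable [set z | owner L z = p].
Proof.
elim: L => [_|[T M] L IH /= [wL mM _ _]].
  case: p => [p|] /=; last by rewrite (_ : [set _ | _] = setT)//; apply/seteqP.
  by rewrite (_ : [set _ | _] = set0)//; apply/seteqP; split.
have mL := cov_measurable wL.
pose B (t : T) := act (inv (val t)) @^-1` M.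
pose D (S : {set T}) := omap (fun t : T => (T, val t)) [pick t in S] == p.
have mD : measurable [set z | D (incidence B z)].
  by apply: fmeas_pred; apply: incidence_meas => t; exact: hma.
rewrite (_ : [set _ | _] = (cov L `&` [set z | owner L z = p]) `|`
    (~` cov L `&` [set z | D (incidence B z)])).
  apply: measurableU; apply: measurableI => //; [exact: IH|exact: measurableC].
have E z : [pick t : T | act (inv (val t)) z \in M] = [pick t in incidence B z].
  by apply: eq_pick => t; rewrite inE; apply/idP/idP => /set_mem /mem_set.
apply/seteqP; split => z /=; rewrite /D E.
  by case: ifPn => [/set_mem Lz|/negP Lz] h; [left|right; split; [move=> /mem_set|apply/eqP]].
by move=> [[/mem_set ->//]|[Lz /eqP h]]; rewrite ifN//; apply/negP => /set_mem.
Qed.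

Definition own L z T m :=
  if owner L z is Some p then (p.1 == T) && (act (inv p.2) z == m) else false.

Lemma ownP L z T m : reflect (exists2 t, owner L z = Some (T, t) & act (inv t) z = m) (own L z T m).
Proof.
rewrite /own; case E: (owner L z) => [[T' t]|]; last by constructor => -[].
apply: (iffP andP) => /= [[/eqP<- /eqP<-]|[t' [-> ->] ->]]; first by exists t.
by rewrite !eqxx.
Qed.

(** In the step that covered z, the centre m keeps everything in T m that was free, since the tiles
    of one step are disjoint; by [wf] this is at least (1 - delta)|T|. *)
Lemma own_card L z T m : wf L -> own L z T m ->
  (1 - delta) * #|` T|%:R <= #|[set t : T | own L (act (val t) m) T m]%SET|%:R.
Proof.
elim: L => // -[T' M] L IH /= [wL mM sep hM] /ownP[t] /=; case: ifPn => Lz.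
  move=> ow tz; have : own L z T m by apply/ownP; exists t.
  move=> /(IH wL) h; apply: (le_trans h); rewrite ler_nat; apply: subset_leq_card.
  apply/fintype.subsetP => t'; rewrite !inE => /ownP[t'' h1 h2]; apply/ownP; exists t'' => //=.
  by rewrite ifT//; apply/mem_set/owner_cov; rewrite h1.
case: pickP => //= t0 Mt0 [TT tt] tz; subst T' t m; have {}Mt0 := set_mem Mt0.
apply: (le_trans (hM _ Mt0)); rewrite ler_nat; apply: subset_leq_card.
apply/fintype.subsetP => t'; rewrite !inE => h.
have E (t'' : T) : M (act (inv (val t'')) (act (val t') (act (inv (val t0)) z))) ->
    act (inv (val t'')) (act (val t') (act (inv (val t0)) z)) = act (inv (val t0)) z.
  move=> h'; apply: (sep _ _ (val t'') (val t')) => //; [exact: valP|exact: valP|].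
  by rewrite (actVK hG hact).
have nL : ((act (val t') (act (inv (val t0)) z)) \in cov L) = false.
  by apply/negP => /set_mem.
apply/ownP => /=; rewrite nL; case: pickP => [t1 /set_mem /E Ht1|/(_ t')].
  by exists (val t1).
by rewrite (actK hG hact) mem_set.
Qed.

(** Disjointness of the tiles makes t'^-1 z in M equivalent to t'^-1 z being the known centre, so
    the position chosen by [owner] can be recovered from z and the centre alone. *)
Lemma owner_pick L z T t : wf L -> owner L z = Some (T, t) ->
  omap val [pick t' : T | act (inv (val t')) z == act (inv t) z] = Some t.
Proof.
elim: L => // -[T' M] L IH /= [wL mM sep hM] /=; case: ifPn => _; first exact: IH.
case E: [pick _ : _ | _] => [t0|] //= [TT tt]; subst T' t.
have {}Mt0 : act (inv (val t0)) z \in M by move: E; case: pickP => // t1 ? [<-].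
rewrite (_ : [pick _ : _ | _] = Some t0)// -E; apply: eq_pick => t /=.
apply/eqP/idP => [->//|/set_mem Mt]; apply: (sep _ _ (val t) (val t0) Mt (set_mem Mt0)).
- exact: valP.
- exact: valP.
- by rewrite !(actVK hG hact).
Qed.
End QuasiTiling.

(** By distributivity the right-hand side is the total weight of all functions, as in a Chernoff or
    Kraft bound. *)
Lemma weighted_card (R : realType) (I A : finType) (w : I -> A -> R)
    (B : {set {ffun I -> A}}) (c : R) :
  (forall i a, 0 <= w i a) -> (forall f, f \in B -> c <= \prod_i w i (f i)) ->
  #|B|%:R * c <= \prod_i \sum_a w i a.
Proof.
move=> w0 hc; rewrite bigA_distr_bigA /= mulr_natl -sumr_const [leLHS]big_mkcond.
apply: ler_sum => f _; case: ifPn => [/hc//|_].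
by apply: prodr_ge0 => i _.
Qed.

Lemma ln_nat_le_exp (R : realType) (n : nat) (y : R) : 0 <= y ->
  n%:R <= expR y -> ln (n%:R : R) <= y.
Proof.
case: n => [|n] y0 h; first by rewrite ln0.
by rewrite -[leRHS]expRK ler_ln ?posrE ?expR_gt0.
Qed.

Lemma ln_card_ffun (R : realType) (I A : finType) (a : A) :
  ln (#|{ffun I -> A}|%:R : R) = #|I|%:R * ln #|A|%:R.
Proof.
rewrite card_ffun natrX lnXn ?mulr_natl// ltr0n.
by apply/card_gt0P; exists a.
Qed.

Lemma card_ord_lt (N n : nat) : (#|[set i : 'I_N | (i < n)%N]%SET| <= n)%N.
Proof.
rewrite cardE -(size_map val) -[leqRHS](size_iota 0); apply: uniq_leq_size.
  by rewrite map_inj_uniq ?enum_uniq//; exact: val_inj.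
by move=> x /mapP[i]; rewrite mem_enum inE mem_iota => ? ->.
Qed.

(** * Counting the itineraries of tile labels *)

Section TileNames.
Context (R : realType) (G : countType) (mul : G -> G -> G) (one : G) (inv : G -> G).
Context (hG : is_group mul one inv).
Context (dsp : measure_display) (X : measurableType dsp).
Context (act : G -> X -> X) (hact : is_action mul one act).
Context (d : X -> X -> R).
Context (hborel : @measurable dsp X = <<s [set U | dopen d U] >>).
Context (hcont : forall g, dcontinuous d d (act g)).
Context (delta : R) (delta1 : delta < 1).
Context (L : seq ({fset G} * set X)) (wL : wf inv act delta L).
Context (SS : seq {fset G}) (LSS : forall T, T \in unzip1 L -> T \in SS).
Context (D : {fset G}) (SD : forall T, T \in SS -> (T `<=` D)%fset).
Context (N : nat) (cd : {fset G} -> X -> 'I_N) (mcd : forall T, fmeas (cd T)).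
Context (Nn : {fset G} -> nat) (cdN : forall T x, T \in SS -> (cd T x < Nn T)%N).

Let hma := hmact hborel hcont.
Local Notation J := (seq_sub SS).
Local Notation Lam := (option (J * D * 'I_N)).
Local Notation own := (own inv act L).
Local Notation owner := (owner inv act L).

Definition labelled (z : X) (q : J * D * 'I_N) : bool :=
  (owner z == Some (ssval q.1.1, val q.1.2)) &&
  (cd (ssval q.1.1) (act (inv (val q.1.2)) z) == q.2).

Definition tile_label (z : X) : Lam := [pick q | labelled z q].

Lemma tile_label_meas : fmeas tile_label.
Proof.
pose B (q : J * D * 'I_N) := [set z | labelled z q].
have mB q : measurable (B q).
  rewrite (_ : B q = [set z | owner z = Some (ssval q.1.1, val q.1.2)] `&`
      act (inv (val q.1.2)) @^-1` (cd (ssval q.1.1) @^-1` [set q.2])).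
    apply: measurableI; first exact: (owner_measurable hborel hcont _ wL).
    by apply: hma; exact: mcd.
  apply/seteqP; split => z /=; first by move=> /andP[/eqP ? /eqP].
  by move=> [h1 h2]; apply/andP; split; apply/eqP.
have -> : tile_label = (fun S : {set J * D * 'I_N} => [pick q in S]) \o incidence B.
  apply/funext => z; apply: eq_pick => q; rewrite inE.
  by apply/idP/idP => [/mem_set|/set_mem].
by apply: fmeas_comp; exact: incidence_meas.
Qed.

Lemma tile_label_some z q : tile_label z = Some q -> labelled z q.
Proof. by rewrite /tile_label; case: pickP => // q' ? [<-]. Qed.

Lemma tile_label_none z : tile_label z = None -> ~ cov inv act L z.
Proof.
move=> h /owner_cov; case E: (owner z) => [[T t]|]// _.
have [TL tT] := owner_mem E; have tD := fsubsetP (SD (LSS TL)) _ tT.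
move: h; rewrite /tile_label; case: pickP => // /(_ (SeqSub (LSS TL), FSetSub tD, cd T (act (inv t) z))).
by rewrite /labelled /= E !eqxx.
Qed.

Section Name.
Context (K : {fset G}).
(** K' contains the elements h for which h x can be the centre of the tile owning some g x with g in
    K, and K'' contains the products t h for which t h x can lie in such a tile. *)
Let K' := mulset mul (invset inv D) K.
Let K'' := mulset mul D K'.

(* Distinct h in K' may give the same centre h x; only one of them is coded. *)
Definition centre_rep (x : X) (h : K') :=
  [pick h' : K' | act (val h') x == act (val h) x] == Some h.

(** D contains every shape, so that the parts owned by tiles of different shapes have one common
    type. *)
Definition owned (x : X) (p : K' * J) : {set D} :=
  [set t : D | (val t \in ssval p.2) &&
    own (act (val t) (act (val p.1) x)) (ssval p.2) (act (val p.1) x)]%SET.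

Definition active (x : X) (p : K' * J) :=
  centre_rep x p.1 && (owned x p != finset.set0).

Definition tile_code (x : X) : {ffun K' * J -> option ('I_N * {set D})} :=
  [ffun p => if active x p then Some (cd (ssval p.2) (act (val p.1) x), owned x p) else None].

(** Coincidences along an orbit depend only on the stabiliser, which is why the stabiliser is
    recorded next to the tile code. *)
Lemma same_stab_eq x y : (forall g, act g x = x <-> act g y = y) ->
  forall g h, act g x = act h x -> act g y = act h y.
Proof.
move=> hxy g h gh; have /hxy : act (mul (inv h) g) x = x.
  by rewrite (actM hact) gh (actK hG hact).
by rewrite (actM hact) => e; rewrite -{2}e (actVK hG hact).
Qed.

(** The tile owning g x has a coded centre h x, and the code reveals which positions t it owns and
    the Bowen cell of the centre. Equal stabilisers transfer h x = t^-1 g x to y, and [owner_pick]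
    recovers t itself. *)
Lemma tile_code_transfer x y g q : (forall g, act g x = x <-> act g y = y) ->
  tile_code x = tile_code y -> g \in K -> labelled (act g x) q -> labelled (act g y) q.
Proof.
move=> hxy hc gK; have hyx g' : act g' y = y <-> act g' x = x by split => /hxy.
have Exy g1 g2 : (act g1 x == act g2 x) = (act g1 y == act g2 y).
  by apply/eqP/eqP; exact: same_stab_eq.
case: q => [[[T TS] t] i] /andP[/eqP /= ow /eqP cdi].
have [TL tT] := owner_mem ow.
have hK : mul (inv (val t)) g \in K'.
  apply: mem_mulset => //; rewrite (mem_invset hG) (ginvK hG); exact: valP.
pose h0 : K' := FSetSub hK.
have [h rh] : exists h, [pick h' : K' | act (val h') x == act (val h0) x] = Some h.
  by case: pickP => [h _|/(_ h0)]; [exists h|rewrite eqxx].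
have hx : act (val h) x = act (val h0) x.
  by move: rh; case: pickP => // h' /eqP ? [<-].
have h0x : act (val h0) x = act (inv (val t)) (act g x) by rewrite /= (actM hact).
pose p : K' * J := (h, SeqSub TS).
have thx : act (val t) (act (val h) x) = act g x by rewrite hx h0x (actVK hG hact).
have to : t \in owned x p.
  rewrite inE tT /= thx; apply/ownP => /=; exists (val t) => //.
  by rewrite hx h0x.
have ap : active x p.
  apply/andP; split; last by apply/finset.set0Pn; exists t.
  by rewrite /centre_rep /= -rh; apply/eqP/eq_pick => h'; rewrite /= hx.
have := congr1 (fun c : {ffun K' * J -> option ('I_N * {set D})} => c p) hc; rewrite !ffunE ap.
case: ifP => // ay [] cdE owE; move: to; rewrite owE inE tT /= => /ownP[t' ow' t'y].
have thy : act (val t) (act (val h) y) = act g y.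
  rewrite -!(actM hact); apply: (same_stab_eq hxy); rewrite (actM hact).
  exact: thx.
have tt' : val t = t'.
  have hB := owner_pick hG hact wL ow'; have := owner_pick hG hact wL ow.
  rewrite (_ : [pick _ : _ | _] = [pick t2 | act (inv (val t2)) (act g y) == act (inv t') (act g y)]).
    by rewrite -thy hB => -[].
  by apply: eq_pick => t2; rewrite -thy t'y thy -h0x -hx /= -!(actM hact); exact: Exy.
rewrite /labelled /= -thy ow' -tt' eqxx /=; apply/eqP.
by rewrite (actK hG hact) -cdE -cdi -h0x hx.
Qed.

Lemma active_card x p : active x p ->
  (1 - delta) * #|` ssval p.2|%:R <= #|owned x p|%:R.
Proof.
move=> /andP[_ /finset.set0Pn[t]]; rewrite inE => /andP[tT ow].
apply: (le_trans (own_card hG hact wL ow)); rewrite ler_nat !cardE -!(size_map val).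
apply: uniq_leq_size; first by rewrite map_inj_uniq ?enum_uniq//; exact: val_inj.
move=> g /mapP[t']; rewrite mem_enum inE => ow' ->.
have tD := fsubsetP (SD (ssvalP p.2)) _ (valP t').
apply/mapP; exists (FSetSub tD) => //.
by rewrite mem_enum inE /= ow' (valP t').
Qed.

(** The point t h x determines the shape and the centre of its owner, the centre determines the
    representative h, and then t follows. So (h, T, t) |-> t h is injective on owned positions. *)
Lemma active_sum x : (\sum_(p | active x p) #|owned x p| <= #|` K''|)%N.
Proof.
have -> : (\sum_(p | active x p) #|owned x p| =
    #|[set q : K' * J * D | active x q.1 && (q.2 \in owned x q.1)]%SET|)%N.
  rewrite -sum1_card (eq_bigl (fun q : K' * J * D => active x q.1 && (q.2 \in owned x q.1))); last first.
    by move=> q; rewrite inE.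
  rewrite -(pair_big_dep (active x) (fun p t => t \in owned x p) (fun _ _ => 1%N)) /=.
  by apply: eq_bigr => p _; rewrite sum1_card.
pose phi (q : K' * J * D) : G := mul (val q.2) (val q.1.1).
rewrite cardE -(size_map phi); apply: uniq_leq_size; last first.
  by move=> g /mapP[q _ ->]; apply: mem_mulset; exact: valP.
rewrite map_inj_in_uniq ?enum_uniq// => -[[h T] t] [[h' T'] t'].
rewrite !mem_enum !inE /= => /andP[/andP[rh _]] /andP[tT ow] /andP[/andP[rh' _]] /andP[tT' ow'].
rewrite /phi /= => e.
move: ow ow'; rewrite -!(actM hact) e => /ownP[u ou uh] /ownP[u']; rewrite ou => -[TT uu].
rewrite -uu uh => hh.
have TTJ : T = T' by exact: val_inj.
have hh' : h = h'.
  move: rh rh'; rewrite /centre_rep /= => /eqP r1 /eqP r2.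
  suff : Some h = Some h' by move=> [].
  by rewrite -r1 -r2; apply: eq_pick => h2; rewrite hh.
by move: e; rewrite hh' => /(gmulIr hG)/val_inj ->; rewrite TTJ.
Qed.

Context (a : R) (a0 : 0 <= a).
Context (aN : \sum_(T : J) (Nn (ssval T))%:R * 2 ^+ #|` ssval T| * expR (- (a * #|` ssval T|%:R)) <= 1).

(* With these weights the product over all (h, T) is at least e^{-a |K''|/(1 - delta)}
   on the codes that occur, while the sum over all codes is at most e^{|K'|}. *)
Let wt (p : K' * J) (c : option ('I_N * {set D})) : R :=
  if c is Some ib then
    if (ib.1 < Nn (ssval p.2))%N && (ib.2 \subset [set t : D | val t \in ssval p.2]%SET)
    then expR (- (a * #|` ssval p.2|%:R)) else 0
  else 1.

Let wt_sum p : \sum_c wt p c <=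
  1 + (Nn (ssval p.2))%:R * 2 ^+ #|` ssval p.2| * expR (- (a * #|` ssval p.2|%:R)).
Proof.
rewrite (bigD1 None)//= lerD2l.
pose T' := [set t : D | val t \in ssval p.2]%SET.
pose e := expR (- (a * #|` ssval p.2|%:R)).
rewrite (reindex_omap Some id)/=; last by case.
apply: (@le_trans _ _ (\sum_(q in finset.setX [set i : 'I_N | (i < Nn (ssval p.2))%N]%SET (powerset T')) e)).
  rewrite [leRHS]big_mkcond [leLHS]big_mkcond; apply: ler_sum => -[i b] _.
  by rewrite eqxx finset.in_setX finset.inE powersetE /wt /=.
rewrite sumr_const -[X in X <= _]mulr_natl ler_wpM2r ?expR_ge0//.
rewrite cardsX card_powerset natrM ler_pM//; first by rewrite ler_nat card_ord_lt.
rewrite -natrX ler_nat leq_exp2l// cardE -(size_map val); apply: uniq_leq_size.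
  by rewrite map_inj_uniq ?enum_uniq//; exact: val_inj.
by move=> g /mapP[t]; rewrite mem_enum inE => ? ->.
Qed.

Let wt_code x p : wt p (tile_code x p) =
  expR (- (a * (if active x p then #|` ssval p.2|%:R else 0))).
Proof.
rewrite ffunE; case: ifP => _ /=; last by rewrite mulr0 oppr0 expR0.
rewrite cdN ?ssvalP//= ifT//; apply/fintype.subsetP => t.
by rewrite !inE => /andP[].
Qed.

(** An active (h, T) weighs e^(-a |T|). It owns at least (1 - delta)|T| positions, and these are
    disjoint in K'', so the active shapes have total size at most |K''| / (1 - delta). *)
Lemma tile_code_prod x :
  expR (- (a * (#|` K''|%:R / (1 - delta)))) <= \prod_p wt p (tile_code x p).
Proof.
under eq_bigr do rewrite wt_code.
rewrite -expR_sum ler_expR sumrN lerN2 -mulr_sumr ler_wpM2l//.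
rewrite ler_pdivlMr ?subr_gt0// mulrC mulr_sumr.
apply: (@le_trans _ _ (\sum_(p | active x p) #|owned x p|)%:R); last by rewrite ler_nat active_sum.
rewrite natr_sum [leRHS]big_mkcond; apply: ler_sum => p _.
by case: ifP => [ap|]; [exact: active_card|rewrite mulr0].
Qed.

(** The terms pay for the choice of the stabiliser from [ps], for the smallest weight of a code that
    occurs, for the total weight of all codes (at most e per element of K', by 1 + u <= e^u), and
    for the points whose stabiliser is not listed. *)
Lemma tile_name_entropy (mu : set X -> R) (ps : seq {fset G}) : fap mu ->
  measurable [set x | exists2 P, P \in ps & forall g, act g x = x <-> g \in P] ->
  Hset act mu tile_label K <= ln 2 + ln #|{: option (seq_sub ps)}|%:R +
    a * (#|` K''|%:R / (1 - delta)) + #|` K'|%:R +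
    mu (~` [set x | exists2 P, P \in ps & forall g, act g x = x <-> g \in P]) *
      (#|` K|%:R * ln #|{: Lam}|%:R).
Proof.
move=> hm mG; set Gd := [set x | _] in mG *.
pose cP x : option (seq_sub ps) := [pick P : seq_sub ps | `[< forall g, act g x = x <-> g \in ssval P >]].
pose B0 := [set c : {ffun K' * J -> option ('I_N * {set D})} |
  expR (- (a * (#|` K''|%:R / (1 - delta)))) <= \prod_p wt p (c p)]%SET.
pose B := finset.setX [set: option (seq_sub ps)]%SET B0.
have mn : fmeas (name act tile_label K) by exact: (name_meas hma tile_label_meas).
have E : ln (#|{ffun K -> Lam}|%:R : R) = #|` K|%:R * ln #|{: Lam}|%:R.
  by rewrite (@ln_card_ffun _ _ _ None) cardfE.
have h := @ent_code _ _ _ mu _ _ (name act tile_label K) (fun x => (cP x, tile_code x)) Gd B hm mn mG.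
apply: (le_trans (h _ _)).
- move=> x _; rewrite finset.in_setX finset.in_setT /= inE; exact: tile_code_prod.
- move=> x y [P Pps xP] [P' P'ps yP'] [cxy txy].
  have hxy g : act g x = x <-> act g y = y.
    move: cxy; rewrite /cP; case: pickP => [Q /asboolP xQ|]; last first.
      by move=> /(_ (SeqSub Pps)) /asboolP h'; exfalso; apply: h'.
    case: pickP => // Q' /asboolP yQ' [QQ].
    by rewrite xQ yQ' QQ.
  have hyx g : act g y = y <-> act g x = x by split => /hxy.
  apply/name_eqP => g gK; apply: eq_pick => q; apply/idP/idP.
    exact: tile_code_transfer.
  by apply: tile_code_transfer.
rewrite E lerD2r -!addrA lerD2l addrA.
have O0 : 0 < (#|{: option (seq_sub ps)}|%:R : R).
  by rewrite ltr0n; apply/card_gt0P; exists None.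
have d1 : 0 < 1 - delta by rewrite subr_gt0.
have L0 : 0 <= a * (#|` K''|%:R / (1 - delta)) by rewrite mulr_ge0 ?divr_ge0 ?(ltW d1).
apply: ln_nat_le_exp.
  by rewrite !addr_ge0// ln_ge0// ler1n -(ltr0n R).
rewrite cardsX cardsT natrM !expRD lnK ?posrE// -mulrA ler_pM2l//.
have /weighted_card : forall c, c \in B0 ->
  expR (- (a * (#|` K''|%:R / (1 - delta)))) <= \prod_p wt p (c p) by move=> c; rewrite inE.
move=> /(_ _)/wrap[]; last first.
  move=> h1; rewrite -ler_pdivrMl ?expR_gt0// -expRN mulrC.
  apply: (le_trans h1).
  apply: (@le_trans _ _ (\prod_p expR ((Nn (ssval p.2))%:R * 2 ^+ #|` ssval p.2| * expR (- (a * #|` ssval p.2|%:R))))).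
    apply: ler_prod => p _; apply/andP; split.
      apply: sumr_ge0 => c _; rewrite /wt; case: c => // c; case: ifP => // _; exact: expR_ge0.
    apply: (le_trans (wt_sum p)); exact: expR_ge1Dx.
  rewrite -expR_sum ler_expR -(pair_big xpredT xpredT (fun (_ : K') (T : J) => (Nn (ssval T))%:R * 2 ^+ #|` ssval T| * expR (- (a * #|` ssval T|%:R)))) /=.
  by rewrite sumr_const cardfE -[leLHS]mulr_natl ler_piMr.
by move=> p c; rewrite /wt; case: c => // c; case: ifP => // _; exact: expR_ge0.
Qed.
End Name.
End TileNames.

(** * The upper bound *)

Section UpperBound.
Context (R : realType) (G : countType) (mul : G -> G -> G) (one : G) (inv : G -> G).
Context (hG : is_group mul one inv) (hinf : ~ finite_set [set: G]).
Context (dsp : measure_display) (X : measurableType dsp).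
Context (d : X -> X -> R) (hd : is_metric d) (hcpt : dcompact d).
Context (hborel : @measurable dsp X = <<s [set U | dopen d U] >>).
Context (act : G -> X -> X) (hact : is_action mul one act).
Context (hcont : forall g, dcontinuous d d (act g)).
Context (F : nat -> {fset G}) (hF : Folner R mul F).

Let hma := hmact hborel hcont.

Lemma Hset_le_ent (m : set X -> R) (A : finType) (f : X -> A) K :
  fap m -> act_invariant act m -> fmeas f -> Hset act m f K <= #|` K|%:R * ent m f.
Proof.
move=> hm im mf; have [n] := ubnP #|` K|; elim: n K => // n IH K.
have [->|[g gK]] := fset_0Vmem K; first by rewrite Hset0// cardfs0 mul0r.
rewrite ltnS (cardfsD1 g) gK add1n => Kn.
rewrite -{1}(fsetD1K gK) mulrSr mulrDl mul1r.
have := @Hset_submod _ _ _ _ _ hma m A f fset0 (K `\ g)%fset g hm mf (fsub0set _).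
rewrite Hset0// subr0.
have : Hset act m f (g |` fset0)%fset <= ent m f.
  have <- : ent m (f \o act g) = ent m f.
    by apply: eq_bigr => a _; congr etaR; exact: im.
  apply: ent_le => //; first exact: fmeas_act.
  by move=> x y /= h; apply/name_eqP => g'; rewrite !inE orbF => /eqP ->.
have := IH (K `\ g)%fset Kn; lra.
Qed.

Lemma Hset_pair (m : set X -> R) (A B : finType) (f : X -> A) (g : X -> B) K :
  fap m -> fmeas f -> fmeas g ->
  Hset act m (fun x => (f x, g x)) K <= Hset act m f K + Hset act m g K.
Proof.
move=> hm mf mg; apply: le_trans (ent_pair hm _ _); try exact: name_meas.
apply: ent_le => //; first by apply: fmeas_pair; exact: name_meas.
by move=> x y [/name_eqP h1 /name_eqP h2]; apply/name_eqP => h hK; rewrite h1 ?h2.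
Qed.

Lemma dF_leP K (eps : R) x y : 0 <= eps ->
  reflect (forall g, g \in K -> d (act g x) (act g y) <= eps) (dF d act K x y <= eps).
Proof.
move=> e0; rewrite /dF; apply: (iffP idP) => [h g gK|h]; last first.
  rewrite big_seq; elim/big_rec : _ => // g r gK re.
  by rewrite ge_max h.
apply: le_trans h; move: gK; rewrite -[g \in K]/(g \in enum_fset K).
elim: (enum_fset K) => // k l IH; rewrite inE big_cons le_max => /orP[/eqP ->|/IH ->].
  by rewrite lexx.
by rewrite orbT.
Qed.

Lemma small_partition (eps : R) : 0 < eps -> exists (I : finType) (phi : X -> I),
  fmeas phi /\ forall x y, phi x = phi y -> d x y <= 2 * eps.
Proof.
move=> e0; have [s hs] := finite_net hd hcpt e0.
pose D (i : seq_sub s) := dball d (ssval i) eps.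
have [] := @first_cover _ X _ D.
- by move=> i; apply: (dopen_measurable hborel); exact: dopen_ball.
- by move=> x; have [c cs cx] := hs x; exists (SeqSub cs).
move=> phi [mphi hphi]; exists (seq_sub s), phi; split => // x y xy.
have := hphi x; have := hphi y; rewrite -xy /D /dball /= => hx hy.
have := dtri hd (ssval (phi x)) x y; rewrite (dC hd x (ssval (phi x))); lra.
Qed.

(** A separated set of maximal size spans, and the closed Bowen balls about its points, made
    disjoint, are the cells. *)
Lemma bowen_code K (eps : R) (b : nat) : 0 <= eps ->
  (forall S : {fset X}, Defs.separated d act K eps S -> (#|` S| <= b)%N) ->
  exists (n : nat) (phi : X -> 'I_n.+1), [/\ (n < b)%N, fmeas phi &
    forall x y, phi x = phi y -> forall g, g \in K -> d (act g x) (act g y) <= 2 * eps].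
Proof.
move=> e0 hb.
pose P n := `[< exists2 S : {fset X}, Defs.separated d act K eps S & #|` S| = n >].
have P1 : exists n, P n.
  exists 1%N; apply/asboolP; exists [fset point]%fset; last by rewrite cardfs1.
  by move=> x y; rewrite !inE => /eqP-> /eqP->; rewrite eqxx.
have Pb n : P n -> (n <= b)%N by move=> /asboolP[S /hb] + <-.
case: (ex_maxnP P1 Pb) => N /asboolP[S sS SN] maxN.
have span x : exists c : S, dF d act K (val c) x <= eps.
  apply: contrapT => /forallNP h.
  have xS : x \notin S.
    by apply/negP => xS; apply: (h (FSetSub xS)); apply/dF_leP => // g _; rewrite (dxx hd).
  have : P N.+1.
    apply/asboolP; exists (x |` S)%fset; last by rewrite cardfsU1 xS SN.
    have sym y : dF d act K x y = dF d act K y x by apply: eq_bigr => g _; rewrite (dC hd).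
    move=> y z; rewrite !inE => /orP[/eqP->|yS] /orP[/eqP->|zS]; rewrite ?eqxx// => yz.
    - by rewrite sym ltNge; apply/negP => /(h (FSetSub zS)).
    - by rewrite ltNge; apply/negP => /(h (FSetSub yS)).
    - exact: sS.
  by move=> /maxN; rewrite ltnn.
have [] := @first_cover _ X _ (fun c : S => [set x | dF d act K (val c) x <= eps]).
- move=> c; rewrite (_ : [set _ | _] = \bigcap_(g in [set: K])
     act (val g) @^-1` [set y | d (act (val g) (val c)) y <= eps]).
    apply: fin_bigcap_measurable => // g _; apply: hma.
    by apply: (dclosed_measurable hborel); exact: (dclosed_cball hd).
  apply/seteqP; split => x /=; first by move=> /dF_leP h g _; apply: h => //; exact: valP.
  by move=> h; apply/dF_leP => // g gK; exact: (h (FSetSub gK) Logic.I).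
- exact: span.
move=> phi [mphi hphi].
have S0 : (0 < N)%N by rewrite -SN cardfE; apply/card_gt0P; exists (phi point).
have NS : #|{: S}| = N.-1.+1 by rewrite -cardfE SN prednK.
exists N.-1, (cast_ord NS \o enum_rank \o phi); split.
- by rewrite prednK// -SN; exact: hb.
- exact: fmeas_comp.
- move=> x y /= /cast_ord_inj/enum_rank_inj xy g gK.
  have /(dF_leP _ _ _ e0) hx := hphi x; have /(dF_leP _ _ _ e0) hy := hphi y.
  have := hx g gK; have := hy g gK; rewrite -xy.
  have := dtri hd (act g (val (phi x))) (act g x) (act g y); rewrite (dC hd (act g x) (act g (val (phi x)))).
  lra.
Qed.

Lemma htop_eps_ge0 eps : (0 <= htop_eps d act F eps)%E.
Proof.
apply: le_ereal_inf_tmp => _ [N _ <-]; apply: le_ereal_sup_tmp.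
exists (((#|` F N|%:R)^-1)%:E * eln (sep_num d act (F N) eps))%E; first by exists N => /=.
apply: mule_ge0; first by rewrite lee_fin.
have : (1%:E <= sep_num d act (F N) eps)%E.
  apply: ereal_sup_ubound; exists [fset point]%fset; last by rewrite cardfs1.
  by move=> x y; rewrite !inE => /eqP-> /eqP->; rewrite eqxx.
by case: (sep_num _ _ _ _) => //= r; rewrite !lee_fin => /ln_ge0.
Qed.

Lemma separated_card (eps H : R) : (htop_eps d act F eps <= H%:E)%E ->
  exists n0, forall n, (n0 <= n)%N -> forall S : {fset X},
    Defs.separated d act (F n) eps S -> #|` S|%:R <= expR ((H + 1) * #|` F n|%:R).
Proof.
move=> hH; have : (htop_eps d act F eps < (H + 1)%:E)%E.
  by apply: (le_lt_trans hH); rewrite lte_fin ltrDl.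
move=> /ereal_inf_lt[_ [N _ <-]] h; exists N => n Nn S sS.
have := le_lt_trans (ereal_sup_ubound (ex_intro2 _ _ n Nn erefl)) h.
have : ((#|` S|%:R)%:E <= sep_num d act (F n) eps)%E.
  by apply: ereal_sup_ubound; exists S.
have k0 := folner_card_gt0 hF n.
case: (sep_num _ _ _ _) => [r| |] //=; last first.
  by rewrite gt0_muley// lte_fin invr_gt0.
rewrite lee_fin -EFinM lte_fin => Sr; rewrite ltr_pdivrMl// mulrC => h'.
apply: (le_trans Sr); have [r0|r0] := ltP 0 r; last exact: le_trans r0 (expR_ge0 _).
by rewrite -ler_ln ?posrE ?expR_gt0// expRK ltW.
Qed.

Definition stab_in (ps : seq {fset G}) : set X :=
  [set x | exists2 P, P \in ps & forall g, act g x = x <-> g \in P].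

Let gs n : seq G := pmap choice.unpickle (iota 0 n).

Let mem_gs (T : countType) n (x : T) :
  (x \in pmap choice.unpickle (iota 0 n)) = has (fun i => choice.unpickle i == Some x) (iota 0 n).
Proof.
elim: (iota 0 n) => //= i l IH; case: (choice.unpickle i) => [y|] /=; last by rewrite IH.
by rewrite inE IH eq_sym.
Qed.

Let gs_ex (T : countType) (x : T) : exists n, forall k, (n <= k)%N ->
  x \in pmap choice.unpickle (iota 0 k).
Proof.
exists (choice.pickle x).+1 => k nk; rewrite mem_gs; apply/hasP; exists (choice.pickle x).
  by rewrite mem_iota.
by rewrite choice.pickleK.
Qed.

Let gs_mono (T : countType) n k : (n <= k)%N ->
  {subset (pmap choice.unpickle (iota 0 n) : seq T) <= pmap choice.unpickle (iota 0 k)}.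
Proof.
move=> nk x; rewrite !mem_gs => /hasP[i]; rewrite mem_iota => /andP[_ ik] h.
by apply/hasP; exists i => //; rewrite mem_iota /= (leq_trans ik).
Qed.

Let E_ n : {fset G} := [fset g in gs n]%fset.
Let E_mono n k : (n <= k)%N -> (E_ n `<=` E_ k)%fset.
Proof. by move=> nk; apply/fsubsetP => g; rewrite !inE; exact: gs_mono. Qed.

Let stab_fset (E : {fset G}) (x : X) := [fset g in E | act g x == x]%fset.
Let card_stab E x : #|stab act E x| = #|` stab_fset E x|.
Proof.
apply/eqP; rewrite eqn_leq !cardE -!(size_map val) /=; apply/andP; split.
  apply: uniq_leq_size; first by rewrite map_inj_uniq ?enum_uniq//; exact: val_inj.
  by move=> g /mapP[g']; rewrite mem_enum inE => h ->; rewrite !inE h (valP g').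
apply: uniq_leq_size; first exact: fset_uniq.
move=> g; rewrite !inE => /andP[/= gE h]; apply/mapP; exists (FSetSub gE) => //.
by rewrite mem_enum inE.
Qed.

Let stab_large s : set X := \bigcup_n [set x | (s < #|stab act (E_ n) x|)%N].

Let stab_set_measurable s E : measurable [set x | (s < #|stab act E x|)%N].
Proof.
exact: (fmeas_pred (fun S : {set E} => (s < #|S|)%N) (stab_meas hd hborel hcont (E := E))).
Qed.

Let stab_set_mono s E E' : (E `<=` E')%fset ->
  [set x | (s < #|stab act E x|)%N] `<=` [set x | (s < #|stab act E' x|)%N].
Proof.
move=> /fsubsetP EE x /=; rewrite !card_stab => /leq_trans; apply.
by apply: fsubset_leq_card; apply/fsubsetP => g; rewrite !inE => /andP[/EE -> ->].
Qed.

Lemma stab_in_measurable ps : measurable (stab_in ps).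
Proof.
have -> : stab_in ps = \bigcup_(P in [set` ps]) [set x | forall g, act g x = x <-> g \in P].
  by apply/seteqP; split => x; [case=> P h1 h2; exists P|case=> P h1 h2; exists P].
apply: fin_bigcup_measurable; first exact: finite_seq.
move=> P _; rewrite (_ : [set _ | _] = \bigcap_(g in [set: G])
    (if g \in P then [set x | act g x = x] else ~` [set x | act g x = x])).
  rewrite -[X in measurable X]setCK setC_bigcap; apply: measurableC.
  apply: countable_bigcupT_measurable => // g; apply: measurableC.
  by case: ifP => _; last apply: measurableC; exact: (fixed_measurable hd hborel hcont).
apply/seteqP; split => x /= h g; first by move=> _; case: ifPn => gP; [exact/h|move=> /h; apply/negP].
have := h g Logic.I; case: ifPn => gP /= hg; split => //.
Qed.

(** Almost every stabiliser has at most s elements and so equals its trace on a finite stage of the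
    exhaustion [E_]. As there are countably many finite sets, finitely many of them capture nearly
    all the mass. *)
Lemma stab_in_exists (nu : probability X R) s (eta : R) : 0 < eta ->
  (forall E : {fset G}, pm nu [set x | (s < #|stab act E x|)%N] = 0) ->
  exists ps, pm nu (~` stab_in ps) <= eta.
Proof.
move=> eta0 hs; have hp := fap_pm nu.
pose ps n : seq {fset G} := pmap choice.unpickle (iota 0 n).
have ps_mono n k : (n <= k)%N -> stab_in (ps n) `<=` stab_in (ps k).
  by move=> nk x [P Pn xP]; exists P => //; exact: gs_mono Pn.
have mps n := stab_in_measurable (ps n).
have mU : measurable (\bigcup_n stab_in (ps n)) by exact: bigcupT_measurable.
have mZ : measurable (stab_large s) by exact: bigcupT_measurable.
have Z0 : pm nu (stab_large s) = 0.
  have := @pm_bigcup_cvg _ _ _ nu (fun n => [set x | (s < #|stab act (E_ n) x|)%N])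
    (fun n => @stab_set_measurable s _) (fun n k nk => stab_set_mono (E_mono nk)).
  under eq_fun do rewrite hs.
  by move=> /(cvg_unique (@Rhausdorff R)) /(_ (cvg_cst _)) ->.
have U1 : 1 <= pm nu (\bigcup_n stab_in (ps n)).
  rewrite -[leLHS]subr0 -Z0 -(fapC hp mZ); apply: fap_le => //; first exact: measurableC.
  move=> x nZ.
  have le_s n : (#|` stab_fset (E_ n) x| <= s)%N.
    by rewrite -card_stab leqNgt; apply/negP => h; apply: nZ; exists n.
  (* A trace of maximal cardinality cannot grow at later stages, so it is the whole stabiliser. *)
  pose P m := `[< exists n, #|` stab_fset (E_ n) x| = m >].
  have P1 : exists m, P m by exists #|` stab_fset (E_ 0) x|; apply/asboolP; exists 0%N.
  have Ps m : P m -> (m <= s)%N by move=> /asboolP[n <-].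
  case: (ex_maxnP P1 Ps) => m /asboolP[n0 n0m] maxm.
  have [k hk] := gs_ex (stab_fset (E_ n0) x); exists k => //.
  exists (stab_fset (E_ n0) x); first exact: hk.
  move=> g; rewrite !inE; split => [gx|/andP[_ /eqP//]].
  have [n hn] := gs_ex g; pose n1 := maxn n n0.
  have : stab_fset (E_ n0) x = stab_fset (E_ n1) x.
    apply/eqP; rewrite eqEfcard; apply/andP; split.
      apply/fsubsetP => h; rewrite !inE => /andP[h1 ->]; rewrite andbT.
      by have /fsubsetP := E_mono (leq_maxr n n0); move=> /(_ h); rewrite !inE; apply.
    by rewrite n0m; apply: maxm; apply/asboolP; exists n1.
  move=> /fsetP/(_ g); rewrite !inE gx eqxx !andbT => ->.
  by apply: hn; exact: leq_maxl.
have := @pm_bigcup_cvg _ _ _ nu _ mps ps_mono; move=> /cvgrPdist_le /(_ _ eta0) h.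
have [n] := filter_ex h; rewrite /= => hn; exists (ps n).
rewrite fapC//; move: hn; rewrite ler_norml => /andP[_]; lra.
Qed.

(** Conjugation by g carries the stabiliser of x to that of g x and preserves cardinalities. *)
Lemma stab_large_invariant s : invariant_set act (stab_large s).
Proof.
have sub g : act g @^-1` stab_large s `<=` stab_large s.
  move=> x [n _ /=]; rewrite card_stab => hn.
  pose A := [fset mul (inv g) (mul h g) | h in stab_fset (E_ n) (act g x)]%fset.
  have cA : #|` A| = #|` stab_fset (E_ n) (act g x)|.
    by rewrite card_imfset//= => h h' /(gmulI hG)/(gmulIr hG).
  have [k hk] : exists k, forall h, h \in A -> h \in E_ k.
    elim/finSet_rect: A {cA} => B IH.
    have [->|[b bB]] := fset_0Vmem B; first by exists 0%N.
    have [k hk] := IH _ (fproperD1 bB); have [j hj] := gs_ex b.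
    exists (maxn k j) => h hB; have [->|hb] := eqVneq h b.
      by rewrite inE /=; apply: hj; exact: leq_maxr.
    have /fsubsetP := E_mono (leq_maxl k j); apply; apply: hk.
    by rewrite !inE hb.
  exists k => //=; rewrite card_stab (leq_trans hn)// -cA; apply: fsubset_leq_card.
  apply/fsubsetP => h hA; rewrite !inE; have := hk _ hA; rewrite !inE /= => -> /=.
  move: hA => /imfsetP[h' /=]; rewrite !inE => /andP[_ /eqP h'x] ->.
  by rewrite !(actM hact) h'x (actK hG hact).
move=> g; apply/seteqP; split; first exact: sub.
move=> x Zx; apply: (sub (inv g)).
by rewrite /preimage /= (actK hG hact).
Qed.

(** The set of points with more than s stabilising elements is invariant, so by ergodicity it is
    null for some s or of full mass for every s. *)
Lemma stab_dichotomy (nu : probability X R) : ergodic act nu ->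
  (exists s, forall E : {fset G}, pm nu [set x | (s < #|stab act E x|)%N] = 0) \/
  (forall (N : nat) (e : R), 0 < e ->
     exists E : {fset G}, 1 - e <= pm nu [set x | (N <= #|stab act E x|)%N]).
Proof.
move=> [inu enu]; have hp := fap_pm nu.
have mZ s : measurable (stab_large s) by exact: bigcupT_measurable.
have [[s Z0]|h] := pselect (exists s, pm nu (stab_large s) = 0).
  left; exists s => E; apply/eqP; rewrite eq_le (fap_ge0 hp)// andbT -Z0.
  apply: fap_le => //.
  have [k hk] : exists k, (E `<=` E_ k)%fset.
    elim/finSet_rect: E => B IH.
    have [->|[b bB]] := fset_0Vmem B; first by exists 0%N; exact: fsub0set.
    have [k hk] := IH _ (fproperD1 bB); have [j hj] := gs_ex b.
    exists (maxn k j); apply/fsubsetP => g gB; have [->|gb] := eqVneq g b.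
      by rewrite inE /=; apply: hj; exact: leq_maxr.
    have /fsubsetP := E_mono (leq_maxl k j); apply; apply: (fsubsetP hk).
    by rewrite !inE gb.
  by move=> x Ex; exists k => //; exact: stab_set_mono hk _ Ex.
right => N e e0.
have Z1 : pm nu (stab_large N) = 1.
  have [z|z] := enu _ (mZ N) (@stab_large_invariant N); last by rewrite /pm z.
  by exfalso; apply: h; exists N; rewrite /pm z.
have := @pm_bigcup_cvg _ _ _ nu (fun n => [set x | (N < #|stab act (E_ n) x|)%N])
  (fun n => @stab_set_measurable N _) (fun n k nk => stab_set_mono (E_mono nk)).
rewrite Z1 => /cvgrPdist_le /(_ _ e0) he; have [n] := filter_ex he; rewrite /= => hn.
exists (E_ n); move: hn; rewrite ler_norml => /andP[_ hn].
apply: (@le_trans _ _ (pm nu [set x | (N < #|stab act (E_ n) x|)%N])); first by lra.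
apply: fap_le => //; last by move=> x /=; exact: ltnW.
exact: (fmeas_pred (fun S : {set E_ n} => (N <= #|S|)%N) (stab_meas hd hborel hcont (E := E_ n))).
Qed.
End UpperBound.

(** * Bounds on the epsilon-entropy of ergodic measures *)

Section UpperBoundErgodic.
Context (R : realType) (G : countType) (mul : G -> G -> G) (one : G) (inv : G -> G).
Context (hG : is_group mul one inv) (hinf : ~ finite_set [set: G]).
Context (dsp : measure_display) (X : measurableType dsp).
Context (d : X -> X -> R) (hd : is_metric d) (hcpt : dcompact d).
Context (hborel : @measurable dsp X = <<s [set U | dopen d U] >>).
Context (act : G -> X -> X) (hact : is_action mul one act).
Context (hcont : forall g, dcontinuous d d (act g)).
Context (F : nat -> {fset G}) (hF : Folner R mul F).

Let hma := hmact hborel hcont.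

Lemma mulset_mulset A B C : mulset mul A (mulset mul B C) = mulset mul (mulset mul A B) C.
Proof.
have [mA _ _ _ _] := hG.
apply/fsetP => g; apply/idP/idP.
  move=> /mulsetP[a [_ [aA /mulsetP[b [c [bB cC ->]]] ->]]].
  by rewrite mA; apply: mem_mulset => //; exact: mem_mulset.
move=> /mulsetP[_ [c [/mulsetP[a [b [aA bB ->]]] cC ->]]].
by rewrite -mA; apply: mem_mulset => //; exact: mem_mulset.
Qed.

Lemma pow_small (r e : R) : 0 < r < 1 -> 0 < e -> exists k, r ^+ k <= e.
Proof.
move=> /andP[r0 r1] e0.
have : (fun n => r ^+ n) @ \oo --> (0 : R) by apply: cvg_expr; rewrite ger0_norm// ltW.
move=> /cvgrPdist_le /(_ _ e0) h; have [k] := filter_ex h.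
by rewrite /= sub0r normrN ger0_norm ?exprn_ge0 ?(ltW r0)// => ?; exists k.
Qed.

Lemma ln2_le1 : ln 2 <= (1 : R).
Proof. by have /le_ln1Dx : -1 < (1 : R) by lra. Qed.

(** The weight e^(-(H + 2 + ln 2)|T|) outweighs e^((H + 1)|T|) Bowen cells and 2^|T| subsets by a
    factor e^(-|T|) <= e^(-k), and at most k shapes contribute k e^(-k) <= 1. *)
Lemma tile_weight (SS : seq {fset G}) (Nn : {fset G} -> nat) (H : R) (k : nat) :
  (size SS <= k)%N -> uniq SS ->
  (forall T, T \in SS -> (k <= #|` T|)%N /\ (Nn T)%:R <= expR ((H + 1) * #|` T|%:R)) ->
  \sum_(T : seq_sub SS) (Nn (ssval T))%:R * 2 ^+ #|` ssval T| *
    expR (- ((H + 2 + ln 2) * #|` ssval T|%:R)) <= 1.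
Proof.
move=> sk uS h; apply: (@le_trans _ _ (\sum_(T : seq_sub SS) expR (- k%:R))).
  apply: ler_sum => T _; have [kT NT] := h _ (ssvalP T).
  apply: (@le_trans _ _ (expR ((H + 1) * #|` ssval T|%:R) * expR (ln 2 * #|` ssval T|%:R) *
      expR (- ((H + 2 + ln 2) * #|` ssval T|%:R)))).
    rewrite ler_wpM2r ?expR_ge0// ler_pM//.
    by rewrite mulrC mulr_natl -lnXn ?lnK// posrE exprn_gt0.
  rewrite -!expRD ler_expR.
  have : k%:R <= (#|` ssval T|%:R : R) by rewrite ler_nat.
  by lra.
rewrite sumr_const card_seq_sub// -[leLHS]mulr_natl expRN.
rewrite ler_pdivrMr ?expR_gt0// mul1r.
apply: (@le_trans _ _ (k%:R)); first by rewrite ler_nat.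
by have := @expR_ge1Dx R k%:R; lra.
Qed.

(** A cell is given by a tile label or, on the uncovered remainder, by a fixed partition [phi].
    Equal labels mean the same position t in T and centres in one Bowen cell along T, hence points
    within 2 eps. *)
Lemma finite_stab_entropy (nu : probability X R) (s : nat) (eps H : R) :
  invariant_measure act nu ->
  (forall E : {fset G}, pm nu [set x | (s < #|stab act E x|)%N] = 0) ->
  0 < eps -> (htop_eps d act F eps <= H%:E)%E ->
  exists (A : finType) (f : X -> A), [/\ fmeas f,
    forall x y, f x = f y -> d x y <= 2 * eps & hset act (pm nu) f <= H + 11].
Proof.
move=> inu hs e0 hH; have hp := fap_pm nu; have ip := invariant_pm inu.
have H0 : 0 <= H by rewrite -lee_fin; apply: le_trans hH; exact: htop_eps_ge0.
have l2 : 0 <= (ln 2 : R) by rewrite ln_ge0// ler1n.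
have l2' := ln2_le1.
pose a := H + 2 + ln 2; have a0 : 0 <= a by rewrite /a; lra.
(* Chosen so that a (1 + delta) / (1 - delta) <= a + 2. *)
pose delta := (a + 2)^-1.
have a2 : 0 < a + 2 by lra.
have delta0 : 0 < delta by rewrite invr_gt0.
have da : delta * (a + 1) <= 1 by rewrite mulrC ler_pdivrMr// mul1r; lra.
have delta1 : delta < 1 by rewrite invf_lt1//; lra.
have d1 : 0 < 1 - delta by lra.
have [I [phi [mphi hphi]]] := small_partition hd hcpt hborel e0.
pose lm : R := ln #|{: option I}|%:R.
have lm0 : 0 <= lm by rewrite ln_ge0// ler1n; apply/card_gt0P; exists None.
(* The uncovered mass will be at most 2 kap, so coding [phi] on it costs at most 2 kap lm <= 1,
   apart from a term ln 2. *)
pose kap := (2 * (lm + 1))^-1.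
have lm1 : 0 < lm + 1 by lra.
have kap0 : 0 < kap by rewrite invr_gt0 mulr_gt0.
have kapl : kap * lm <= 1 / 2.
  by rewrite mulrC ler_pdivrMr ?mulr_gt0//; lra.
(* k serves twice: it makes (1 - delta)^k small, and below it is a lower bound for the size of the
   shapes, as [tile_weight] requires. *)
have [|k hk] := @pow_small (1 - delta) kap _ kap0; first by apply/andP; split; lra.
have [n1 hn1] := separated_card hF hH.
have [n0 _ hn0] : \forall n \near \oo, (n1 <= n)%N /\ (k <= #|` F n|)%N.
  exact: (filterI (nbhs_infty_ge n1) (folner_card_large hG hinf hF k)).
have [L [S [wL sS LS hS muL]]] := quasi_tiling hG hd hcpt hborel hact hcont hF inu delta0 delta1 hs k fset0 n0 kap0.
pose SS := undup S.
have LSS T : T \in unzip1 L -> T \in SS by rewrite mem_undup; exact: LS.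
have code T : exists (p : {n : nat & X -> 'I_n.+1}), fmeas (projT2 p) /\ (T \in SS ->
    ((projT1 p).+1)%:R <= expR ((H + 1) * #|` T|%:R) /\
    forall x y, projT2 p x = projT2 p y -> forall g, g \in T -> d (act g x) (act g y) <= 2 * eps).
  have [TS|nT] := boolP (T \in SS); last first.
    exists (existT (fun n => X -> 'I_n.+1) 0%N (fun=> ord0)); split => // i /=.
    by rewrite preimage_cst; case: ifP.
  move: TS; rewrite mem_undup => /hS[[n nn0 ->] _].
  have b0 : 0 <= expR ((H + 1) * #|` F n|%:R) by exact: expR_ge0.
  have [] := @bowen_code _ _ _ _ _ hd hborel _ hcont (F n) eps (Num.truncn (expR ((H + 1) * #|` F n|%:R))) (ltW e0).
    move=> S' sS'; rewrite truncn_ge_nat//; apply: hn1 sS'.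
    by have [] := hn0 _ nn0.
  move=> N [psi [Nb mpsi hpsi]]; exists (existT (fun n => X -> 'I_n.+1) N psi); split => //= _; split.
    by rewrite -truncn_ge_nat.
  exact: hpsi.
have [p hpc] := choice code.
pose Nn T := (projT1 (p T)).+1.
pose N := \max_(T <- SS) projT1 (p T).
pose cd T x : 'I_N.+1 := inord (val (projT2 (p T) x)).
have NN T : T \in SS -> (projT1 (p T) <= N)%N by move=> TS; exact: leq_bigmax_seq.
have mcd T : fmeas (cd T) by apply: (fmeas_comp (f := projT2 (p T)) (fun i => inord (val i))); case: (hpc T).
have cdE T x : T \in SS -> val (cd T x) = val (projT2 (p T) x).
  by move=> TS; apply: inordK; rewrite ltnS (leq_trans _ (NN T TS))// -ltnS ltn_ord.
have cdN T x : T \in SS -> (cd T x < Nn T)%N by move=> TS; rewrite (cdE T x TS); exact: ltn_ord.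
pose D := (\bigcup_(T <- SS) T)%fset.
have SD T : T \in SS -> (T `<=` D)%fset.
  by move=> TS; exact: bigfcup_sup.
have aN : \sum_(T : seq_sub SS) (Nn (ssval T))%:R * 2 ^+ #|` ssval T| *
    expR (- (a * #|` ssval T|%:R)) <= 1.
  apply: tile_weight; first exact: leq_trans (size_undup _) sS.
    exact: undup_uniq.
  move=> T TS; split; last by case: (hpc T) => _ /(_ TS) [].
  by move: TS; rewrite mem_undup => /hS[[n nn0 ->] _]; have [] := hn0 _ nn0.
pose lab := tile_label inv act L SS D cd.
have mlab : fmeas lab by exact: (tile_label_meas hborel hcont wL).
(* Constant on labelled points, so that only the small uncovered part contributes to its entropy
   beyond ln 2. *)
pose g x := if lab x is None then Some (phi x) else None.
have mg : fmeas g.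
  exact: (fmeas_comp (f := fun x => (lab x, phi x))
    (fun q => if q.1 is None then Some q.2 else None) (fmeas_pair mlab mphi)).
exists _, (fun x => (lab x, g x)); split; first exact: fmeas_pair.
  move=> x y [lxy gxy]; case E: (lab x) => [q|]; last first.
    by move: gxy; rewrite /g -lxy E => -[]; exact: hphi.
  have := tile_label_some E; have := tile_label_some (etrans (esym lxy) E).
  case: q {E} => [[[T TS] t] i] /andP[/eqP /= oy /eqP iy] /andP[/eqP /= ox /eqP ix].
  have [_ tT] := owner_mem ox.
  have [_ /(_ TS) [_ hT]] := hpc T.
  have : projT2 (p T) (act (inv (val t)) x) = projT2 (p T) (act (inv (val t)) y).
    by apply: val_inj; rewrite -!cdE// ix iy.
  by move=> /hT /(_ _ tT); rewrite !(actVK hG hact).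
have entg : ent (pm nu) g <= ln 2 + 1.
  have := ent_support [set None]%SET hp mg; rewrite cards1 ln1 addr0 => h.
  apply: (le_trans h); rewrite lerD2l.
  have mGN : measurable [set x | g x \notin [set None]%SET].
    exact: (fmeas_pred (fun q => q \notin [set None]%SET) mg).
  apply: (@le_trans _ _ ((kap + kap) * lm)); last by lra.
  rewrite ler_wpM2r//; apply: (@le_trans _ _ (pm nu (~` cov inv act L))); last first.
    by apply: (le_trans muL); rewrite lerD2r.
  apply: fap_le => //; first by apply: measurableC; exact: (cov_measurable hborel hcont wL).
  move=> x /=; rewrite finset.inE /g; case E: (lab x) => [q|]; first by rewrite eqxx.
  by move=> _; exact: (tile_label_none LSS SD E).
pose lL : R := ln #|{: option (seq_sub SS * D * 'I_N.+1)}|%:R.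
have lL0 : 0 <= lL by rewrite ln_ge0// ler1n; apply/card_gt0P; exists None.
have lL1 : 0 < lL + 1 by lra.
have eta0 : 0 < (lL + 1)^-1 by rewrite invr_gt0.
have [ps hps] := stab_in_exists hd hborel hcont eta0 hs.
pose lQ : R := ln 2 + ln #|{: option (seq_sub ps)}|%:R.
(* F_n has to absorb the constant [lQ] of the stabiliser list and be almost invariant under D^-1 and
   D D^-1. *)
have [n [h1 [h2 h3]]] : exists n, [/\ lQ <= #|` F n|%:R,
   #|` mulset mul (mulset mul D (invset inv D)) (F n)|%:R <= (1 + delta) * #|` F n|%:R &
   #|` mulset mul (invset inv D) (F n)|%:R <= (1 + delta) * #|` F n|%:R].
  have [n [h1 [h2 h3]]] := filter_ex (filterI (folner_card_large hG hinf hF (Num.truncn `|lQ|).+1)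
    (filterI (folner_mulset_card hF (mulset mul D (invset inv D)) delta0)
      (folner_mulset_card hF (invset inv D) delta0))).
  exists n; split => //; apply: (@le_trans _ _ (Num.truncn `|lQ|).+1%:R); last by rewrite ler_nat.
  by apply: (le_trans (ler_norm _)); apply: ltW; exact: truncnS_gt.
have k0 := folner_card_gt0 hF n.
rewrite -(ler_pM2r k0); apply: (le_trans (hset_le hma _ hp (fmeas_pair mlab mg))).
apply: (le_trans (Hset_pair hborel hcont _ hp mlab mg)).
have := @tile_name_entropy _ _ _ _ _ hG _ _ _ hact _ hborel hcont _ delta1 _ wL _ _ SD _ _ mcd _ cdN (F n) _ a0 aN _ ps hp (stab_in_measurable hd hborel hcont ps).
rewrite -/lQ -/lL -/(stab_in act ps) mulset_mulset -/lab.
have := Hset_le_ent hborel hcont (F n) hp ip mg.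
set K2 := #|` mulset mul (mulset _ _ _) _|%:R in h2 *; set K1 := #|` mulset _ _ _|%:R in h3 *.
set K := #|` F n|%:R in k0 h1 h2 h3 *.
have b1 : K * ent (pm nu) g <= K * (ln 2 + 1) by rewrite ler_pM2l.
have b2 : pm nu (~` stab_in act ps) * (K * lL) <= K.
  apply: (@le_trans _ _ ((lL + 1)^-1 * (K * lL))).
    by rewrite ler_wpM2r// mulr_ge0// ltW.
  rewrite mulrC ler_pdivrMr// ler_pM2l//; lra.
have b3 : a * (K2 / (1 - delta)) <= (a + 2) * K.
  rewrite mulrA ler_pdivrMr//.
  have : a * K2 <= a * ((1 + delta) * K) by rewrite ler_wpM2l.
  have : delta * (a + 1) * K <= 1 * K by rewrite ler_pM2r.
  lra.
have b4 : delta * K <= 1 * K by rewrite ler_pM2r// ltW.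
have b5 : ln 2 * K <= 1 * K by rewrite ler_pM2r.
have b6 : (a + 2) * K = H * K + 4 * K + ln 2 * K by rewrite /a; ring.
(* Per element of F_n: H + 5 from the weights, 1 from the stabiliser list, 2 from K', 1 from
   unlisted stabilisers and 2 from [g]; together H + 11. *)
move: h1 h3 b1 b2 b3 b4 b5; rewrite b6; lra.
Qed.

Lemma h_eps_le (nu : probability X R) (A : finType) (f : X -> A) (eps : R) :
  invariant_measure act nu -> fmeas f -> (forall x y, f x = f y -> d x y <= eps) ->
  (h_eps d act F nu eps <= (hset act (pm nu) f)%:E)%E.
Proof.
move=> inu mf hf; pose f' := enum_rank \o f.
have mf' : fmeas f' by exact: fmeas_comp.
apply: ge_ereal_inf; exists (hpart act F nu (fun i => f' @^-1` [set i]))%:E.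
  exists (existT (fun m => 'I_m -> set X) #|A| (fun i => f' @^-1` [set i])) => //=; split.
    exact: fun_partition.
  by move=> i x y /= <- /enum_rank_inj xy; apply: hf.
have hp := fap_pm nu; rewrite lee_fin (hpartE hG hF hact hma inu mf')//.
apply: (hset_ge hF) => K _; apply: (le_trans (hset_le hma K hp mf')).
apply: ent_le => //; first exact: (name_meas hma).
by move=> x y /name_eqP h; apply/name_eqP => g gK; rewrite /f' /= h.
Qed.

(* The value 11 is irrelevant: it disappears after division by ln (1 / eps). *)
Lemma h_eps_upper (nu : probability X R) (eps : R) : ergodic act nu -> 0 < eps ->
  (h_eps d act F nu eps <= htop_eps d act F (eps / 2) + 11%:E)%E.
Proof.
move=> enu e0; have [inu _] := enu; have e2 : 0 < eps / 2 by lra.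
have := htop_eps_ge0 d act F (eps / 2).
case E: (htop_eps _ _ _ _) => [H| |]// H0; last by rewrite leey.
have hH : (htop_eps d act F (eps / 2) <= H%:E)%E by rewrite E.
have E2 : 2 * (eps / 2) = eps by lra.
have [[s hs]|h] := stab_dichotomy hG hd hborel hact hcont enu.
  have [A [f [mf hf hs']]] := finite_stab_entropy inu hs e2 hH; rewrite E2 in hf.
  by apply: (le_trans (h_eps_le inu mf hf)); rewrite lee_fin.
have [A [f [mf hf]]] := small_partition hd hcpt hborel e2; rewrite E2 in hf.
apply: (le_trans (h_eps_le inu mf hf)).
have := hset_infinite_stab hG hinf hd hborel hact hcont hF inu mf h.
by rewrite -EFinD !lee_fin; move: H0; rewrite lee_fin; lra.
Qed.

Lemma h_eps_ge_good (nu : probability X R) (eps c e' : R) : invariant_measure act nu ->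
  good d act eps c (pm nu) -> e' < eps -> (c%:E <= h_eps d act F nu e')%E.
Proof.
move=> inu hg ee; apply: le_ereal_inf_tmp => _ [[m P] /= [hP dP] <-].
have [f [mf fP]] := partition_fun hP.
rewrite lee_fin (hpartE hG hF hact hma inu mf fP).
apply: (hset_ge hF) => K _; apply: hg => //; exists e'; split => // x y xy.
by apply: (dP (f x)); rewrite -fP.
Qed.
End UpperBoundErgodic.

(** * Weak convergence *)

Section WeakConvergence.
Context (R : realType) (dsp : measure_display) (X : measurableType dsp).
Context (d : X -> X -> R) (hd : is_metric d) (hcpt : dcompact d).
Context (hborel : @measurable dsp X = <<s [set U | dopen d U] >>).
Local Notation cont := (dcontinuous d (@realdist R)).

Lemma cont_open_gt f a : cont f -> dopen d [set x | a < f x].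
Proof.
move=> cf x /= ax; have [|r [r0 hr]] := cf x (f x - a); first by rewrite subr_gt0.
exists r; split => // y /hr; rewrite /realdist /= => h.
by have := ler_norm (f x - f y); lra.
Qed.

Lemma cont_opp f : cont f -> cont (fun x => - f x).
Proof.
move=> cf x e /(cf x e)[r [r0 hr]]; exists r; split => // y /hr.
by rewrite /realdist -opprD normrN.
Qed.

Lemma cont_bounded f : cont f -> exists B, 0 < B /\ forall x, `|f x| <= B.
Proof.
move=> cf; pose r x := projT1 (cid (cf x 1 ltr01)).
have r0 x : 0 < r x by rewrite /r; case: cid => ? [].
have [//|s [_ hs]] := @metric_compact_cover _ _ _ hd hcpt setT r (dclosedT d).
have [B hB] : exists B, forall c, c \in s -> `|f c| <= B.
  elim: (s) => [|c l [B hB]]; first by exists 0.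
  exists (Num.max `|f c| B) => c'; rewrite inE le_max => /orP[/eqP->|/hB ->].
    by rewrite lexx.
  by rewrite orbT.
exists (Num.max 1 (B + 1)); split; first by rewrite lt_max ltr01.
move=> x; have [c cs cx] := hs x Logic.I; rewrite le_max; apply/orP; right.
have : `|f c - f x| < 1 by move: cx; rewrite /r; case: cid => ? [_ /= h] /h.
have := hB c cs; have := ler_normD (f c) (f x - f c); rewrite subrKC (distrC (f x)); lra.
Qed.

Lemma cont_measurable f : cont f -> measurable_fun setT (f : X -> R).
Proof.
move=> cf; apply: (measurability _ (RGenOInfty.measurableE R)) => //.
move=> _ [_ [a ->] <-]; rewrite setTI; apply: (dopen_measurable hborel).
rewrite (_ : _ @^-1` _ = [set x | a < f x]); first exact: cont_open_gt.
by apply/seteqP; split => x /=; rewrite in_itv /= andbT.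
Qed.

Definition mean (nu : probability X R) (f : X -> R) : R := fine (\int[nu]_x (f x)%:E)%E.

Lemma cont_integrable (nu : probability X R) f : cont f -> nu.-integrable setT (EFin \o f).
Proof.
move=> cf; have [B [B0 hB]] := cont_bounded cf.
apply: (@le_integrable _ _ _ _ _ _ _ (EFin \o cst B)) => //.
- by apply/measurable_EFinP; exact: cont_measurable.
- by move=> x _ /=; rewrite lee_fin (ger0_norm (ltW B0)).
- exact: finite_measure_integrable_cst.
Qed.

Lemma meanE (nu : probability X R) f : cont f -> (\int[nu]_x (f x)%:E = (mean nu f)%:E)%E.
Proof. by move=> cf; rewrite /mean fineK//; exact: integrable_fin_num (cont_integrable nu cf). Qed.

Lemma mean_opp (nu : probability X R) f : cont f -> mean nu (fun x => - f x) = - mean nu f.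
Proof.
move=> cf; rewrite {1}/mean; under eq_integral do rewrite -mulN1r EFinM.
by rewrite (integralZl measurableT (cont_integrable nu cf))/= meanE// -EFinM mulN1r.
Qed.

Lemma mean_cst (nu : probability X R) (c : R) : (\int[nu]__ c%:E = c%:E)%E.
Proof.
rewrite integral_cst//.
by rewrite [X in (_ * X)%E](@probability_setT _ _ _ nu) mule1.
Qed.

(* Layer-cake approximation of the mean of [f + B] with step [eta]. *)
Let cake (nu : probability X R) f B eta n : R :=
  \sum_(i < n) eta * pm nu [set x | i.+1%:R * eta < f x + B].

Lemma mean_cake (nu : probability X R) f B eta n : cont f -> 0 < eta ->
  (forall x, `|f x| <= B) -> 2 * B <= n%:R * eta ->
  cake nu f B eta n - B <= mean nu f <= cake nu f B eta n + eta - B.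
Proof.
move=> cf eta0 fB Bn; have intf := cont_integrable nu cf.
have g0 x : 0 <= f x + B by have := fB x; rewrite ler_norml => /andP[]; lra.
have gM x : f x + B <= n%:R * eta by have := fB x; rewrite ler_norml => /andP[]; lra.
pose A (i : 'I_n) := [set x | i.+1%:R * eta < f x + B].
have mA i : measurable (A i).
  apply: (dopen_measurable hborel); rewrite (_ : A i = [set x | i.+1%:R * eta - B < f x]).
    exact: cont_open_gt.
  by apply/seteqP; split => x; rewrite /A /= ltrBlDr.
pose st x : R := \sum_(i < n) eta * \1_(A i) x.
have step (k : nat) (t : R) : 0 <= t -> t <= k%:R * eta ->
    \sum_(i < k) eta * ((i.+1%:R * eta < t)%R)%:R <= t <= \sum_(i < k) eta * ((i.+1%:R * eta < t)%R)%:R + eta.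
  elim: k t => [|k IH] t t0 tk.
    by rewrite big_ord0; move: tk; rewrite mul0r => tk; apply/andP; split; lra.
  have [te|te] := leP t eta.
    rewrite big1 ?add0r ?t0// => i _; rewrite ltNge (le_trans te) ?mulr0//.
    by rewrite ler_peMl ?(ltW eta0)// ler1n.
  rewrite big_ord_recl mul1r te mulr1.
  have t0' : 0 <= t - eta by lra.
  have tk' : t - eta <= k%:R * eta by move: tk; rewrite -natr1; lra.
  have /andP[] := IH _ t0' tk'.
  rewrite (eq_bigr (fun i : 'I_k => eta * (((lift ord0 i).+1%:R * eta < t)%R)%:R)); last first.
    by move=> i _; rewrite ltrBrDr -[X in _ + X < _]mul1r -mulrDl natr1.
  by move=> h1 h2; apply/andP; split; lra.
have stE x : st x = \sum_(i < n) eta * ((i.+1%:R * eta < f x + B)%R)%:R.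
  by apply: eq_bigr => i _; rewrite indicE; congr (_ * (nat_of_bool _)%:R); apply/idP/idP => [/set_mem|/mem_set].
have mst : measurable_fun setT st.
  by apply: measurable_sum => i; apply: measurable_funM => //; exact: measurable_indic.
have st0 x : 0 <= st x by apply: sumr_ge0 => i _; rewrite mulr_ge0// ltW.
have ist : (\int[nu]_x (st x)%:E = (cake nu f B eta n)%:E)%E.
  rewrite /st /cake; under eq_integral do rewrite -sumEFin.
  rewrite ge0_integral_sum//; last 2 first.
  - move=> i; apply/measurable_EFinP; apply: measurable_funM => //; exact: measurable_indic.
  - by move=> i x _; rewrite lee_fin mulr_ge0// ltW.
  rewrite -sumEFin; apply: eq_bigr => i _.
  under eq_integral do rewrite EFinM.
  rewrite ge0_integralZl//; last by rewrite lee_fin ltW.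
    have -> : (\int[nu]_x (\1_(A i) x)%:E = (pm nu (A i))%:E)%E.
      by rewrite integral_indic// setIT; exact: pmE.
    by rewrite -EFinM.
  by apply/measurable_EFinP; exact: measurable_indic.
have mg : measurable_fun setT (fun x => f x + B).
  by apply: measurable_funD => //; exact: cont_measurable.
have ig : (\int[nu]_x (f x + B)%:E = (mean nu f + B)%:E)%E.
  under eq_integral do rewrite EFinD.
  rewrite integralD//=; last exact: finite_measure_integrable_cst.
  by rewrite meanE// mean_cst.
have lo : (\int[nu]_x (st x)%:E <= \int[nu]_x (f x + B)%:E)%E.
  apply: ge0_le_integral => //.
  - by move=> x _; rewrite lee_fin.
  - exact/measurable_EFinP.
  - exact/measurable_EFinP.
  - by move=> x _; rewrite lee_fin stE; have /andP[] := step n _ (g0 x) (gM x).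
have hi : (\int[nu]_x (f x + B)%:E <= \int[nu]_x ((st x)%:E + eta%:E))%E.
  apply: ge0_le_integral => //.
  - by move=> x _; rewrite lee_fin.
  - exact/measurable_EFinP.
  - by apply: emeasurable_funD => //; exact/measurable_EFinP.
  - by move=> x _; rewrite -EFinD lee_fin stE; have /andP[] := step n _ (g0 x) (gM x).
move: hi lo; rewrite ge0_integralD//; last 3 first.
- by move=> x _; rewrite lee_fin.
- exact/measurable_EFinP.
- by move=> x _; rewrite lee_fin ltW.
rewrite mean_cst ist ig -EFinD !lee_fin => h1 h2.
by apply/andP; split; lra.
Qed.

(** Lower semicontinuity on open sets is applied to the finitely many superlevel sets of the
    layer-cake sum. *)
Lemma mean_lsc (nus : nat -> probability X R) mu f e : cont f -> 0 < e ->
  (forall V a, dopen d V -> 0 < a -> \forall n \near \oo, pm mu V - a <= pm (nus n) V) ->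
  \forall n \near \oo, mean mu f - e <= mean (nus n) f.
Proof.
move=> cf e0 h; have [B [B0 fB]] := cont_bounded cf.
pose eta := e / 2; have eta0 : 0 < eta by rewrite /eta; lra.
pose k := (Num.truncn (2 * B / eta)).+1.
have Bk : 2 * B <= k%:R * eta by rewrite -ler_pdivrMr// ltW// truncnS_gt.
pose V (i : 'I_k) := [set x | i.+1%:R * eta < f x + B].
have oV i : dopen d (V i).
  rewrite (_ : V i = [set x | i.+1%:R * eta - B < f x]); first exact: cont_open_gt.
  by apply/seteqP; split => x; rewrite /V /= ltrBlDr.
have k0 : 0 < (k%:R : R) by rewrite ltr0n.
have near_all : \forall n \near \oo, forall i, pm mu (V i) - k%:R^-1 <= pm (nus n) (V i).
  by apply: filter_forall => i; apply: h => //; rewrite invr_gt0.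
apply: filterS near_all => n hn.
have /andP[_ h1] := mean_cake mu cf eta0 fB Bk.
have /andP[h2 _] := mean_cake (nus n) cf eta0 fB Bk.
have : cake mu f B eta k - eta <= cake (nus n) f B eta k.
  apply: (@le_trans _ _ (\sum_(i < k) eta * (pm mu (V i) - k%:R^-1))).
    under [leRHS]eq_bigr do rewrite mulrBr.
    rewrite sumrB sumr_const card_ord -[X in _ <= _ - X]mulr_natl mulrCA divff ?mulr1//.
    by rewrite lt0r_neq0.
  by apply: ler_sum => i _; rewrite ler_pM2l.
rewrite /eta in h1 h2 *; lra.
Qed.

(** Lower semicontinuity of the mean, used for f and for -f. *)
Lemma weak_limit (nus : nat -> probability X R) mu f : cont f ->
  (forall V a, dopen d V -> 0 < a -> \forall n \near \oo, pm mu V - a <= pm (nus n) V) ->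
  (fun n => \int[nus n]_x (f x)%:E)%E @ \oo --> (\int[mu]_x (f x)%:E)%E.
Proof.
move=> cf h; under eq_fun do rewrite meanE//; rewrite meanE//.
apply/fine_cvgP; split; first by apply: nearW => n.
apply/cvgrPdist_le => e e0.
have h1 := mean_lsc cf e0 h; have := mean_lsc (cont_opp cf) e0 h.
apply: filterS2 h1 => n /= h1; rewrite !mean_opp// => h2.
by rewrite ler_norml; apply/andP; split; lra.
Qed.
End WeakConvergence.

Lemma ln_inv_gt (R : realType) (e M : R) : 0 < e -> e < expR (- M) -> M < ln (1 / e).
Proof.
by move=> e0 h; rewrite div1r lnV ?posrE// ltrNr -ltr_expR lnK ?posrE.
Qed.

Lemma ln_inv_half (R : realType) (e : R) : 0 < e -> ln (1 / (e / 2)) = ln (1 / e) + ln 2.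
Proof.
by move=> e0; rewrite -lnM ?posrE ?divr_gt0//; congr ln; field; rewrite lt0r_neq0.
Qed.

Lemma ln2_ge0 (R : realType) : 0 <= (ln 2 : R).
Proof. by rewrite ln_ge0// ler1n. Qed.

Lemma real_between (R : realType) (x y : \bar R) : (x < y)%E ->
  exists2 q : R, (x < q%:E)%E & (q%:E < y)%E.
Proof.
case: x y => [t| |] [r| |]// h.
- by exists ((t + r) / 2); move: h; rewrite !lte_fin; lra.
- by exists (t + 1); rewrite ?ltry// lte_fin; lra.
- by exists (r - 1); rewrite ?ltNyr// lte_fin; lra.
- by exists 0; rewrite ?ltNyr ?ltry.
Qed.

(** * The variational principle *)

Section Elimsup0.
Context (R : realType).
Implicit Types v w : R -> \bar R.
Local Notation rate v := (fun e => v e * ((ln (1 / e))^-1)%:E)%E.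

Lemma elimsup0_ge0 v : (forall e, 0 < e -> (0 <= v e)%E) -> (0 <= elimsup0 (rate v))%E.
Proof.
move=> v0; apply: le_ereal_inf_tmp => _ [del /= d0 <-]; apply: le_ereal_sup_tmp.
have m0 : 0 < Num.min del 1 by rewrite lt_min d0 ltr01.
pose e := Num.min del 1 / 2; have e0 : 0 < e by rewrite divr_gt0.
have em : e < Num.min del 1 by rewrite /e; lra.
have /andP[ed e1] : (e < del) && (e < 1) by move: em; rewrite lt_min.
exists (v e * ((ln (1 / e))^-1)%:E)%E; first by exists e => //=; rewrite e0.
apply: mule_ge0; first exact: v0.
by rewrite lee_fin invr_ge0 ln_ge0// ler_pdivlMr// mul1r ltW.
Qed.

(** Halving the scale adds only ln 2 to the denominator, and C is divided by ln (1 / e), which tends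
    to infinity; neither affects the limsup. *)
Lemma elimsup0_half v w (C : R) : 0 <= C -> (forall e, 0 < e -> (0 <= w e)%E) ->
  (forall e, 0 < e -> (v e <= w (e / 2)%R + C%:E)%E) ->
  (elimsup0 (rate v) <= elimsup0 (rate w))%E.
Proof.
move=> C0 w0 vw; have := elimsup0_ge0 w0.
case E : (elimsup0 _) => [L| |]// L0; last by rewrite leey.
rewrite lee_fin in L0; apply/lee_addgt0Pr => eta eta0; rewrite -EFinD.
pose A := L + eta / 2; have A0 : 0 < A by rewrite /A; lra.
have : (elimsup0 (rate w) < A%:E)%E by rewrite E lte_fin /A; lra.
move=> /ereal_inf_lt[_ [del /= d0 <-]] hdel.
(* For ln (1 / e) > M0 the terms A ln 2 + C <= A + C are at most eta / 2 times ln (1 / e). *)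
pose M0 := (A + C) / (eta / 2) + 1.
have eta2 : 0 < eta / 2 by lra.
have M00 : 0 < M0 by rewrite ltr_wpDl// divr_ge0//; lra.
apply: ge_ereal_inf; exists (ereal_sup [set (rate v) e | e in [set e | 0 < e < Num.min del (expR (- M0))]]).
  by exists (Num.min del (expR (- M0))) => //=; rewrite lt_min d0 expR_gt0.
apply: ge_ereal_sup => y [e /= /andP[e0]]; rewrite lt_min => /andP[ed /(ln_inv_gt e0) eM] <-.
set M := ln (1 / e) in eM *; have Mp : 0 < M by exact: lt_trans eM.
have e2 : 0 < e / 2 by lra.
have : ((rate w) (e / 2)%R <= A%:E)%E.
  apply: ltW; apply: le_lt_trans hdel; apply: ereal_sup_ubound.
  by exists (e / 2) => //=; rewrite e2; lra.
have := vw e e0; have := w0 _ e2; rewrite /= ln_inv_half// -/M.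
have l20 := ln2_ge0 R; have l21 := @ln2_le1 R.
have Ml : 0 < M + ln 2 by lra.
case: (w (e / 2)) => [r| |]// _; last by rewrite gt0_mulye ?lte_fin ?invr_gt0// => _; rewrite leye_eq.
rewrite -EFinD -EFinM lee_fin ler_pdivrMr// => ve rA.
apply: (@le_trans _ _ ((r + C)%:E * (M^-1)%:E)%E).
  by apply: lee_wpmul2r => //; rewrite lee_fin invr_ge0 ltW.
rewrite -EFinM lee_fin ler_pdivrMr//.
have : A + C <= eta / 2 * M.
  rewrite mulrC -ler_pdivrMr//; apply: ltW; apply: lt_trans eM.
  by rewrite /M0; move: ((A + C) / (eta / 2)) => t; lra.
have : A * ln 2 <= A * 1 by rewrite ler_pM2l.
have -> : (L + eta) * M = A * M + eta / 2 * M by rewrite /A; lra.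
by move: rA; rewrite mulrDr; lra.
Qed.
End Elimsup0.

Section Variational.
Context (R : realType) (G : countType) (mul : G -> G -> G) (one : G) (inv : G -> G).
Context (hG : is_group mul one inv) (hinf : ~ finite_set [set: G]).
Context (dsp : measure_display) (X : measurableType dsp).
Context (d : X -> X -> R) (hd : is_metric d) (hcpt : dcompact d).
Context (hborel : @measurable dsp X = <<s [set U | dopen d U] >>).
Context (act : G -> X -> X) (hact : is_action mul one act).
Context (hcont : forall g, dcontinuous d d (act g)).
Context (F : nat -> {fset G}) (hF : Folner R mul F).

Lemma mdimM_meas_le mu : (mdimM_meas d act F mu <= mdimM_top d act F)%E.
Proof.
apply: ge_ereal_sup => _ [fam /= [mus [hdec _]] <-].
apply: (elimsup0_half (C := 11)) => // [e e0|e e0]; first exact: htop_eps_ge0.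
have [lam0 lam1 _ erg _] := hdec e e0.
have h j := h_eps_upper hG hinf hd hcpt hborel hact hcont hF (erg j) e0.
have := htop_eps_ge0 d act F (e / 2).
move: h; case: (htop_eps _ _ _ _) => [r| |]// h r0; last by rewrite leey.
have H1 : (Fval d act F (fam e) e <= \sum_j (ec_lam (e:=fam e) j)%:E * (r + 11)%:E)%E.
  by apply: lee_sum => j _; apply: lee_wpmul2l; rewrite ?lee_fin ?(ltW (lam0 j)).
apply: (le_trans H1).
under eq_bigr do rewrite -EFinM.
by rewrite sumEFin -mulr_suml lam1 mul1r.
Qed.

Lemma ergodic_rate (q del : R) : (q%:E < mdimM_top d act F)%E -> 0 < del ->
  exists (e : R) (nu : probability X R), [/\ 0 < e, e < del, ergodic act nu &
    (q%:E <= h_eps d act F nu e * ((ln (1 / e))^-1)%:E)%E].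
Proof.
move=> qL d0.
have [q' qq' q'L] := real_between qL; rewrite lte_fin in qq'.
have dq : 0 < q' - q by lra.
(* Beyond M0 the gap (q' - q) ln (1 / e) exceeds |q|, hence also the term q ln 2 caused by passing
   to e / 2. *)
pose M0 := `|q| / (q' - q) + 1.
have M00 : 0 < M0 by rewrite ltr_wpDl// divr_ge0// ltW.
pose del' := Num.min del (expR (- M0)).
have d'0 : 0 < del' by rewrite lt_min d0 expR_gt0.
have := lt_le_trans q'L (ereal_inf_lbound (ex_intro2 _ _ del' d'0 erefl)).
move=> /ereal_sup_gt[y [e /= /andP[e0]]]; rewrite lt_min => /andP[ed /(ln_inv_gt e0) eM] <-.
set M := ln (1 / e) in eM *; have Mp : 0 < M by exact: lt_trans eM.
move=> hq; have hc : ((q' * M)%:E < htop_eps d act F e)%E.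
  move: hq; have := htop_eps_ge0 d act F e.
  case: (htop_eps _ _ _ _) => [r| |]// _; last by rewrite ltry.
  by rewrite -EFinM !lte_fin ltr_pdivlMr.
have [nu [enu gnu]] := good_ergodic_exists hG hinf hd hcpt hborel hact hcont hF e0 hc.
(* [good] at e controls partitions of diameter strictly below e, whereas [h_eps] allows diameters
   equal to its scale; half the scale restores the strict bound. *)
exists (e / 2), nu; split => //; [lra|lra|].
have e2 : e / 2 < e by lra.
have h := h_eps_ge_good hG hborel hact hcont hF (proj1 enu) gnu e2.
have l20 := ln2_ge0 R; have l21 := @ln2_le1 R.
have Ml : 0 < M + ln 2 by lra.
rewrite ln_inv_half// -/M.
apply: (@le_trans _ _ ((q' * M)%:E * ((M + ln 2)^-1)%:E)%E); last first.
  by apply: lee_wpmul2r => //; rewrite lee_fin invr_ge0 ltW.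
rewrite -EFinM lee_fin ler_pdivlMr//.
have : `|q| <= (q' - q) * M.
  rewrite mulrC -ler_pdivrMr//; apply: ltW; apply: lt_trans eM.
  by rewrite /M0 ltrDl.
have : q * ln 2 <= `|q|.
  apply: (le_trans (ler_norm _)); rewrite normrM (ger0_norm l20).
  by rewrite ler_piMr.
by rewrite mulrDr mulrBl; lra.
Qed.

Lemma approximating_rates (L : \bar R) : (0 <= L)%E -> exists qs : nat -> R,
  (forall p, ((qs p)%:E < L)%E) /\
  forall q, (q%:E < L)%E -> exists P, forall p, (P <= p)%N -> q <= qs p.
Proof.
case: L => [r| |]// _.
  exists (fun p => r - p.+1%:R^-1); split => [p|q].
    by rewrite lte_fin ltrBlDr ltrDl invr_gt0.
  rewrite lte_fin => qr; have rq : 0 < r - q by lra.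
  have [P _ hP] := near_infty_natSinv_lt (PosNum rq).
  exists P => p pP; have : p.+1%:R^-1 < r - q := hP p pP; move: (p.+1%:R^-1) => t; lra.
exists (fun p => p%:R); split => [p|q _]; first by rewrite ltry.
exists (Num.truncn `|q|).+1 => p pP; apply: (le_trans (ler_norm _)).
by apply: (@le_trans _ _ (Num.truncn `|q|).+1%:R); [exact/ltW/truncnS_gt|rewrite ler_nat].
Qed.

(** An ultralimit converges along an ultrafilter only, whereas a family in M_G(mu) must converge as
    e tends to 0. The index k P satisfies the bounds on the first P + 1 base sets up to 1 / (P + 1);
    every open set is an increasing union of base sets, so the bounds extend to all of them. *)
Lemma weak_subsequence (nus : nat -> probability X R) :
  (forall p, invariant_measure act (nus p)) ->
  exists (mu : probability X R) (k : nat -> nat), [/\ invariant_measure act mu,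
    forall P, (P <= k P)%N &
    forall V a, dopen d V -> 0 < a -> \forall P \near \oo, pm mu V - a <= pm (nus (k P)) V].
Proof.
move=> inus; have [U [uU sU]] := free_ultrafilter.
have [mu rmu] := limit_exists hd hcpt hborel uU sU nus.
have [Q [oQ hQ]] := countable_base hd hcpt.
have near_mu V a : dopen d V -> 0 < a -> U [set p | pm mu V - a <= pm (nus p) V].
  move=> oV a0; have hf n := fap_pm (nus n).
  have := mlim_cvg uU hf (dopen_measurable hborel oV) => /cvgrPdist_le /(_ _ a0).
  apply: filterS => p /=.
  have : pm mu V <= mlim U (fun n => pm (nus n)) V.
    case: rmu => mulam _; rewrite mulam//.
    exact: (lam_le_open hborel (fap_mlim uU sU hf) oV).
  by rewrite ler_norml => h /andP[_]; lra.
have step P : exists k, (P <= k)%N /\ forall i : 'I_P.+1, pm mu (Q i) - P.+1%:R^-1 <= pm (nus k) (Q i).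
  apply: (@filter_ex _ U); apply: filterI; first by apply: sU; exact: nbhs_infty_ge.
  apply: filter_forall => i; apply: near_mu; first exact: oQ.
  by rewrite invr_gt0.
have [k hk] := choice step.
exists mu, k; split.
- by apply: (limit_invariant hG hborel hact hcont uU sU rmu); apply: nearW.
- by move=> P; have [] := hk P.
move=> V a oV a0; have [j [jm VE]] := hQ V oV.
have mO n : measurable (Q (j n)) by exact: (dopen_measurable hborel (oQ _)).
have := @pm_bigcup_cvg _ _ _ mu _ mO jm; rewrite -VE.
have a2 : 0 < a / 2 by lra.
move=> /cvgrPdist_le /(_ _ a2) h; have [n] := filter_ex h; rewrite /= => hn.
have h2 : \forall P \near \oo, P.+1%:R^-1 < (a / 2 : R) := near_infty_natSinv_lt (PosNum a2).
have h1 := nbhs_infty_ge (j n).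
apply: filterS2 h1 h2 => P /= jP Pa.
have [_ /(_ (Ordinal (leq_ltn_trans jP (ltnSn P)))) /= hP] := hk P.
have : pm (nus (k P)) (Q (j n)) <= pm (nus (k P)) V.
  apply: fap_le => //; [exact: fap_pm|exact: (dopen_measurable hborel oV)|].
  by rewrite VE; exact: bigcup_sup.
by move: hn; rewrite ler_norml => /andP[_]; move: hP Pa; move: (P.+1%:R^-1 : R) => t; lra.
Qed.

(** A family needs a measure at every e, with a prescribed one at each scale es P; elsewhere any
    index tending to infinity will do, here the integer part of 1 / e. If several indices share a
    scale, one of them is chosen. The first P0 scales are bounded away from 0, so p e tends to
    infinity as e tends to 0. *)
Lemma scale_index (es : nat -> R) : (forall P, 0 < es P) -> exists p : R -> nat,
  (forall P, es (p (es P)) = es P) /\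
  forall P0, exists2 del, 0 < del & forall e, 0 < e -> e < del -> (P0 <= p e)%N.
Proof.
move=> es0; pose p e := if pselect (exists P, es P = e) is left h then projT1 (cid h)
  else Num.truncn (1 / e).
exists p; split.
  move=> P; rewrite /p; case: pselect => [h|]; first by case: cid.
  by case; exists P.
move=> P0.
have [m m0 hm] : exists2 m, 0 < m & forall P, (P < P0)%N -> m <= es P.
  elim: P0 => [|P0 [m m0 hm]]; first by exists 1.
  exists (Num.min m (es P0)); first by rewrite lt_min m0 es0.
  move=> P; rewrite ltnS leq_eqVlt ge_min => /orP[/eqP->|/hm ->//].
  by rewrite lexx orbT.
exists (Num.min m P0.+1%:R^-1); first by rewrite lt_min m0 /= invr_gt0.
move=> e e0; rewrite lt_min => /andP[em eP]; rewrite /p; case: pselect => [h|_].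
  case: cid => P /= PE; rewrite leqNgt; apply/negP => /hm.
  by rewrite PE leNgt em.
rewrite truncn_ge_nat ?divr_ge0 ?(ltW e0)// ler_pdivlMr//.
apply: (@le_trans _ _ (P0.+1%:R * e)); first by rewrite ler_pM2r// ler_nat.
by rewrite mulrC -ler_pdivlMr// div1r ltW.
Qed.

Lemma maximizing_measure : exists mu : probability X R,
  invariant_measure act mu /\ (mdimM_top d act F <= mdimM_meas d act F mu)%E.
Proof.
have L0 : (0 <= mdimM_top d act F)%E.
  by apply: elimsup0_ge0 => e _; exact: htop_eps_ge0.
have [qs [qsL hqs]] := approximating_rates L0.
have hq p : exists en : R * probability X R, [/\ 0 < en.1, en.1 < p.+1%:R^-1, ergodic act en.2 &
    ((qs p)%:E <= h_eps d act F en.2 en.1 * ((ln (1 / en.1))^-1)%:E)%E].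
  have p0 : 0 < p.+1%:R^-1 :> R by rewrite invr_gt0.
  by have [e [nu h]] := ergodic_rate (qsL p) p0; exists (e, nu).
have [en hen] := choice hq.
have inv_en p : invariant_measure act (en p).2 by have [_ _ []] := hen p.
have [mu [k [imu kP hmu]]] := weak_subsequence inv_en.
pose es P := (en (k P)).1; pose nu P := (en (k P)).2.
have es0 P : 0 < es P by case: (hen (k P)).
have [p [pes pinf]] := scale_index es0.
(* One ergodic measure per scale, viewed as a convex combination with a single term; the weak limit
   mu need not be ergodic. *)
pose fam (e : R) : ecomb R X := @ECombo R dsp X 1 (fun=> 1) (fun=> nu (p e)).
exists mu; split => //; apply: le_ereal_sup_tmp.
exists (elimsup0 (fun e => Fval d act F (fam e) e * ((ln (1 / e))^-1)%:E)%E).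
  exists fam => //; exists (fun e => nu (p e)); split.
    move=> e _; split => /=.
    - by move=> _.
    - by rewrite big_ord1.
    - by move=> i j _; rewrite !ord1.
    - by move=> _; case: (hen (k (p e))).
    - by move=> A _; rewrite big_ord1 mul1e.
  move=> f cf; have /= hw := weak_limit hd hcpt hborel cf hmu.
  apply: (cvg_comp _ _ _ hw) => A [N _ hN].
  have [del d0 hdel] := pinf N; suff : \forall e \near (0 : R)^'+, A (p e) by [].
  near=> e; have e0 : 0 < e by near: e; exact: nbhs_right_gt.
  have ed : e < del by near: e; exact: nbhs_right_lt.
  by apply: hN; exact: hdel e e0 ed.
apply: le_ereal_inf_tmp => _ [del /= d0 <-].
rewrite leNgt; apply/negP => hlt.
have [q hq1 hq2] := real_between hlt.
have [P0 hP0] := hqs q hq2.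
have [del1 d10 hdel1] := pinf P0.
have m0 : 0 < Num.min del del1 by rewrite lt_min d0 d10.
have [P _ /(_ P (leqnn _)) hP] := near_infty_natSinv_lt (PosNum m0).
have eP : es P < Num.min del del1.
  apply: lt_trans (hP : P.+1%:R^-1 < _); have [_ h _ _] := hen (k P).
  by apply: (lt_le_trans h); rewrite lef_pV2 ?posrE// ler_nat ltnS.
move: eP; rewrite lt_min => /andP[ed ed1].
have : (q%:E <= Fval d act F (fam (es P)) (es P) * ((ln (1 / es P))^-1)%:E)%E.
  (* The index p (es P) may differ from P but has the same scale, so the bound for its measure
     applies at es P. *)
  rewrite /Fval big_ord1 mul1e /= -{2 3}(pes P).
  have [_ _ _] := hen (k (p (es P))); apply: le_trans.
  by rewrite lee_fin; apply: hP0; apply: leq_trans (kP _); exact: hdel1.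
rewrite leNgt => /negP; apply; apply: le_lt_trans hq1; apply: ereal_sup_ubound.
by exists (es P) => //=; rewrite es0.
Unshelve. all: by end_near.
Qed.
End Variational.

Theorem theorem1p1
  (R : realType)
  (G : countType) (mul : G -> G -> G) (one : G) (inv : G -> G)
  (hG : is_group mul one inv) (hGinf : ~ finite_set [set: G])
  (dsp : measure_display) (X : measurableType dsp)
  (d : X -> X -> R) (hd : is_metric d) (hcpt : dcompact d)
  (hborel : @measurable dsp X = <<s [set U | dopen d U] >>)
  (act : G -> X -> X) (hact : is_action mul one act)
  (hcont : forall g, dcontinuous d d (act g))
  (F : nat -> {fset G}) (hF : Folner R mul F) (htemp : tempered R mul inv F) :
  mdimM_top d act F
    = ereal_sup [set mdimM_meas d act F mu
                | mu in [set mu : probability X R | invariant_measure act mu]]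
  /\ exists mu : probability X R,
       invariant_measure act mu /\ mdimM_meas d act F mu = mdimM_top d act F.
Proof.
have ub := mdimM_meas_le hG hGinf hd hcpt hborel hact hcont hF.
have [mu [imu lb]] := maximizing_measure hG hGinf hd hcpt hborel hact hcont hF.
have muE : mdimM_meas d act F mu = mdimM_top d act F.
  by apply/eqP; rewrite eq_le ub lb.
split; last by exists mu.
apply/eqP; rewrite eq_le; apply/andP; split.
  by apply: ereal_sup_ubound; exists mu.
by apply: ge_ereal_sup => _ [nu _ <-].
Qed.
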